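(* Let $(\Omega,d,\mu)$ be a locally compact, non-complete metric measure space, with $\mu$ a doubling measure. Suppose also that $\partial\Omega:=\overline\Omega\setminus\Omega$ is equipped with a Borel measure $\nu$ which is codimension $\theta$ Ahlfors regular with respect to $\mu$ for some $\theta>0$. Let $0<\alpha<1$, $1\le p<\infty$, and $1\le q\le\infty$ be such that $\alpha<1-\theta/p$. Then there exists a bounded linear extension operator $$E:B^\alpha_{p,q}(\partial\Omega,\nu)\to B^{\alpha+\theta/p}_{p,q}(\Omega,\mu).$$ In particular, there exists $C\ge 1$, depending only on $\alpha$, $p$, $q$, $\theta$, as well as the doubling and codimensional Ahlfors regularity constants, such that $$\|Ef\|_{L^p(\Omega,\mu)}\le C\|f\|_{L^p(\partial\Omega,\nu)}$$ and $$\|Ef\|_{HB^{\alpha+\theta/p}_{p,q}(\Omega,\mu)}\le C\left(\|f\|_{HB^\alpha_{p,q}(\partial\Omega,\nu)}+\|f\|_{L^p(\partial\Omega,\nu)}\right)$$ for all $f\in B^\alpha_{p,q}(\partial\Omega,\nu)$.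
   Context: Doubling: a Borel measure $\mu$ on a metric space is doubling if there is $C_\mu\ge 1$ (the doubling constant) with $0<\mu(B(x,2r))\le C_\mu\,\mu(B(x,r))<\infty$ for all points $x$ and all $r>0$. Boundary: $\overline\Omega$ is the metric completion of $\Omega$; since $\Omega$ is locally compact it is open in $\overline\Omega$. The measure $\mu$ is extended to $\overline\Omega$ by zero (i.e. $\mu(\partial\Omega)=0$). Balls $B(z,r)$ centered at $z\in\partial\Omega$ are balls of $\overline\Omega$. Codimension $\theta$ Ahlfors regularity: $\nu$ is codimension $\theta$ Ahlfors regular with respect to $\mu$ if there is $C_\theta\ge 1$ such that for all $z\in\partial\Omega$ and $0<r\le 2\operatorname{diam}(\partial\Omega)$, $$\frac{1}{C_\theta}\frac{\mu(B(z,r)\cap\Omega)}{r^\theta}\le\nu(B(z,r)\cap\partial\Omega)\le C_\theta\frac{\mu(B(z,r)\cap\Omega)}{r^\theta}.$$ Besov spaces: for a metric measure space $(X,d,\mu)$, $0<\alpha<1$, $1\le p<\infty$ and $f\in L^1_{\mathrm{loc}}(X,\mu)$, set $$\|f\|_{HB^\alpha_{p,q}(X,\mu)}:=\left(\int_0^\infty\left(\int_X\frac{1}{\mu(B(x,t))}\int_{B(x,t)}|f(y)-f(x)|^p\,d\mu(y)\,d\mu(x)\right)^{q/p}\frac{dt}{t^{\alpha q+1}}\right)^{1/q}$$ for $1\le q<\infty$, and $$\|f\|_{HB^\alpha_{p,\infty}(X,\mu)}:=\sup_{t>0}\frac{1}{t^{\alpha}}\left(\int_X\frac{1}{\mu(B(x,t))}\int_{B(x,t)}|f(y)-f(x)|^p\,d\mu(y)\,d\mu(x)\right)^{1/p}.$$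 $HB^\alpha_{p,q}(X,\mu)$ is the class of $f\in L^1_{\mathrm{loc}}(X,\mu)$ for which this seminorm is finite. The inhomogeneous Besov space is $B^\alpha_{p,q}(X,\mu):=HB^\alpha_{p,q}(X,\mu)\cap L^p(X,\mu)$ with norm $\|f\|_{HB^\alpha_{p,q}(X,\mu)}+\|f\|_{L^p(X,\mu)}$. Extension operator: a linear operator $E$ from functions on $\partial\Omega$ to functions on $\Omega$ is an extension operator if for each $f$ in its domain, $\lim_{r\to0^+}\frac{1}{\mu(B(z,r))}\int_{B(z,r)}|Ef-f(z)|\,d\mu=0$ for $\nu$-a.e. $z\in\partial\Omega$.
   Formalization: The constant C may also depend on a positive lower bound for diam(∂Ω), and on the space itself if ∂Ω is a single point; with dependence only on the listed data the claim fails, e.g. for the plane minus a segment of length h→0 with f=1. *)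

(* Defs.v *)
From HB Require Import structures.
From mathcomp Require Import all_boot all_order all_algebra.
From mathcomp Require Import all_classical all_reals all_analysis.

Set Implicit Arguments.
Unset Strict Implicit.
Unset Printing Implicit Defensive.

Import Order.TTheory GRing.Theory Num.Theory.
Import numFieldNormedType.Exports.

Local Open Scope classical_set_scope.
Local Open Scope ring_scope.

HB.mixin Record isBorel (d : measure_display) T
    of Measurable d T & Topological T := {
  measurable_borelE : (@measurable d T : set (set T)) = <<s @open T >>
}.

(* Metric spaces whose measurable sets are exactly the Borel sets; a Borel
   measure on such a T is an element of {measure set T -> \bar R}. *)
#[short(type="borelMetricType")]
HB.structure Definition BorelMetric (K : numDomainType) (d : measure_display) :=
  { T of Metric K T & Measurable d T & isBorel d T }.

Definition complete_space (T : uniformType) : Prop :=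
  forall F : set_system T, ProperFilter F -> cauchy F -> exists x : T, F --> x.

(* A metric completion of X, which is unique up to isometry. *)
Record completion (R : realType) (X : metricType R) := Completion {
  cspace : metricType R;
  cembed : X -> cspace;
  cembed_isometry : forall x y, mdist (cembed x) (cembed y) = mdist x y;
  cembed_dense : closure (range cembed) = [set: cspace];
  cspace_complete : complete_space cspace
}.
Arguments cspace {R X} c.
Arguments cembed {R X} c.

Section boundary_set.
Context (R : realType) (X : metricType R) (c : completion X).

Definition boundary_set : set (cspace c) := ~` range (cembed c).

Lemma boundary_set_neq0 : ~ complete_space X -> boundary_set !=set0.
Proof.
move=> ncX; apply: contrapT => b0; apply: ncX => F FF cF.
have surj y : exists x, cembed c x = y.
  by apply: contrapT => h; apply: b0; exists y => -[x _ xy]; apply: h; exists x.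
have FG : ProperFilter (cembed c @ F) by exact: fmap_proper_filter.
have [|y Fy] := @cspace_complete _ _ c (cembed c @ F) FG.
  apply/cauchy_ballP => e e0.
  have /cauchy_ballP/(_ _ e0) := cF.
  move=> [[A B] /= [FA FB] AB].
  exists (cembed c @` A, cembed c @` B) => /=.
    by split; [apply: filterS FA|apply: filterS FB] => x ? /=; exists x.
  move=> [_ _] /= [[a Aa <-] [b Bb <-]].
  have := AB (a, b) (conj Aa Bb).
  by rewrite /= !ballEmdist/= cembed_isometry.
have [x xy] := surj y; exists x.
apply/cvg_ballP => e e0.
have := Fy; move/cvg_ballP => /(_ e e0).
rewrite /= near_simpl /=; apply: filterS => z.
by rewrite -xy !ballEmdist /= cembed_isometry.
Qed.

End boundary_set.
Arguments boundary_set {R X} c _ : rename.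
Arguments boundary_set_neq0 {R X} c _ : rename.

(* The boundary as a type. The proof that X is not complete is a parameter
   because measurable types are pointed, hence inhabited. *)
Definition boundary (R : realType) (X : metricType R) (c : completion X)
  (ncX : ~ complete_space X) : Type := set_type (boundary_set c).

Section boundary_instances.
Context (R : realType) (X : metricType R) (c : completion X).
Context (ncX : ~ complete_space X).
Local Notation bX := (boundary c ncX).

HB.instance Definition _ := Choice.copy bX (set_type (boundary_set c)).

Definition boundary_val (z : bX) : cspace c := set_val z.

Let bdist (z w : bX) : R := mdist (boundary_val z) (boundary_val w).

Let bdistxx z : bdist z z = 0. Proof. exact: mdistxx. Qed.

Let bdist_positivity z w : bdist z w = 0 -> z = w.
Proof. by move=> /mdist_positivity/val_inj. Qed.

Let bdist_sym z w : bdist z w = bdist w z.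
Proof. exact: metric_sym. Qed.

Let bdist_triangle w z v : bdist z v <= bdist z w + bdist w v.
Proof. exact: metric_triangle. Qed.

HB.instance Definition _ :=
  isMetric.Build R bX bdistxx bdist_positivity bdist_sym bdist_triangle.

Let boundary_point : bX :=
  let h := cid (boundary_set_neq0 c ncX) in exist _ (sval h) (mem_set (svalP h)).

HB.instance Definition _ := isPointed.Build bX boundary_point.

HB.instance Definition _ := @isMeasurable.Build (sigma_display (@open bX)) bX
  <<s @open bX >> (@sigma_algebra0 _ setT _) (@sigma_algebraC _ _)
  (@sigma_algebra_bigcup _ setT _).

HB.instance Definition _ := @isBorel.Build (sigma_display (@open bX)) bX erefl.

End boundary_instances.

Local Open Scope ereal_scope.

Definition diam (R : realType) (T : metricType R) : \bar R :=
  ereal_sup [set (mdist z.1 z.2)%:E | z in [set: T * T]].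

Definition doubling_with (R : realType) d (T : borelMetricType R d)
    (mu : {measure set T -> \bar R}) (C : R) : Prop :=
  (1 <= C)%R /\ forall (x : T) (r : R), (0 < r)%R ->
    [/\ 0 < mu (ball x (2 * r)%R),
        mu (ball x (2 * r)%R) <= C%:E * mu (ball x r) &
        C%:E * mu (ball x r) < +oo].

Section besov.
Context (R : realType) (d : measure_display) (T : borelMetricType R d).
Variable mu : {measure set T -> \bar R}.
Implicit Types (f : T -> R) (alpha p t : R) (q : \bar R).

Definition L1loc f : Prop := measurable_fun [set: T] f /\
  forall x, exists2 r, (0 < r)%R & mu.-integrable (ball x r) (EFin \o f).

Definition besov_osc p t f : \bar R :=
  \int[mu]_x ((mu (ball x t))^-1 *
              \int[mu]_(y in ball x t) (`|f y - f x| `^ p)%:E).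

(* The second branch is the case q = +oo; q = -oo is excluded by 1 <= q. *)
Definition HBnorm alpha p q f : \bar R :=
  match q with
  | r%:E => (\int[lebesgue_measure]_(t in [set t : R | (0 < t)%R])
               (besov_osc p t f `^ (r / p) / (t `^ (alpha * r + 1))%:E)) `^ r^-1
  | _ => ereal_sup [set (t `^ alpha)^-1%:E * besov_osc p t f `^ p^-1
                   | t in [set t : R | (0 < t)%R]]
  end.

Definition HBesov alpha p q : set (T -> R) :=
  [set f | L1loc f /\ HBnorm alpha p q f < +oo].

(* Elements are functions rather than classes modulo equality mu-a.e. A linear
   operator bounded in L^p, as a map of functions, descends to the classes. *)
Definition Besov alpha p q : set (T -> R) :=
  HBesov alpha p q `&` [set f | f \in Lfun mu p%:E].

End besov.

Section boundary_theory.
Context (R : realType) (d : measure_display) (Om : borelMetricType R d).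
Variable mu : {measure set Om -> \bar R}.
Context (c : completion Om) (ncOm : ~ complete_space Om).
Local Notation bOm := (boundary c ncOm).

(* The trace on Om of the ball B(z, r) of the completion. Its mu-measure is the
   measure of B(z, r) for the extension of mu by zero. *)
Definition trace_ball (z : bOm) (r : R) : set Om :=
  cembed c @^-1` ball (boundary_val z) r.

Definition codim_regular_with (nu : {measure set bOm -> \bar R}) (theta C : R) :
    Prop :=
  (1 <= C)%R /\ forall (z : bOm) (r : R), (0 < r)%R -> r%:E <= 2%:E * diam bOm ->
    C^-1%:E * (mu (trace_ball z r) / (r `^ theta)%:E) <= nu (ball z r) /\
    nu (ball z r) <= C%:E * (mu (trace_ball z r) / (r `^ theta)%:E).

Definition linear_on (D : set (bOm -> R)) (E : (bOm -> R) -> (Om -> R)) : Prop :=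
  forall (a : R) (f g : bOm -> R), D f -> D g ->
    E (fun z => (a * f z + g z)%R) = (fun x => (a * E f x + E g x)%R).

Definition extension_on (nu : {measure set bOm -> \bar R})
    (D : set (bOm -> R)) (E : (bOm -> R) -> (Om -> R)) : Prop :=
  forall f, D f -> {ae nu, forall z : bOm,
    ((mu (trace_ball z r))^-1 *
      \int[mu]_(x in trace_ball z r) `|E f x - f z|%:E) @[r --> 0^'+] --> 0}.

End boundary_theory.

(* Main.v *)
Require Import Defs.
From HB Require Import structures.
From mathcomp Require Import all_boot all_order all_algebra.
From mathcomp Require Import all_classical all_reals all_analysis.
From mathcomp Require Import measurable_realfun lra ring.

(** Write delta x for the distance from x to the boundary. The extension of f
    is the mean Av f x of f for the Lipschitz weight (4 delta x - d(x, z))_+,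
    multiplied by the cutoff (1 - 2 delta / R1)_+. It is linear in f, and the
    explicit weight does the work of a Whitney covering with a subordinate
    partition of unity.

    On a Whitney region delta ~ rho close to a boundary point w, the weight is
    comparable to the indicator of B(w, 16 rho). So |Av f|^p is at most a
    multiple of the mean of |f|^p over that ball (Av_pow), and Av f is
    Lipschitz there with a slope of order 1 / rho times the mean of |f - c|,
    for any constant c (Av_diff_pow). A trace ball of radius rho has mu-measure
    comparable to rho^theta times the nu-measure of the boundary ball; summing
    over a net of boundary points with bounded overlap hence transfers
    integrals over the layer delta ~ rho to the boundary with a gain rho^theta
    (layer_bound). The gains of the layers rho / 2^k are summable because
    theta > 0, and this bounds Av in L^p (Av_Lp_outer).

    Let osc_g(t) be the double integral inside the Besov seminorm of g. At a
    scale t ~ tau the points with delta < 8 tau contribute at most a multiple of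
    tau^theta osc_f(c tau), as Av f is there close in L^p to the means of f over
    balls of radius c tau (near_osc_Av). A layer delta ~ rho > 8 tau contributes
    (tau / rho)^p rho^theta osc_f(c rho), by the Lipschitz bound (far_osc).
    After division by tau^(s p), where s = alpha + theta / p, these estimates
    become a recursion b_(k+1) <= a_(k+1) + lam b_k between the normalised
    oscillations of Ext f and of f at the dyadic scales. Here lam = 2^(s p - p)
    is less than 1 exactly because alpha < 1 - theta / p. A discrete Hardy
    inequality (lqb_rec) bounds the l^q norm of b by that of a, and these norms
    are the two Besov seminorms (HBnorm_lower, HBnorm_upper). The cutoff costs a
    multiple of the L^p norm of f.

    The trace comes from the same oscillations rather than from a
    differentiation theorem. The p-th power of the mean of |Av f - f z| over the
    trace ball of radius ~ tau_k about z is at most g_k z, for a function g_k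
    with integral at most a multiple of osc_f(c tau_k) (net_trace). Since f is
    in a Besov space these oscillations decay geometrically, so the sum of the
    g_k is finite almost everywhere and g_k tends to 0 (Ext_trace).

    The regularity of nu is available for radii up to twice the diameter. The
    height R1 of the collar is therefore a power 1 / 2^n adapted to the
    diameter, and K delta is the sum of the constants for all n up to a bound
    depending on delta. A boundary with a single point carries no regularity at
    all; there f is a constant, and its extension a multiple of the cutoff. *)

Set Implicit Arguments.
Unset Strict Implicit.
Unset Printing Implicit Defensive.

Import Order.TTheory GRing.Theory Num.Theory.
Import numFieldNormedType.Exports.

Local Open Scope classical_set_scope.
Local Open Scope ring_scope.
Local Open Scope ereal_scope.

(** * Integrals of nonnegative functions and elementary inequalities *)

Lemma nneseries_ge_term (R : realType) (u : (\bar R)^nat) k :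
  (forall n, 0 <= u n) -> u k <= \sum_(n <oo) u n.
Proof.
move=> u0; rewrite (@nneseriesD1 _ _ k xpredT)//= leeDl//.
by apply: nneseries_ge0.
Qed.

Section integral_tools.
Context d (T : measurableType d) (R : realType) (mu : {measure set T -> \bar R}).
Implicit Types (D : set T) (f g : T -> \bar R).

(** The integral of a nonnegative function is the supremum of the integrals of
    the nonnegative simple functions below it, so it is monotone on arbitrary
    functions. The integrands of a Besov seminorm, whose measurability is
    unclear, are estimated in this way throughout. *)
Lemma ge0_le_integral_outer D f g : (forall x, D x -> 0 <= f x) ->
  (forall x, D x -> f x <= g x) ->
  \int[mu]_(x in D) f x <= \int[mu]_(x in D) g x.
Proof.
move=> f0 fg; rewrite (integral_mkcond _ f) (integral_mkcond _ g).
have h0 x : 0 <= (f \_ D) x by apply: erestrict_ge0.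
have hg x : (f \_ D) x <= (g \_ D) x.
  by rewrite /patch; case: ifPn => // /set_mem; exact: fg.
rewrite !ge0_integralTE//; last by move=> x; exact: le_trans (hg x).
by apply: ereal_sup_le => _ [h hf <-]; exists h => // x; exact: le_trans (hg x).
Qed.

(** A bound on the upper integral of f over D. The integral itself is not
    additive on functions that may fail to be measurable, whereas the
    majorants g can be added, scaled and glued. *)
Definition outer_le D f (c : \bar R) := exists g : T -> \bar R, [/\ measurable_fun [set: T] g,
  (forall x, 0 <= g x), (forall x, D x -> f x <= g x) & \int[mu]_x g x <= c].

Lemma outer_leP f c : (forall x, 0 <= f x) -> outer_le setT f c ->
  \int[mu]_x f x <= c.
Proof.
move=> f0 [g [mg g0 fg gc]]; apply: le_trans gc.
by apply: ge0_le_integral_outer => // x _; exact: fg.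
Qed.

Lemma outer_le_bigcup (D : set T) (E : nat -> set T) f (c : nat -> \bar R) :
  D `<=` \bigcup_n E n -> (forall n, outer_le (E n) f (c n)) ->
  outer_le D f (\sum_(n <oo) c n).
Proof.
move=> DE /choice[g hg].
have g0 n x : 0 <= g n x by have [] := hg n.
exists (fun x => \sum_(n <oo) g n x); split.
- by apply: ge0_emeasurable_sum => // n; have [] := hg n.
- by move=> x; apply: nneseries_ge0.
- move=> x /DE[n _ Enx]; have [_ _ /(_ _ Enx) /le_trans fx _] := hg n; apply: fx.
  exact: (@nneseries_ge_term _ (fun n => g n x)).
- rewrite integral_nneseries//; last by move=> n; have [] := hg n.
  apply: lee_nneseries => [n _ _|n _]; last by have [] := hg n.
  by apply: integral_ge0 => x _; exact: g0.
Qed.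

Lemma outer_leD D f g h a b : (forall x, D x -> f x <= g x + h x) ->
  outer_le D g a -> outer_le D h b -> outer_le D f (a + b).
Proof.
move=> fgh [g' [mg g0 gg ga]] [h' [mh h0 hh hb]].
exists (fun x => g' x + h' x); split.
- exact: emeasurable_funD.
- by move=> x; exact: adde_ge0.
- by move=> x Dx; apply: (le_trans (fgh _ Dx)); apply: leeD; [exact: gg|exact: hh].
- by rewrite ge0_integralD//; exact: leeD.
Qed.

Lemma outer_leZ D f g (k : R) a : (0 <= k)%R ->
  (forall x, D x -> f x <= k%:E * g x) ->
  outer_le D g a -> outer_le D f (k%:E * a).
Proof.
move=> k0 fg [g' [mg g0 gg ga]].
exists (fun x => k%:E * g' x); split.
- exact: measurable_funeM.
- by move=> x; rewrite mule_ge0.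
- move=> x Dx; apply: (le_trans (fg _ Dx)); apply: lee_wpmul2l => //; exact: gg.
- by rewrite ge0_integralZl_EFin//; exact: lee_wpmul2l.
Qed.

Lemma outer_le_sub D E f g a b : D `<=` E -> (forall x, D x -> f x <= g x) ->
  a <= b -> outer_le E g a -> outer_le D f b.
Proof.
move=> DE fg ab [g' [mg g0 gg ga]]; exists g'; split => //.
  by move=> x Dx; apply: le_trans (fg _ Dx) (gg _ _); exact: DE.
exact: le_trans ab.
Qed.

Lemma outer_le_integral D f a : measurable D -> measurable_fun D f ->
  (forall x, D x -> 0 <= f x) -> \int[mu]_(x in D) f x <= a -> outer_le D f a.
Proof.
move=> mD mf f0 fa; exists (f \_ D); split.
- exact/(measurable_restrictT _ mD).
- exact: erestrict_ge0.
- by move=> x Dx; rewrite patchE mem_set.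
- by rewrite -integral_mkcond.
Qed.

End integral_tools.

Lemma powR_addle (R : realType) (p a b : R) : (0 <= p)%R -> (0 <= a)%R ->
  (0 <= b)%R -> ((a + b) `^ p <= 2 `^ p * (a `^ p + b `^ p))%R.
Proof.
move=> p0 a0 b0; wlog ab : a b a0 b0 / (a <= b)%R.
  move=> h; have [|/ltW] := leP a b; first exact: h.
  by rewrite addrC [(a `^ p + _)%R]addrC; exact: h.
apply: (@le_trans _ _ ((2 * b) `^ p)%R).
  by apply: ge0_ler_powR; rewrite ?nnegrE ?addr_ge0 ?mulr_ge0//; lra.
by rewrite powRM// ler_wpM2l ?powR_ge0// lerDr powR_ge0.
Qed.

Section jensen.
Context d (T : measurableType d) (R : realType) (mu : {measure set T -> \bar R}).

(** Hoelder's inequality for g and the indicator of D. *)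
Lemma jensen_powR (D : set T) (m p : R) (g : T -> R) : measurable D ->
  mu D = m%:E -> (0 < m)%R -> (1 <= p)%R -> measurable_fun [set: T] g ->
  (forall x, (0 <= g x)%R) ->
  (\int[mu]_(x in D) (g x)%:E) `^ p <=
  (m `^ (p - 1))%:E * \int[mu]_(x in D) (g x `^ p)%:E.
Proof.
move=> mD muD m0; rewrite le_eqVlt => /predU1P[<- mg g0|p1 mg g0].
  rewrite subrr powRr0 mul1e poweRe1; last first.
    by apply: integral_ge0 => x _; rewrite lee_fin.
  by under [in leRHS]eq_integral do rewrite powRr1//.
have p0 : (0 < p)%R by rewrite (lt_trans _ p1).
have [q [q0 pq qp]] : exists q : R,
    [/\ (0 < q)%R, (p^-1 + q^-1 = 1)%R & (q^-1 * p = p - 1)%R].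
  have p10 : (p - 1 != 0)%R by rewrite gt_eqF// subr_gt0.
  exists (p / (p - 1))%R; split; first by rewrite divr_gt0// subr_gt0.
    by rewrite invf_div; field; rewrite gt_eqF.
  by rewrite invf_div mulfVK// gt_eqF.
(* q is the exponent dual to p; p = 1 was set apart since it has none *)
have mgD : measurable_fun [set: T] (g \* \1_D)%R.
  by apply: measurable_funM => //; exact: measurable_indic.
have m1D : measurable_fun [set: T] (\1_D : T -> R) by exact: measurable_indic.
have := @hoelder _ _ _ mu _ _ p q mgD m1D p0 q0 pq.
rewrite Lnorm1 unlock.
have E1 : \int[mu]_x `|((g \* \1_D) \* \1_D)%R x|%:E = \int[mu]_(x in D) (g x)%:E.
  rewrite [RHS]integral_mkcond; apply: eq_integral => x _.
  rewrite /= patchE indicE; case: (x \in D); rewrite ?mulr1 ?mulr0 ?normr0//.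
  by rewrite ger0_norm.
have E2 : \int[mu]_x (`|((g \* \1_D)%R x)%:E| `^ p) = \int[mu]_(x in D) (g x `^ p)%:E.
  rewrite [RHS]integral_mkcond; apply: eq_integral => x _.
  rewrite /= patchE indicE; case: (x \in D); rewrite ?mulr1 ?mulr0 ?normr0//.
    by rewrite ger0_norm.
  by rewrite powR0// gt_eqF.
have E3 : \int[mu]_x (`|(\1_D x : R)%:E| `^ q) = m%:E.
  rewrite -muD -[in RHS](setIT D) -(integral_indic mu measurableT mD).
  apply: eq_integral => x _; rewrite [LHS]/= indicE; case: (x \in D).
    by rewrite normr1 powR1.
  by rewrite normr0 powR0 ?gt_eqF.
move=> h.
have {h} : \int[mu]_(x in D) (g x)%:E <=
   (\int[mu]_(x in D) (g x `^ p)%:E) `^ p^-1 * m%:E `^ q^-1.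
  by rewrite -E1 -E2 -E3; apply: le_trans h.
have I0 : 0 <= \int[mu]_(x in D) (g x)%:E.
  by apply: integral_ge0 => x _; rewrite lee_fin.
have I1 : 0 <= \int[mu]_(x in D) (g x `^ p)%:E.
  by apply: integral_ge0 => x _; rewrite lee_fin powR_ge0.
move: I0 I1; move: (integral _ _ _) (integral _ _ _) => J I I0 J0 h.
apply: (@le_trans _ _ ((J `^ p^-1 * m%:E `^ q^-1) `^ p)).
  have le := gt0_ler_poweR (ltW p0). apply: le (h).
    by rewrite in_itv/= I0 leey.
  by rewrite in_itv/= leey mule_ge0 ?poweR_ge0// lee_fin powR_ge0.
rewrite poweRM ?poweR_ge0// -!poweRrM mulVf ?gt_eqF// poweRe1// muleC.
by rewrite poweR_EFin qp.
Qed.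

End jensen.

Section overlap.
Context d (T : measurableType d) (R : realType) (mu : {measure set T -> \bar R}).

Lemma sum_integral_overlap (E : nat -> set T) (M : R) (h : T -> \bar R) :
  (forall n, measurable (E n)) -> (0 <= M)%R ->
  (forall x N, (\sum_(n < N) \1_(E n) x <= M)%R) ->
  measurable_fun [set: T] h -> (forall x, 0 <= h x) ->
  \sum_(n <oo) \int[mu]_(x in E n) h x <= M%:E * \int[mu]_x h x.
Proof.
move=> mE M0 ovl mh h0.
have mhE n : measurable_fun [set: T] (fun x => (\1_(E n) x)%:E * h x).
  apply: emeasurable_funM => //; apply/measurable_EFinP.
  exact: measurable_indic.
have hE n x : 0 <= (\1_(E n) x)%:E * h x by rewrite mule_ge0.
rewrite (eq_eseriesr (g := fun n => \int[mu]_x ((\1_(E n) x)%:E * h x))); last first.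
  move=> n _; rewrite integral_mkcond; apply: eq_integral => x _.
  by rewrite patchE indicE; case: (x \in E n); rewrite ?mul1e ?mul0e.
rewrite -integral_nneseries// -ge0_integralZl_EFin//.
apply: ge0_le_integral_outer => x _; first exact: nneseries_ge0.
apply: lime_le; first by apply: is_cvg_nneseries.
near=> N; rewrite -ge0_sume_distrl; last by move=> n _; rewrite lee_fin.
by rewrite lee_wpmul2r// sumEFin lee_fin big_mkord ovl.
Unshelve. all: by end_near. Qed.

End overlap.

Section borel.
Context (R : realType) d (T : borelMetricType R d).

Lemma open_borel (A : set T) : open A -> measurable A.
Proof. by move=> oA; rewrite measurable_borelE; exact: sub_sigma_algebra. Qed.

Lemma metric_openP (A : set T) :
  (forall x, A x -> exists2 e : R, (0 < e)%R & forall y, (mdist x y < e)%R -> A y) ->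
  open A.
Proof.
move=> h; rewrite openE => x /h[e e0 xA].
by rewrite /interior -nbhs_ballE; exists e => // y; rewrite ballEmdist => /xA.
Qed.

Lemma metric_measurable_fun (f : T -> R) :
  (forall x (e : R), (0 < e)%R -> exists2 r : R, (0 < r)%R &
    forall y, (mdist x y < r)%R -> (`|f x - f y| < e)%R) ->
  measurable_fun [set: T] f.
Proof.
move=> h _; apply: (measurability _ (RGenOInfty.measurableE R)) => //.
move=> _ [_ [a ->] <-]; rewrite setTI preimage_itvoy.
apply: open_borel; apply: metric_openP => x /= ax.
have [|r r0 hr] := h x (f x - a)%R; first by rewrite subr_gt0.
by exists r => // y /hr /(le_lt_trans (ler_norm _)); lra.
Qed.

Lemma lip_measurable_fun (f : T -> R) (c : R) :
  (forall x y, (`|f x - f y| <= c * mdist x y)%R) -> measurable_fun [set: T] f.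
Proof.
move=> fc; apply: metric_measurable_fun => x e e0.
have c0 : (0 < `|c| + 1)%R by rewrite ltr_wpDl.
exists (e / (`|c| + 1))%R; first by rewrite divr_gt0.
move=> y; rewrite ltr_pdivlMr// mulrC; apply: le_lt_trans.
apply: (le_trans (fc x y)); apply: ler_wpM2r; first exact: mdist_ge0.
by have := ler_norm c; lra.
Qed.

End borel.

Lemma lee_poweR (R : realType) (r : R) (x y : \bar R) : (0 <= r)%R -> 0 <= x ->
  x <= y -> x `^ r <= y `^ r.
Proof.
move=> r0 x0 xy; have le := gt0_ler_poweR r0; apply: le (xy).
  by rewrite in_itv/= x0 leey.
by rewrite in_itv/= leey andbT (le_trans x0).
Qed.

Lemma powR_le (R : realType) (r x y : R) : (0 <= r)%R -> (0 <= x)%R ->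
  (x <= y)%R -> (x `^ r <= y `^ r)%R.
Proof.
by move=> r0 x0 xy; apply: ge0_ler_powR => //; rewrite nnegrE// (le_trans x0).
Qed.

Lemma powR2N_lt1 (R : realType) (a : R) : (0 < a)%R -> (2 `^ (- a) < 1 :> R)%R.
Proof.
move=> a0; rewrite powRN invf_lt1 ?powR_gt0// -[ltLHS](powRr0 2).
by rewrite lt_neqAle ler_powR ?ler1n ?(ltW a0)// powRr0 eq_sym powR_eq1 negb_or andbT; lra.
Qed.

Lemma powR_exprn (R : realType) (a r : R) k : (0 <= a)%R ->
  ((a ^+ k) `^ r = (a `^ r) ^+ k)%R.
Proof.
by move=> a0; rewrite -powR_mulrn// -powRrM mulrC powRrM powR_mulrn ?powR_ge0.
Qed.

Lemma measurable_norm_powR d (T : measurableType d) (R : realType) (D : set T)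
    (f : T -> R) (p : R) :
  measurable_fun D f -> measurable_fun D (fun x => (`|f x| `^ p)%:E).
Proof.
move=> mf; apply/measurable_EFinP.
apply: (@measurableT_comp _ _ _ _ _ _ (@powR R ^~ p)) => //.
exact: measurableT_comp.
Qed.

Section outer_scaling.
Import HBNNSimple.

(** A simple function below c f is c times a simple function below f. *)
Lemma ge0_integralZl_outer d (T : measurableType d) (R : realType)
    (mu : {measure set T -> \bar R}) (f : T -> \bar R) (c : R) :
  (0 < c)%R -> (forall x, 0 <= f x) ->
  \int[mu]_x (c%:E * f x) <= c%:E * \int[mu]_x f x.
Proof.
move=> c0 f0; rewrite ge0_integralTE; last by move=> x; rewrite mule_ge0// lee_fin ltW.
apply: ge_ereal_sup => _ [h hf <-]; rewrite -integralT_nnsfun.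
rewrite -lee_pdivrMl// -ge0_integralZl_EFin//; last 3 first.
- by move=> x _; rewrite lee_fin.
- exact/measurable_EFinP.
- by rewrite invr_ge0 ltW.
apply: ge0_le_integral_outer => x _.
  by rewrite mule_ge0// lee_fin ?invr_ge0 ?(ltW c0).
by rewrite lee_pdivrMl//; exact: hf.
Qed.

End outer_scaling.

Lemma outer_le_int d (T : measurableType d) (R : realType)
    (mu : {measure set T -> \bar R}) (D : set T) (f : T -> \bar R) c :
  (forall x, D x -> 0 <= f x) -> outer_le mu D f c ->
  \int[mu]_(x in D) f x <= c.
Proof.
move=> f0 [g [mg g0 fg gc]]; apply: le_trans gc.
rewrite integral_mkcond; apply: ge0_le_integral_outer => x _.
  exact: erestrict_ge0.
by rewrite patchE; case: ifPn => [/set_mem/fg//|_]; exact: g0.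
Qed.

Lemma sum_geometric_le (R : realType) (x : R) N : (0 <= x)%R -> (x < 1)%R ->
  (\sum_(k < N) x ^+ k <= (1 - x)^-1)%R.
Proof.
move=> x0 x1; have h : (0 < 1 - x)%R by rewrite subr_gt0.
rewrite -[leRHS]mul1r ler_pdivlMr// mulrC.
have -> : ((1 - x) * \sum_(k < N) x ^+ k = 1 - x ^+ N)%R.
  by rewrite -{1}opprB mulNr -subrX1 opprB.
by rewrite gerBl exprn_ge0.
Qed.

Lemma nneseries_geometric_le (R : realType) (x : R) (a : \bar R) :
  (0 <= x)%R -> (x < 1)%R -> 0 <= a ->
  \sum_(k <oo) ((x ^+ k)%:E * a) <= (1 - x)^-1%:E * a.
Proof.
move=> x0 x1 a0; apply: lime_le.
  by apply: is_cvg_nneseries => n _ _; rewrite mule_ge0// lee_fin exprn_ge0.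
near=> N; rewrite big_mkord -ge0_sume_distrl; last first.
  by move=> n _; rewrite lee_fin exprn_ge0.
by rewrite lee_wpmul2r// sumEFin lee_fin sum_geometric_le.
Unshelve. all: by end_near. Qed.

Lemma dyadic_layer (R : realType) (r t : R) : (0 < t)%R -> (t < r)%R ->
  exists k, (r / 2 ^+ k / 2 <= t)%R /\ (t < r / 2 ^+ k)%R.
Proof.
move=> t0 tr; have ex : exists n, (r / 2 ^+ n <= t)%R.
  exists (Num.truncn (r / t)).+1; rewrite ler_pdivrMr ?exprn_gt0// mulrC -ler_pdivrMr//.
  apply/ltW/(lt_trans (truncnS_gt _)).
  by rewrite -natrX ltr_nat ltn_expl.
case: (ex_minnP ex) => [[|k]]; first by rewrite expr0 divr1 leNgt tr.
move=> hk mink; exists k; split.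
  by rewrite -mulrA -invfM -exprSr.
by rewrite ltNge; apply/negP => /mink; rewrite ltnn.
Qed.

Section outer_le_union.
Context d (T : measurableType d) (R : realType) (mu : {measure set T -> \bar R}).

Lemma outer_leU (D E : set T) (f : T -> \bar R) a b :
  outer_le mu D f a -> outer_le mu E f b -> outer_le mu (D `|` E) f (a + b).
Proof.
move=> [g [mg g0 fg ga]] [h [mh h0 fh hb]].
exists (fun x => g x + h x); split.
- exact: emeasurable_funD.
- by move=> x; exact: adde_ge0.
- move=> x [/fg|/fh] fx; apply: (le_trans fx); first by rewrite leeDl.
  by rewrite leeDr.
- by rewrite ge0_integralD//; exact: leeD.
Qed.

Lemma outer_le_set0 (f : T -> \bar R) a : 0 <= a -> outer_le mu set0 f a.
Proof. by move=> a0; exists (cst 0); split => //; rewrite integral0. Qed.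

Lemma outer_le_bigcup_ord (E : nat -> set T) (f : T -> \bar R) (c : nat -> \bar R) n :
  (forall m, (m < n)%N -> outer_le mu (E m) f (c m)) ->
  outer_le mu [set x | exists2 m, (m < n)%N & E m x] f (\sum_(m < n) c m).
Proof.
elim: n => [|n ih] h.
  rewrite big_ord0; apply: (@outer_le_sub _ _ _ mu _ set0 _ f 0) => //.
    by move=> x [].
  exact: outer_le_set0.
rewrite big_ord_recr/=; apply: (@outer_le_sub _ _ _ mu _
    ([set x | exists2 m, (m < n)%N & E m x] `|` E n) _ f _ _ _ _ (lexx _)) => //.
  move=> x [m]; rewrite ltnS leq_eqVlt => /predU1P[->|mn Em]; first by right.
  by left; exists m.
by apply: outer_leU; [apply: ih => m mn; apply: h; rewrite ltnS ltnW|exact: h].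
Qed.

(** Passes from a layer close to the boundary to the whole space for functions
    that vanish away from it. *)
Lemma outer_le_supp (D : set T) (f : T -> \bar R) c :
  (forall x, ~ D x -> f x <= 0) -> outer_le mu D f c -> outer_le mu setT f c.
Proof.
move=> f0 [g [mg g0 fg gc]]; exists g; split => // x _.
by have [/fg//|/f0/le_trans] := pselect (D x); apply.
Qed.

End outer_le_union.

Lemma max0_lip (R : realType) (a b : R) :
  (`|Num.max 0 a - Num.max 0 b| <= `|a - b|)%R.
Proof.
rewrite ler_norml !maxEle; have := ler_norm (a - b)%R; have := ler_norm (b - a)%R.
by rewrite (distrC b a); case: (leP 0%R a) => ?; case: (leP 0%R b) => ? ? ?; lra.
Qed.

Local Close Scope ereal_scope.

(** * Trace balls and doubling *)

(** The estimates are carried out for an isometric map i from Om onto a dense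
    subset of a metric space Y, which will be the completion, and an isometric
    map j from a space B into Y, which will be the boundary. *)
Section geometry.
Context (R : realType) (dO : measure_display) (Om : borelMetricType R dO)
  (mu : {measure set Om -> \bar R}) (Y : metricType R) (i : Om -> Y)
  (Cmu : R).
Hypothesis isoi : forall x y, mdist (i x) (i y) = mdist x y.
Hypothesis densi : forall y (e : R), 0 < e -> exists x, mdist y (i x) < e.
Hypothesis dbl : doubling_with mu Cmu.

(** The trace on Om of a ball of Y. Its measure is that of the ball for the
    extension of mu by zero. *)
Definition tball (y : Y) (r : R) : set Om := i @^-1` ball y r.

Lemma tballE y r x : tball y r x = (mdist y (i x) < r).
Proof. by rewrite /tball /preimage/= ballEmdist. Qed.

Lemma measurable_tball y r : measurable (tball y r).
Proof.
apply: open_borel; apply: metric_openP => x; rewrite tballE => xr.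
exists (r - mdist y (i x)); first by rewrite subr_gt0.
move=> w xw; rewrite tballE (le_lt_trans (metric_triangle _ (i x) _))//.
by rewrite isoi; move: xw; lra.
Qed.

Definition vol (y : Y) (r : R) : R := fine (mu (tball y r)).

Lemma ball_tball x r : ball x r = tball (i x) r.
Proof. by apply/seteqP; split=> z; rewrite tballE ballEmdist/= isoi. Qed.

Let muball x r : 0 < r -> ((0 < mu (ball x r)) /\ (mu (ball x r) < +oo))%E.
Proof.
move=> r0; have [C1 dblx] := dbl.
have r20 : 0 < r / 2 by lra.
have [] := dblx x (r / 2) r20; rewrite mulrC divfK// => + le lt; split => //.
exact: le_lt_trans le lt.
Qed.

Let muballD x r n : 0 < r -> (mu (ball x (2 ^+ n * r)) <= (Cmu ^+ n)%:E * mu (ball x r))%E.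
Proof.
move=> r0; have [C1 dblx] := dbl; elim: n => [|n ih].
  by rewrite !expr0 mul1r mul1e.
have [|_ + _] := dblx x (2 ^+ n * r); first by rewrite mulr_gt0// exprn_gt0.
rewrite mulrA -exprS => /le_trans; apply.
rewrite exprS EFinM -muleA; apply: lee_wpmul2l => //.
by rewrite lee_fin (le_trans ler01).
Qed.

Lemma Cmu_ge1 : 1 <= Cmu. Proof. by case: dbl. Qed.

Lemma mu_tball y r : 0 < r -> mu (tball y r) = (vol y r)%:E.
Proof.
move=> r0; rewrite /vol fineK// ge0_fin_numE//.
have [x yx] := densi y r0.
apply: (@le_lt_trans _ _ (mu (ball x (2 * r)))); last first.
  by apply: (muball _ _).2; lra.
rewrite le_measure ?inE//; [exact: measurable_tball|rewrite ball_tball; exact: measurable_tball|].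
move=> w; rewrite tballE ballEmdist/= -isoi => yw.
apply: le_lt_trans (metric_triangle _ y _) _.
by rewrite metric_sym; lra.
Qed.

Lemma vol_gt0 y r : 0 < r -> 0 < vol y r.
Proof.
move=> r0; rewrite -lte_fin -mu_tball//.
have [|x yx] := @densi y (r / 2); first by lra.
have r2 : 0 < r / 2 by lra.
apply: lt_le_trans (muball x r2).1 _.
rewrite le_measure ?inE//; [rewrite ball_tball; exact: measurable_tball|exact: measurable_tball|].
move=> w; rewrite tballE ballEmdist/= -isoi => xw.
by apply: le_lt_trans (metric_triangle _ (i x) _) _; lra.
Qed.

Lemma le_vol y y' r s : 0 < r -> 0 < s -> mdist y' y + r <= s -> vol y r <= vol y' s.
Proof.
move=> r0 s0 h; rewrite -lee_fin -!mu_tball// le_measure ?inE//; try exact: measurable_tball.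
move=> w; rewrite !tballE => yw.
by apply: le_lt_trans (metric_triangle _ y _) _; lra.
Qed.

(** The doubling constant of the trace balls. Doubling is assumed for balls
    centred in Om only; a point of Om close to y serves as the centre instead
    of y, and the enlargement of the balls that this requires takes three
    doublings. *)
Definition Dbl := Cmu ^+ 3.

Lemma Dbl_ge1 : 1 <= Dbl.
Proof. by rewrite /Dbl exprn_ege1// Cmu_ge1. Qed.

Lemma vol_dbl y r : 0 < r -> vol y (2 * r) <= Dbl * vol y r.
Proof.
move=> r0; have r2 : 0 < r / 2 by lra.
have [x yx] := @densi y (r / 2) r2.
have := muballD x 3 r2.
have -> : 2 ^+ 3 * (r / 2) = 4 * r by rewrite !exprS expr0; lra.
rewrite !ball_tball !mu_tball//; last by lra.
rewrite -EFinM lee_fin => h.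
apply: (@le_trans _ _ (vol (i x) (4 * r))).
  by apply: le_vol; rewrite 1?metric_sym; lra.
apply: (le_trans h); rewrite ler_wpM2l ?exprn_ge0 ?(le_trans ler01) ?Cmu_ge1//.
by apply: le_vol; lra.
Qed.

Lemma vol_cmp n y y' s r : 0 < r -> 0 < s -> mdist y' y + s <= 2 ^+ n * r ->
  vol y s <= Dbl ^+ n * vol y' r.
Proof.
move=> r0 s0 h; have nr : 0 < 2 ^+ n * r by rewrite mulr_gt0// exprn_gt0.
apply: le_trans (le_vol s0 nr h) _; elim: n {h nr} => [|n ih].
  by rewrite !expr0 !mul1r.
rewrite exprS -mulrA; apply: le_trans (vol_dbl _ _) _.
  by rewrite mulr_gt0// exprn_gt0.
by rewrite exprS -mulrA ler_wpM2l// (le_trans ler01) ?Dbl_ge1.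
Qed.

Context (B : Type) (j : B -> Y).

(** The disjoint trace balls counted on the left all lie in the trace ball of
    radius 2 ^+ m.+1 * rho about y, and by doubling each of them fills a fixed
    fraction of it. *)
Lemma packing (rho : R) (z : nat -> B) (P : set nat) (m : nat) (y : Y) (N : nat) :
  0 < rho -> trivIset P (fun n => tball (j (z n)) (rho / 2)) ->
  \sum_(n < N) (`[< P n /\ mdist y (j (z n)) < 2 ^+ m * rho >])%:R <= Dbl ^+ (m + 3).
Proof.
move=> rho0 tP; have rho2 : 0 < rho / 2 by lra.
pose r' := 2 ^+ m.+1 * rho.
have m1 : 1 <= 2 ^+ m :> R by rewrite exprn_ege1// ler1n.
have r'0 : 0 < r' by rewrite mulr_gt0// exprn_gt0.
pose Q n := `[< P n /\ mdist y (j (z n)) < 2 ^+ m * rho >].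
pose F n := if Q n then tball (j (z n)) (rho / 2) else set0.
have mF n : measurable (F n) by rewrite /F; case: ifP => // _; exact: measurable_tball.
have tF : trivIset setT F.
  move=> a b _ _ [x [+ +]]; rewrite /F; case: ifP => // /asboolP[Pa _].
  by move=> xa; case: ifP => // /asboolP[Pb _] xb; apply: tP => //; exists x.
have : (\sum_(n < N) mu (F n) <= mu (tball y r'))%E.
  rewrite -(@measure_bigsetU _ _ _ mu _ mF)//.
  rewrite le_measure ?inE//; [exact: bigsetU_measurable|exact: measurable_tball|].
  rewrite -bigcup_mkord => x [n _] /=; rewrite /F; case: ifP => // /asboolP[_ yz].
  rewrite !tballE => zx; apply: le_lt_trans (metric_triangle _ (j (z n)) _) _.
  apply: (lt_le_trans (ltrD yz zx)); rewrite /r' exprS -subr_ge0.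
  by rewrite (_ : _ - _ = (2 ^+ m - 2^-1) * rho); [rewrite mulr_ge0; lra|field].
rewrite mu_tball// => h.
have vy : 0 < vol y r' by exact: vol_gt0.
rewrite -(ler_pM2r vy) -lee_fin; apply: (@le_trans _ _ ((Dbl ^+ (m + 3))%:E * \sum_(n < N) mu (F n))%E); last first.
  rewrite EFinM; apply: lee_wpmul2l => //.
  by rewrite lee_fin exprn_ge0// (le_trans ler01) ?Dbl_ge1.
rewrite ge0_sume_distrr// mulr_suml -sumEFin; apply: lee_sum => n _.
rewrite /F -/(Q n); case: ifP => [/asboolP[_ yz]|_]; last by rewrite mul0r measure0 mule0.
rewrite mul1r mu_tball// -EFinM lee_fin; apply: vol_cmp => //.
rewrite metric_sym; apply: (@le_trans _ _ (2 ^+ m * rho + r')); first by rewrite lerD2r ltW.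
rewrite /r' exprD exprS -subr_ge0.
by rewrite (_ : _ - _ = 2 ^+ m * rho); [rewrite mulr_ge0; lra|rewrite !exprS expr0; field].
Qed.

End geometry.

(** * Nets on the boundary *)

Section nets.
Context (R : realType) (dO : measure_display) (Om : borelMetricType R dO)
  (mu : {measure set Om -> \bar R}) (Y : metricType R) (i : Om -> Y)
  (Cmu : R).
Hypothesis isoi : forall x y, mdist (i x) (i y) = mdist x y.
Hypothesis densi : forall y (e : R), 0 < e -> exists x, mdist y (i x) < e.
Hypothesis dbl : doubling_with mu Cmu.
Context (dB : measure_display) (B : borelMetricType R dB) (j : B -> Y).
Hypothesis isoj : forall x y, mdist (j x) (j y) = mdist x y.

(** Disjointness of the trace balls gives bounded overlap of their enlargements
    through packing. The set P of active indices allows for finite nets. *)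
Definition is_net (rho : R) (z : nat -> B) (P : set nat) :=
  trivIset P (fun n => tball i (j (z n)) (rho / 2)) /\
  forall w : B, exists2 n, P n & mdist (j w) (j (z n)) < rho.

(** A maximal family of disjoint trace balls: a boundary point at distance at
    least rho from all the centres would enlarge it. The family is countable because
    packing leaves finitely many centres in each bounded set. *)
Lemma net_exists rho : 0 < rho -> exists z P, is_net rho z P.
Proof.
move=> rho0; have rho2 : 0 < rho / 2 by lra.
pose F (z : B) := tball i (j z) (rho / 2).
have [E [_ tE maxE]] := ex_maximal_disjoint_subcollection F [set: B].
have cover w : exists2 z, E z & mdist (j w) (j z) < rho.
  apply: contrapT => nz.
  have wF z : E z -> F w `&` F z = set0.
    move=> Ez; apply: contrapT => /eqP/set0P[x [wx zx]]; apply: nz; exists z => //.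
    apply: le_lt_trans (metric_triangle _ (i x) _) _.
    by rewrite (metric_sym (i x)); move: wx zx; rewrite /F !tballE; lra.
  have [x wx] := densi (j w) rho2.
  have Ew : ~ E w.
    move=> Ew; have := wF _ Ew; rewrite setIid => F0.
    by have : F w x; [rewrite /F tballE|rewrite F0].
  apply: (maxE (E `|` [set w])) => //.
    by split; [left|move=> h; apply: Ew; apply: h; right].
  move=> a b [Ea|->] [Eb|->] // [u [ua ub]].
  - by apply: tE => //; exists u.
  - by have : (F w `&` F a) u; [split|rewrite wF].
  - by have : (F w `&` F b) u; [split|rewrite wF].
have cE : countable E.
  have -> : E = \bigcup_k (E `&` [set z | mdist (j point) (j z) < 2 ^+ k * rho]).
    apply/seteqP; split => [z Ez|z [k _ []]//].
    have [k hk] : exists k, mdist (j point) (j z) < 2 ^+ k * rho.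
      exists (Num.truncn (mdist (j point) (j z) / rho)).+1.
      rewrite -ltr_pdivrMr//.
      apply: (lt_trans (truncnS_gt _)).
      by rewrite -natrX ltr_nat ltn_expl.
    by exists k.
  apply: bigcup_countable => // k _; apply: finite_set_countable.
  apply: contrapT => /infiniteP/pcard_leP[w].
  have wE n : E (w n) /\ mdist (j point) (j (w n)) < 2 ^+ k * rho.
    by apply: (@funS _ _ _ _ w).
  have tw : trivIset setT (fun n => tball i (j (w n)) (rho / 2)).
    move=> a b _ _ [x [xa xb]]; apply: (@inj _ _ _ w); rewrite ?inE//.
    by apply: (tE _ _ (wE a).1 (wE b).1); exists x.
  pose N := (Num.truncn (Dbl Cmu ^+ (k + 3))).+1.
  have := packing isoi densi dbl k (j point) N rho0 tw.
  rewrite (eq_bigr (fun=> 1)); last first.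
    by move=> n _; case: asboolP => // -[]; split => //; exact: (wE n).2.
  rewrite sumr_const card_ord; apply/negP; rewrite -ltNge.
  exact: truncnS_gt.
have /countable_injP[g ginj] := cE.
have /choice[z zP] : forall n, exists z, (exists2 z', E z' & g z' = n) -> E z /\ g z = n.
  move=> n; have [[z' Ez gz]|nz] := pselect (exists2 z', E z' & g z' = n).
    by exists z'.
  by exists point.
exists z, [set n | exists2 z', E z' & g z' = n]; split.
  move=> a b /zP[Ea ga] /zP[Eb gb] [x [xa xb]]; rewrite -ga -gb; congr g.
  by apply: tE => //; exists x.
move=> w; have [u Eu wu] := cover w; exists (g u); first by exists u.
have [|Eu' gu] := zP (g u); first by exists u.
by rewrite (ginj _ _ _ _ gu) ?inE.
Qed.

Variables (rho : R) (rho0 : 0 < rho) (z : nat -> B) (P : set nat).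
Hypothesis netP : is_net rho z P.

(** Empty for the inactive indices, so that sums can range over all indices. *)
Definition netT n r : set Om := [set x | P n /\ mdist (j (z n)) (i x) < r].
Definition netB n r : set B := [set w | P n /\ mdist (j (z n)) (j w) < r].

Lemma netTE n r : P n -> netT n r = tball i (j (z n)) r.
Proof.
by move=> Pn; apply/seteqP; split=> x; rewrite tballE /netT/=; [case|split].
Qed.

Lemma netBE n r : P n -> netB n r = ball (z n) r.
Proof.
by move=> Pn; apply/seteqP; split=> x; rewrite ballEmdist /netB/= isoj; [case|split].
Qed.

Lemma netT0 n r : ~ P n -> netT n r = set0.
Proof. by move=> nP; apply/seteqP; split => x // -[]. Qed.

Lemma netB0 n r : ~ P n -> netB n r = set0.
Proof. by move=> nP; apply/seteqP; split => x // -[]. Qed.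

Lemma measurable_netT n r : measurable (netT n r).
Proof.
have [Pn|/netT0->//] := pselect (P n); rewrite netTE//; exact: measurable_tball.
Qed.

Lemma measurable_bball (w : B) r : measurable (ball w r).
Proof.
apply: open_borel; apply: metric_openP => x; rewrite ballEmdist/= => xr.
exists (r - mdist w x); first by rewrite subr_gt0.
by move=> u xu; rewrite (le_lt_trans (metric_triangle _ x _))//; move: xu; lra.
Qed.

Lemma measurable_netB n r : measurable (netB n r).
Proof.
have [Pn|/netB0->//] := pselect (P n); rewrite netBE//; exact: measurable_bball.
Qed.

Lemma overlapT m x N :
  \sum_(n < N) \1_(netT n (2 ^+ m * rho)) x <= Dbl Cmu ^+ (m + 3) :> R.
Proof.
apply: le_trans (packing isoi densi dbl m (i x) N rho0 netP.1).
apply: ler_sum => n _; rewrite indicE.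
have [/set_mem[Pn nx]|_] := boolP (x \in _); last exact: ler0n.
by rewrite asboolT//; split => //; rewrite metric_sym.
Qed.

Lemma overlapB m x N :
  \sum_(n < N) \1_(netB n (2 ^+ m * rho)) x <= Dbl Cmu ^+ (m + 3) :> R.
Proof.
apply: le_trans (packing isoi densi dbl m (j x) N rho0 netP.1).
apply: ler_sum => n _; rewrite indicE.
have [/set_mem[Pn nx]|_] := boolP (x \in _); last exact: ler0n.
by rewrite asboolT//; split => //; rewrite metric_sym.
Qed.

End nets.

(** * The averaging operator *)

Section bounded_support.
Context d (T : measurableType d) (R : realType) (nu : {measure set T -> \bar R}).

Lemma integral_bounded_support (W : set T) (c : R) (phi f : T -> R) :
  measurable W -> 0 <= c -> measurable_fun [set: T] phi ->
  (forall z, `|phi z| <= c) -> (forall z, ~ W z -> phi z = 0) ->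
  measurable_fun [set: T] f -> nu.-integrable W (EFin \o f) ->
  nu.-integrable [set: T] (EFin \o (phi \* f)) /\
  (`| \int[nu]_z (phi z * f z) |%:E <=
    c%:E * \int[nu]_(z in W) `|f z|%:E)%E.
Proof.
move=> mW c0 mphi phic phiW mf intf.
have le1 : (\int[nu]_z `|(phi z * f z)%:E| <= c%:E * \int[nu]_(z in W) `|f z|%:E)%E.
  rewrite -ge0_integralZl_EFin//; last first.
    by apply/measurable_EFinP/measurableT_comp => //; exact: measurable_funTS.
  rewrite [leRHS]integral_mkcond; apply: ge0_le_integral_outer => [z _|z _]; first exact: abse_ge0.
  rewrite patchE; case: ifPn => [_|/negP zW].
    by rewrite abse_EFin normrM lee_fin ler_wpM2r.
  rewrite phiW; last by move=> Wz; apply: zW; rewrite inE.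
  by rewrite mul0r abse0; exact: lexx.
have int : nu.-integrable [set: T] (EFin \o (phi \* f)).
  apply/integrableP; split; first by apply/measurable_EFinP; exact: measurable_funM.
  apply: (le_lt_trans le1); move/integrableP : intf => [_ intf].
  by rewrite lte_mul_pinfty// lee_fin.
split => //; apply: le_trans le1.
apply: (@le_trans _ _ ((\int[nu]_z `|phi z * f z|)%:E)%R).
  by rewrite lee_fin le_normr_Rintegral.
rewrite /Rintegral fineK//.
have /integrableP[_ fin] := int.
by rewrite ge0_fin_numE//; apply: integral_ge0.
Qed.

End bounded_support.

Section kernel.
Context (R : realType) (dO : measure_display) (Om : borelMetricType R dO)
  (Y : metricType R) (i : Om -> Y).
Hypothesis isoi : forall x y, mdist (i x) (i y) = mdist x y.
Context (dB : measure_display) (B : borelMetricType R dB) (j : B -> Y).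
Hypothesis isoj : forall x y, mdist (j x) (j y) = mdist x y.
Hypothesis sep : forall x, exists2 e : R, 0 < e & forall z, e <= mdist (i x) (j z).

Definition delta (x : Om) : R := inf [set mdist (i x) (j z) | z in [set: B]].

Let dist_inf x : has_inf [set mdist (i x) (j z) | z in [set: B]].
Proof.
split; first by exists (mdist (i x) (j point)), point.
by exists 0 => _ [z _ <-]; exact: mdist_ge0.
Qed.

Lemma delta_gt0 x : 0 < delta x.
Proof.
have [e e0 h] := sep x; apply: (lt_le_trans e0).
by apply: lb_le_inf; [exact: (dist_inf x).1|move=> _ [z _ <-]].
Qed.

Lemma delta_le x z : delta x <= mdist (i x) (j z).
Proof. by apply: ge_inf; [exact: (dist_inf x).2|exists z]. Qed.

Lemma delta_lt x e : delta x < e -> exists z, mdist (i x) (j z) < e.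
Proof. by move=> /(inf_lt (dist_inf x).1)[_ [z _ <-] ze]; exists z. Qed.

Lemma delta_lip x y : delta x <= delta y + mdist x y.
Proof.
rewrite -lerBlDr; apply: lb_le_inf; first exact: (dist_inf y).1.
move=> _ [z _ <-]; rewrite lerBlDr; apply: le_trans (delta_le x z) _.
by rewrite addrC -isoi; exact: metric_triangle.
Qed.

Lemma delta_lipN x y : `|delta x - delta y| <= mdist x y.
Proof.
rewrite ler_norml; have := delta_lip x y; have := delta_lip y x.
by rewrite (metric_sym y x); lra.
Qed.

(** The factor 4 makes the kernel at least delta x on all boundary points at
    distance at most 3 delta x, and there are such points at distance less than
    2 delta x. The kernel is Lipschitz in both variables. *)
Definition kern (x : Om) (z : B) : R := Num.max 0 (4 * delta x - mdist (i x) (j z)).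

Lemma kern_ge0 x z : 0 <= kern x z. Proof. by rewrite /kern le_max lexx. Qed.

Lemma kern_le x z : kern x z <= 4 * delta x.
Proof.
have := delta_gt0 x; have := mdist_ge0 (i x) (j z).
by rewrite /kern ge_max; lra.
Qed.

Lemma kern_out x z : 4 * delta x <= mdist (i x) (j z) -> kern x z = 0.
Proof. by move=> h; apply/max_idPl; rewrite subr_le0. Qed.

Lemma kern_in x z : mdist (i x) (j z) <= 3 * delta x -> delta x <= kern x z.
Proof. by move=> h; rewrite /kern le_max; apply/orP; right; lra. Qed.

Lemma kern_lip x y z : `|kern x z - kern y z| <= 5 * mdist x y.
Proof.
apply: le_trans (max0_lip _ _) _.
have h1 := delta_lipN x y.
have h2 := metric_triangle (i x) (i y) (j z).
have h3 := metric_triangle (i y) (i x) (j z).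
rewrite (metric_sym (i y) (i x)) isoi in h3; rewrite isoi in h2.
by move: h1; rewrite !ler_norml; lra.
Qed.

Lemma kern_lip2 x z w : `|kern x z - kern x w| <= mdist z w.
Proof.
apply: le_trans (max0_lip _ _) _.
have h2 := metric_triangle (i x) (j w) (j z).
have h3 := metric_triangle (i x) (j z) (j w).
rewrite (metric_sym (j w) (j z)) isoj in h2; rewrite isoj in h3.
by rewrite ler_norml; lra.
Qed.

Lemma measurable_kern x : measurable_fun [set: B] (kern x).
Proof.
by apply: (@lip_measurable_fun _ _ _ _ 1) => z w; rewrite mul1r kern_lip2.
Qed.

End kernel.

Section averaging.
Context (R : realType) (dO : measure_display) (Om : borelMetricType R dO)
  (Y : metricType R) (i : Om -> Y).
Hypothesis isoi : forall x y, mdist (i x) (i y) = mdist x y.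
Context (dB : measure_display) (B : borelMetricType R dB) (j : B -> Y).
Hypothesis isoj : forall x y, mdist (j x) (j y) = mdist x y.
Hypothesis sep : forall x, exists2 e : R, 0 < e & forall z, e <= mdist (i x) (j z).
Context (nu : {measure set B -> \bar R}).
Hypothesis fin : forall z (r : R), 0 < r ->
  (0 < nu (ball z r))%E /\ (nu (ball z r) < +oo)%E.

Local Notation delta := (delta i j).
Local Notation kern := (kern i j).

Definition nuv z (r : R) : R := fine (nu (ball z r)).

Lemma nuE z r : 0 < r -> nu (ball z r) = (nuv z r)%:E.
Proof.
by move=> r0; rewrite /nuv fineK// ge0_fin_numE//; case: (fin z r0).
Qed.

Lemma nuv_gt0 z r : 0 < r -> 0 < nuv z r.
Proof. by move=> r0; rewrite -lte_fin -nuE//; case: (fin z r0). Qed.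

Lemma le_nuv z w r s : 0 < r -> 0 < s -> mdist w z + r <= s -> nuv z r <= nuv w s.
Proof.
move=> r0 s0 h; rewrite -lee_fin -!nuE// le_measure ?inE//; try exact: measurable_bball.
move=> u; rewrite !ballEmdist /= => zu.
by apply: le_lt_trans (metric_triangle _ z _) _; lra.
Qed.

(** The support of kern x is a ball of radius 4 delta x, which may be large:
    integrability on small balls is not enough to average. *)
Definition locint (f : B -> R) := measurable_fun [set: B] f /\
  forall w (r : R), 0 < r -> nu.-integrable (ball w r) (EFin \o f).

Lemma locint_cst c : locint (cst c).
Proof.
split => // w r r0; have mb := measurable_bball w r.
apply/integrableP; split; first exact/measurable_EFinP/measurable_cst.
rewrite [X in (X < _)%E](_ : _ = \int[nu]_(x in ball w r) (cst (`|c|%:E) x))%E//.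
by rewrite integral_cst// nuE// -EFinM ltry.
Qed.

Lemma locintD a f g : locint f -> locint g -> locint (fun z => a * f z + g z).
Proof.
move=> [mf intf] [mg intg]; split.
  by apply: measurable_funD => //; exact: measurable_funM.
move=> w r r0; have mb := measurable_bball w r.
have -> : EFin \o (fun z => a * f z + g z) =
    (fun z => a%:E * (EFin \o f) z + (EFin \o g) z)%E by [].
by apply: integrableD => //; [apply: integrableZl => //; exact: intf|exact: intg].
Qed.

Definition kint (f : B -> R) x : R := \int[nu]_z (kern x z * f z).

Lemma kern_supp x w r z : 4 * delta x + mdist (i x) (j w) <= r ->
  ~ ball w r z -> kern x z = 0.
Proof.
move=> h wz; apply: kern_out => //; rewrite leNgt; apply/negP => xz; apply: wz.
rewrite ballEmdist/= -isoj; apply: le_lt_trans (metric_triangle _ (i x) _) _.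
by rewrite (metric_sym (j w)); lra.
Qed.

Lemma kint_bound f x w r : locint f -> 0 < r ->
  4 * delta x + mdist (i x) (j w) <= r ->
  nu.-integrable [set: B] (EFin \o (kern x \* f)) /\
  (`|kint f x|%:E <= (4 * delta x)%:E * \int[nu]_(z in ball w r) `|f z|%:E)%E.
Proof.
move=> [mf intf] r0 h; apply: integral_bounded_support => //.
- exact: measurable_bball.
- by have := delta_gt0 sep x; lra.
- exact: measurable_kern.
- by move=> z; rewrite ger0_norm ?kern_ge0 ?kern_le.
- by move=> z; exact: kern_supp.
- exact: intf.
Qed.

Lemma kint_integrable f x : locint f -> nu.-integrable [set: B] (EFin \o (kern x \* f)).
Proof.
move=> lf; have d0 := delta_gt0 sep x.
have [||//] := @kint_bound f x point (4 * delta x + mdist (i x) (j point)) lf.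
  by rewrite ltr_wpDr ?mdist_ge0//; lra.
by [].
Qed.

Lemma kint_diff f x y w r : locint f -> 0 < r ->
  4 * delta x + mdist (i x) (j w) <= r ->
  4 * delta y + mdist (i y) (j w) <= r ->
  (`|kint f x - kint f y|%:E <=
    (5 * mdist x y)%:E * \int[nu]_(z in ball w r) `|f z|%:E)%E.
Proof.
move=> lf r0 hx hy; have [mf intf] := lf.
have -> : kint f x - kint f y = \int[nu]_z ((kern x z - kern y z) * f z).
  rewrite /kint -RintegralB//; try exact: kint_integrable.
  by apply: eq_Rintegral => z _; rewrite mulrBl.
apply: (@integral_bounded_support _ _ _ nu _ _ (fun z => kern x z - kern y z) f _ _ _ _ _ _ _).2 => //.
- exact: measurable_bball.
- by rewrite mulr_ge0 ?mdist_ge0.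
- by apply: measurable_funB; exact: measurable_kern.
- by move=> z; exact: kern_lip.
- by move=> z wz; rewrite !(@kern_supp _ w r)// subrr.
- exact: intf.
Qed.

Lemma kint_lin a f g x : locint f -> locint g ->
  kint (fun z => a * f z + g z) x = a * kint f x + kint g x.
Proof.
move=> lf lg; rewrite /kint -RintegralZl//; last exact: kint_integrable.
have := kint_integrable x lf => If; have := kint_integrable x lg => Ig.
rewrite -RintegralD//; last first.
  by apply: (integrableZl _ a If).
by apply: eq_Rintegral => z _; rewrite mulrDr mulrCA.
Qed.

Definition kmass x := kint (cst 1) x.

Lemma kmass_ge x z r : mdist (i x) (j z) + r <= 3 * delta x -> 0 < r ->
  delta x * nuv z r <= kmass x.
Proof.
move=> h r0; rewrite /kmass /kint /Rintegral -lee_fin fineK; last first.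
  apply: integrable_fin_num => //.
  exact: (kint_integrable x (locint_cst 1)).
rewrite EFinM -nuE// -integral_cst; last exact: measurable_bball.
rewrite integral_mkcond; apply: ge0_le_integral_outer => w _.
  by rewrite patchE; case: ifP => _; rewrite ?lee_fin ?lexx// ltW// delta_gt0.
rewrite patchE mulr1; case: ifPn => [/set_mem|_]; last by rewrite lee_fin kern_ge0.
rewrite ballEmdist/= -isoj => zw; rewrite lee_fin kern_in//.
by have := metric_triangle (i x) (j z) (j w); lra.
Qed.

(** The infimum delta x need not be attained by a boundary point, but some
    boundary point is at distance less than 2 delta x. *)
Lemma kmass_gt0 x : 0 < kmass x.
Proof.
have d0 := delta_gt0 sep x.
have [|z xz] := @delta_lt _ _ _ _ i _ _ j x (2 * delta x); first by lra.
apply: lt_le_trans (@kmass_ge x z (delta x) _ d0); last by lra.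
by rewrite mulr_gt0// nuv_gt0.
Qed.

(** The mean of f over the boundary points at distance of order delta x. *)
Definition Av f x := kint f x / kmass x.

Lemma Av_lin a f g x : locint f -> locint g ->
  Av (fun z => a * f z + g z) x = a * Av f x + Av g x.
Proof. by move=> lf lg; rewrite /Av kint_lin// mulrDl mulrA. Qed.

Lemma kint_cst c x : kint (cst c) x = c * kmass x.
Proof.
rewrite /kmass /kint -RintegralZl//; last exact: (kint_integrable x (locint_cst 1)).
by apply: eq_Rintegral => z _; rewrite /= mulrCA mulr1.
Qed.

Lemma Av_cst c x : Av (cst c) x = c.
Proof. by rewrite /Av kint_cst mulfK// gt_eqF// kmass_gt0. Qed.

(** As constants are reproduced, any bound on Av f by the size of f is also a
    bound on Av f - c by the deviation of f from c. *)
Lemma Av_subcst f c x : locint f -> Av (fun z => f z - c) x = Av f x - c.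
Proof.
move=> lf; have := Av_lin (-1) x (locint_cst c) lf.
rewrite Av_cst mulN1r [RHS]addrC => <-.
by congr Av; apply/funext => z /=; rewrite addrC.
Qed.

Lemma Av_eq f g x : (forall z, mdist (i x) (j z) < 4 * delta x -> f z = g z) ->
  Av f x = Av g x.
Proof.
move=> fg; rewrite /Av /kint; congr (_ / _); apply: eq_Rintegral => z _.
have [/fg->//|h] := ltP (mdist (i x) (j z)) (4 * delta x).
by rewrite kern_out// !mul0r.
Qed.

Lemma kint_cont f x (e : R) : locint f -> 0 < e -> exists2 r : R, 0 < r &
  forall y, mdist x y < r -> `|kint f x - kint f y| < e.
Proof.
move=> lf e0; have d0 := delta_gt0 sep x; have dx0 := mdist_ge0 (i x) (j point).
pose r' := 9 * delta x + mdist (i x) (j point); have r'0 : 0 < r' by rewrite /r'; lra.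
have /integrableP[mf fin1] := lf.2 point r' r'0.
pose L := fine (\int[nu]_(z in ball point r') `|f z|%:E).
have LE : (\int[nu]_(z in ball point r') `|f z|%:E = L%:E)%E.
  by rewrite /L fineK// ge0_fin_numE//; apply: integral_ge0 => z _; rewrite lee_fin.
have L0 : 0 <= L.
  by rewrite -lee_fin -LE; apply: integral_ge0 => z _; rewrite lee_fin.
have L1 : 0 < 5 * (L + 1) by lra.
exists (Num.min (delta x) (e / (5 * (L + 1)))).
  by rewrite lt_min d0 divr_gt0.
move=> y; rewrite lt_min => /andP[yd ye].
have dy := delta_lip isoi j y x; rewrite metric_sym in dy.
have dyx := metric_triangle (i y) (i x) (j point).
rewrite isoi (metric_sym y x) in dyx.
have := @kint_diff f x y point r' lf r'0.
rewrite LE -EFinM lee_fin => h; apply: (le_lt_trans (h _ _)).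
- by rewrite /r'; lra.
- by rewrite /r'; lra.
move: ye; rewrite ltr_pdivlMr// => ye; apply: le_lt_trans ye.
by have := mdist_ge0 x y; nra.
Qed.

Lemma Av_cont f x (e : R) : locint f -> 0 < e -> exists2 r : R, 0 < r &
  forall y, mdist x y < r -> `|Av f x - Av f y| < e.
Proof.
move=> lf e0; have a0 := kmass_gt0 x.
pose N : R := `|kint f x|; have N0 : 0 <= N by exact: normr_ge0.
pose a := kmass x.
pose e1 := Num.min (a / 2) (e * a ^+ 2 / (4 * (a + N))).
have aN : 0 < 4 * (a + N) by rewrite /a; lra.
have e10 : 0 < e1.
  by rewrite lt_min !divr_gt0//= mulr_gt0// exprn_gt0.
have [r1 r10 h1] := kint_cont x lf e10.
have [r2 r20 h2] := kint_cont x (locint_cst 1) e10.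
exists (Num.min r1 r2); first by rewrite lt_min r10.
move=> y; rewrite lt_min => /andP[/h1 k1 /h2]; rewrite -!/(kmass _) -/a => k2.
have b0 := kmass_gt0 y; set b := kmass y in k2 b0 *.
have e1a : e1 <= a / 2 by rewrite ge_min lexx.
have e1e : e1 * (4 * (a + N)) <= e * a ^+ 2.
  by rewrite -ler_pdivlMr// ge_min lexx orbT.
have ab : a / 2 <= b by move: k2; rewrite ltr_norml; lra.
rewrite /Av -/a -/b.
have -> : kint f x / a - kint f y / b =
   ((kint f x - kint f y) * a - kint f x * (a - b)) / (a * b).
  by field; rewrite !gt_eqF.
rewrite normrM normfV (gtr0_norm (mulr_gt0 _ _))// ltr_pdivrMr ?mulr_gt0//.
apply: (le_lt_trans (ler_normB _ _)); rewrite !normrM -/N (gtr0_norm a0) -/a.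
have h : e1 * (a + N) * 4 <= e * (a * b) * 2.
  have : e * (a * a) <= e * (a * (2 * b)).
    by rewrite ler_wpM2l ?(ltW e0)// ler_wpM2l ?(ltW a0)//; lra.
  by rewrite -expr2; lra.
have : `|kint f x - kint f y| * a < e1 * a by rewrite ltr_pM2r.
have : N * `|a - b| <= N * e1 by rewrite ler_wpM2l// ltW.
have : 0 < e * (a * b) by rewrite !mulr_gt0.
by lra.
Qed.

Lemma measurable_Av f : locint f -> measurable_fun [set: Om] (Av f).
Proof. by move=> lf; apply: metric_measurable_fun => x e; exact: Av_cont. Qed.

End averaging.

(** * Averages in a Whitney layer *)

Section averaging_estimates.
Context (R : realType) (dO : measure_display) (Om : borelMetricType R dO)
  (mu : {measure set Om -> \bar R}) (Y : metricType R) (i : Om -> Y)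
  (Cmu : R).
Hypothesis isoi : forall x y, mdist (i x) (i y) = mdist x y.
Hypothesis densi : forall y (e : R), 0 < e -> exists x, mdist y (i x) < e.
Hypothesis dbl : doubling_with mu Cmu.
Context (dB : measure_display) (B : borelMetricType R dB) (j : B -> Y).
Hypothesis isoj : forall x y, mdist (j x) (j y) = mdist x y.
Hypothesis sep : forall x, exists2 e : R, 0 < e & forall z, e <= mdist (i x) (j z).
Context (nu : {measure set B -> \bar R}).
Hypothesis fin : forall z (r : R), 0 < r ->
  (0 < nu (ball z r))%E /\ (nu (ball z r) < +oo)%E.
Context (theta Ct Rmax : R).
Hypothesis htheta : 0 < theta.
Hypothesis hCt : 1 <= Ct.
Hypothesis reg : forall z (r : R), 0 < r -> r <= Rmax ->
  (Ct^-1%:E * (mu (tball i (j z) r) / (r `^ theta)%:E) <= nu (ball z r))%E /\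
  (nu (ball z r) <= Ct%:E * (mu (tball i (j z) r) / (r `^ theta)%:E))%E.

Local Notation delta := (delta i j).
Local Notation vol := (vol mu i).
Local Notation nuv := (nuv nu).
Local Notation D := (Dbl Cmu).
Local Notation Av := (Av i j nu).
Local Notation kmass := (kmass i j nu).
Local Notation kint := (kint i j nu).
Local Notation locint := (locint nu).

Lemma reg_real z (r : R) : 0 < r -> r <= Rmax ->
  vol (j z) r <= Ct * r `^ theta * nuv z r /\
  nuv z r <= Ct * (vol (j z) r / r `^ theta).
Proof.
move=> r0 rR; have rt : 0 < r `^ theta by exact: powR_gt0.
have Ct0 : 0 < Ct by exact: lt_le_trans ltr01 hCt.
have [] := reg z r0 rR; rewrite (nuE fin)// (mu_tball isoi densi dbl)//.
rewrite inver gt_eqF// -!EFinM !lee_fin => h1 h2; split => //.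
by move: h1; rewrite ler_pdivrMl// ler_pdivrMr// mulrAC.
Qed.

(** Up to the factor r^theta, which is monotone in r, nu compares with mu, and
    the trace balls are doubling. *)
Lemma nuv_cmp n z w (r s : R) : 0 < r -> r <= s -> s <= Rmax ->
  mdist (j w) (j z) + s <= 2 ^+ n * r ->
  nuv z s <= Ct ^+ 2 * D ^+ n * nuv w r.
Proof.
move=> r0 rs sR h; have s0 : 0 < s by exact: lt_le_trans rs.
have Ct0 : 0 < Ct by exact: lt_le_trans ltr01 hCt.
have [_ /le_trans] := reg_real z s0 sR; apply.
have [h1 _] := reg_real w r0 (le_trans rs sR).
have rt : 0 < r `^ theta by exact: powR_gt0.
have st : 0 < s `^ theta by exact: powR_gt0.
have rst : r `^ theta <= s `^ theta.
  by apply: powR_le; rewrite ?(ltW htheta) ?(ltW r0).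
have Dn : 0 <= D ^+ n by rewrite exprn_ge0// (le_trans ler01) ?(Dbl_ge1 dbl).
have h2 := vol_cmp isoi densi dbl r0 s0 h.
rewrite expr2 -!mulrA ler_pM2l// ler_pdivrMr//.
apply: (le_trans h2).
rewrite [leRHS](_ : _ = D ^+ n * (Ct * s `^ theta * nuv w r)); last by ring.
apply: ler_wpM2l => //; apply: (le_trans h1).
by rewrite -!mulrA ler_pM2l// ler_wpM2r// ltW// (nuv_gt0 fin).
Qed.

(** The quotient kern x / kmass x is at most CA divided by the nu-measure of a
    boundary ball of radius 16 rho, in the region delta x ~ rho. *)
Definition CA := 32 * Ct ^+ 2 * D ^+ 7.

Lemma CA_ge1 : 1 <= CA.
Proof.
have h1 : 1 <= Ct ^+ 2 by rewrite exprn_ege1.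
have h2 : 1 <= D ^+ 7 by rewrite exprn_ege1// (Dbl_ge1 dbl).
by rewrite /CA; nra.
Qed.

(** Jensen's inequality for the mean over the ball. *)
Lemma pow_avg f w (r p c u : R) : 0 < r -> 1 <= p -> locint f -> 0 <= c -> 0 <= u ->
  (u%:E <= (c / nuv w r)%:E * \int[nu]_(z in ball w r) `|f z|%:E)%E ->
  ((u `^ p)%:E <= (c `^ p / nuv w r)%:E *
    \int[nu]_(z in ball w r) (`|f z| `^ p)%:E)%E.
Proof.
move=> r0 p1 [mf intf] c0 u0 h.
have p0 : 0 <= p by lra.
have n0 : 0 < nuv w r by exact: nuv_gt0.
have J := jensen_powR (measurable_bball w r) (nuE fin w r0) n0 p1
  (measurableT_comp (@normr_measurable _ _) mf) (fun x => normr_ge0 _).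
have u0' : (0 <= u%:E)%E by rewrite lee_fin.
have := lee_poweR p0 u0' h.
rewrite poweR_EFin => /le_trans; apply.
rewrite poweRM ?lee_fin ?divr_ge0 ?(ltW n0)//; last first.
  by apply: integral_ge0 => z _; rewrite lee_fin.
rewrite poweR_EFin; set n := nuv _ _ in n0 J *.
apply: (@le_trans _ _ (((c / n) `^ p)%:E * ((n `^ (p - 1))%:E *
    \int[nu]_(z in ball w r) (`|f z| `^ p)%:E)))%E.
  by apply: lee_wpmul2l => //; rewrite lee_fin powR_ge0.
rewrite muleA -EFinM (_ : (c / n) `^ p * _ = c `^ p / n)//.
have nE : n^-1 = n `^ (-1) by rewrite powR_inv1// ltW.
rewrite nE powRM ?powR_ge0// -powRrM -mulrA -powRD; last first.
  by rewrite (gt_eqF n0) implybT.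
by congr (_ * _ `^ _); ring.
Qed.

Variables (rho : R) (rho0 : 0 < rho) (rhoR : 16 * rho <= Rmax).

(** The kernel is at least delta x on the ball of radius rho / 4 about a
    boundary point almost closest to x. *)
Lemma kmass_low x w : rho / 4 <= delta x -> mdist (i x) (j w) < 3 * rho ->
  delta x <= 2 * rho -> 8 * rho * nuv w (16 * rho) <= CA * kmass x.
Proof.
have rho0' := rho0; move=> d1 xw d2; have d0 := delta_gt0 sep x.
have [|z xz] := @delta_lt _ _ _ _ i _ _ j x (2 * delta x); first by lra.
have r40 : 0 < rho / 4 by lra.
have h1 : delta x * nuv z (rho / 4) <= kmass x.
  by apply: kmass_ge => //; lra.
have h2 : nuv w (16 * rho) <= Ct ^+ 2 * D ^+ 7 * nuv z (rho / 4).
  (* 2 ^+ 7 * (rho / 4) = 32 * rho, while z and w are at most 7 * rho apart *)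
  apply: nuv_cmp => //; first by lra.
  have := metric_triangle (j z) (i x) (j w); rewrite (metric_sym (j z) (i x)).
  by rewrite !exprS expr0; lra.
have n0 : 0 < nuv z (rho / 4) by exact: nuv_gt0.
have CD : 0 < Ct ^+ 2 * D ^+ 7 by rewrite mulr_gt0// exprn_gt0// (lt_le_trans ltr01)// (Dbl_ge1 dbl).
apply: (@le_trans _ _ (8 * rho * (Ct ^+ 2 * D ^+ 7 * nuv z (rho / 4)))).
  by rewrite ler_wpM2l//; lra.
have h3 : rho / 4 * nuv z (rho / 4) <= kmass x.
  by apply: le_trans h1; rewrite ler_wpM2r// ltW.
have := ler_wpM2l (ltW CD) h3.
by rewrite /CA -[32 * _ * _]mulrA; set q := Ct ^+ 2 * _; lra.
Qed.

Let supp x w : mdist (i x) (j w) < 3 * rho -> delta x <= 2 * rho ->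
  4 * delta x + mdist (i x) (j w) <= 16 * rho.
Proof. by have := rho0; lra. Qed.

Let rho16 : 0 < 16 * rho. Proof. by have := rho0; lra. Qed.

Lemma Av_le f x w : locint f ->
  rho / 4 <= delta x -> mdist (i x) (j w) < 3 * rho -> delta x <= 2 * rho ->
  (`|Av f x|%:E <= (CA / nuv w (16 * rho))%:E *
    \int[nu]_(z in ball w (16 * rho)%R) `|f z|%:E)%E.
Proof.
have rho0' := rho0; move=> lf d1 xw d2; have lo := kmass_low d1 xw d2.
have n0 : 0 < nuv w (16 * rho) by exact: nuv_gt0.
have a0 := kmass_gt0 isoj sep fin x.
have [_ h] := kint_bound isoj sep lf rho16 (supp xw d2).
rewrite /Av normrM normfV (gtr0_norm a0) EFinM muleC.
apply: (@le_trans _ _ ((kmass x)^-1%:E * ((4 * delta x)%:E * \int[nu]_(z in ball w (16 * rho)%R) `|f z|%:E)))%E.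
  by apply: lee_wpmul2l => //; rewrite lee_fin invr_ge0 ltW.
rewrite muleA -EFinM; apply: lee_wpmul2r.
  by apply: integral_ge0 => z _; rewrite lee_fin.
rewrite lee_fin mulrC ler_pdivrMr// mulrAC ler_pdivlMr//.
by apply: le_trans lo; rewrite ler_wpM2r ?(ltW n0)//; lra.
Qed.

(** The Lipschitz constant of Av at unit distance from the boundary, relative to
    the mean of f. *)
Definition CL := 2 * CA ^+ 2.

(** Quotient rule: kint f and its normalisation kmass = kint 1 both vary by at
    most 5 d(x, y) times an integral over the ball, while kmass is of order rho
    times the measure of the ball. *)
Lemma Av_diff_le f x y w : locint f ->
  rho / 4 <= delta x -> mdist (i x) (j w) < 3 * rho -> delta x <= 2 * rho ->
  rho / 4 <= delta y -> mdist (i y) (j w) < 3 * rho -> delta y <= 2 * rho ->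
  (`|Av f x - Av f y|%:E <= (CL * (mdist x y / rho) / nuv w (16 * rho))%:E *
    \int[nu]_(z in ball w (16 * rho)%R) `|f z|%:E)%E.
Proof.
have rho0' := rho0; move=> lf d1 xw d2 e1 yw e2; have lo := kmass_low d1 xw d2.
have n0 : 0 < nuv w (16 * rho) by exact: nuv_gt0.
have a0 := kmass_gt0 isoj sep fin x.
have b0 := kmass_gt0 isoj sep fin y.
have I0 : (0 <= \int[nu]_(z in ball w (16 * rho)%R) `|f z|%:E)%E.
  by apply: integral_ge0 => z _; rewrite lee_fin.
have h1 := kint_diff isoi isoj sep lf rho16 (supp xw d2) (supp yw e2).
have h2 := kint_diff isoi isoj sep (locint_cst fin 1) rho16 (supp xw d2) (supp yw e2).
have h3 := Av_le lf e1 yw e2.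
have E1 : (\int[nu]_(z in ball w (16 * rho)%R) `|(cst 1 : B -> R) z|%:E = (nuv w (16 * rho))%:E)%E.
  rewrite -nuE//; under eq_integral do rewrite /= normr1.
  by rewrite integral_cst ?mul1e//; exact: measurable_bball.
have finI : (\int[nu]_(z in ball w (16 * rho)%R) `|f z|%:E)%E \is a fin_num.
  have /integrableP[_ ?] := lf.2 w _ rho16.
  by rewrite ge0_fin_numE.
move: E1 h1 h2 h3; rewrite -(fineK finI); move: (fine _) (fineK finI) I0 => I <-.
rewrite lee_fin => I0 ->; rewrite -!EFinM !lee_fin => h1 h2 h3.
rewrite -!/(kmass _) in h2.
set a := kmass x in a0 lo h2 *; set b := kmass y in b0 h2 *.
set n := nuv _ _ in n0 lo h2 h3 *; set m := mdist x y in h1 h2 *.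
have m0 : 0 <= m by exact: mdist_ge0.
have CA1 := CA_ge1.
have -> : Av f x - Av f y = (kint f x - kint f y) / a - Av f y * (a - b) / a.
  by rewrite /Av -/a -/b; field; rewrite !gt_eqF.
rewrite -mulrBl normrM normfV (gtr0_norm a0) ler_pdivrMr//.
apply: (le_trans (ler_normB _ _)); rewrite normrM.
have h4 : `|Av f y| * `|a - b| <= CA * (5 * m) * I.
  apply: (@le_trans _ _ ((CA / n * I) * (5 * m * n))).
    by apply: ler_pM.
  by rewrite le_eqVlt; apply/orP; left; apply/eqP; field; rewrite gt_eqF.
have h5 : 5 * m * I * (1 + CA) * (8 * rho * n) <= 5 * m * I * (2 * CA) * (CA * a).
  apply: ler_pM => //; rewrite ?mulr_ge0//; try lra.
  by apply: ler_wpM2l; [rewrite !mulr_ge0|lra].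
have rn : 0 < 8 * rho * n by rewrite !mulr_gt0.
have h6 : CL * (m / rho) / n * I * a * (8 * rho * n) = 16 * m * I * CA * (CA * a).
  by rewrite /CL; field; rewrite !gt_eqF.
rewrite -(ler_pM2r rn) h6.
have CA0 : 0 <= CA by lra.
have h7 : 0 <= m * I * (CA * (CA * a)).
  apply: mulr_ge0; first exact: mulr_ge0.
  by apply: (mulr_ge0 CA0); apply: (mulr_ge0 CA0); exact: ltW.
apply: (@le_trans _ _ (5 * m * I * (1 + CA) * (8 * rho * n))).
  by rewrite ler_wpM2r ?(ltW rn)//; lra.
by apply: (le_trans h5); lra.
Qed.

Lemma Av_pow f x w p : 1 <= p -> locint f ->
  rho / 4 <= delta x -> mdist (i x) (j w) < 3 * rho -> delta x <= 2 * rho ->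
  ((`|Av f x| `^ p)%:E <= (CA `^ p / nuv w (16 * rho))%:E *
    \int[nu]_(z in ball w (16 * rho)%R) (`|f z| `^ p)%:E)%E.
Proof.
move=> p1 lf d1 xw d2; apply: pow_avg => //; last exact: Av_le.
by have := CA_ge1; lra.
Qed.

Lemma Av_diff_pow f x y w p : 1 <= p -> locint f ->
  rho / 4 <= delta x -> mdist (i x) (j w) < 3 * rho -> delta x <= 2 * rho ->
  rho / 4 <= delta y -> mdist (i y) (j w) < 3 * rho -> delta y <= 2 * rho ->
  ((`|Av f x - Av f y| `^ p)%:E <=
   ((CL * (mdist x y / rho)) `^ p / nuv w (16 * rho))%:E *
    \int[nu]_(z in ball w (16 * rho)%R) (`|f z| `^ p)%:E)%E.
Proof.
move=> p1 lf d1 xw d2 e1 yw e2; apply: pow_avg => //.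
  by rewrite mulr_ge0 ?divr_ge0 ?mdist_ge0 ?(ltW rho0)// /CL mulr_ge0// exprn_ge0//; have := CA_ge1; lra.
exact: Av_diff_le.
Qed.

End averaging_estimates.

(** * Integration over boundary layers *)

Section layers.
Context (R : realType) (dO : measure_display) (Om : borelMetricType R dO)
  (mu : {measure set Om -> \bar R}) (Y : metricType R) (i : Om -> Y)
  (Cmu : R).
Hypothesis isoi : forall x y, mdist (i x) (i y) = mdist x y.
Hypothesis densi : forall y (e : R), 0 < e -> exists x, mdist y (i x) < e.
Hypothesis dbl : doubling_with mu Cmu.
Context (dB : measure_display) (B : borelMetricType R dB) (j : B -> Y).
Hypothesis isoj : forall x y, mdist (j x) (j y) = mdist x y.
Hypothesis sep : forall x, exists2 e : R, 0 < e & forall z, e <= mdist (i x) (j z).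
Context (nu : {measure set B -> \bar R}).
Hypothesis fin : forall z (r : R), 0 < r ->
  (0 < nu (ball z r))%E /\ (nu (ball z r) < +oo)%E.
Context (theta Ct Rmax : R).
Hypothesis htheta : 0 < theta.
Hypothesis hCt : 1 <= Ct.
Hypothesis reg : forall z (r : R), 0 < r -> r <= Rmax ->
  (Ct^-1%:E * (mu (tball i (j z) r) / (r `^ theta)%:E) <= nu (ball z r))%E /\
  (nu (ball z r) <= Ct%:E * (mu (tball i (j z) r) / (r `^ theta)%:E))%E.

Local Notation delta := (delta i j).
Local Notation vol := (vol mu i).
Local Notation nuv := (nuv nu).
Local Notation D := (Dbl Cmu).
Local Notation Av := (Av i j nu).
Local Notation locint := (locint nu).
Local Notation CA := (CA Cmu Ct).

Let D1 : 1 <= D. Proof. exact: Dbl_ge1 dbl. Qed.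
Let D0 n : 0 <= D ^+ n. Proof. by rewrite exprn_ge0// (le_trans ler01). Qed.
Let Ct0 : 0 < Ct. Proof. exact: lt_le_trans ltr01 hCt. Qed.

Definition avg (f : B -> R) w (r : R) := (\int[nu]_(z in ball w r) f z) / nuv w r.

Lemma avg_dev f w (r a : R) : 0 < r -> locint f ->
  (`|a - avg f w r|%:E <= (nuv w r)^-1%:E *
    \int[nu]_(z in ball w r) `|a - f z|%:E)%E.
Proof.
move=> r0 [mf intf]; have n0 : 0 < nuv w r by exact: nuv_gt0.
have mb := measurable_bball w r.
have ic : nu.-integrable (ball w r) (EFin \o (cst a : B -> R)).
  exact: (locint_cst fin a).2.
have id : nu.-integrable (ball w r) (EFin \o (fun z => a - f z)).
  by rewrite [X in nu.-integrable _ X](_ : _ = (EFin \o cst a) \- (EFin \o f))%E//; apply: integrableB => //; exact: intf.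
have -> : a - avg f w r = (\int[nu]_(z in ball w r) (a - f z)) / nuv w r.
  rewrite RintegralB//; last exact: intf.
  rewrite Rintegral_cst// -/(nuv w r) /avg.
  by field; rewrite gt_eqF.
rewrite normrM normfV (gtr0_norm n0) mulrC EFinM.
apply: lee_wpmul2l; first by rewrite lee_fin invr_ge0 ltW.
apply: (@le_trans _ _ (\int[nu]_(z in ball w r) `|a - f z|)%R%:E).
  by rewrite lee_fin le_normr_Rintegral.
rewrite /Rintegral fineK//.
by have /integrableP[_ ?] := id; rewrite ge0_fin_numE//; apply: integral_ge0.
Qed.

(** Jensen's inequality for the mean of a - f. *)
Lemma avg_dev_pow f w (r a p : R) : 0 < r -> 1 <= p -> locint f ->
  ((`|a - avg f w r| `^ p)%:E <= (nuv w r)^-1%:E *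
    \int[nu]_(z in ball w r) (`|a - f z| `^ p)%:E)%E.
Proof.
move=> r0 p1 lf; have := @pow_avg _ _ _ nu fin (fun z => a - f z) w r p 1 (`|a - avg f w r|) r0 p1.
rewrite powR1 mul1r; apply => //; last exact: avg_dev.
have := locintD (-1) lf (locint_cst fin a).
rewrite (_ : (fun z => _) = (fun z => a - f z))//.
by apply/funext => z; rewrite mulN1r addrC.
Qed.

(** Every point of the layer is close to a net point, so the pointwise bound can
    be integrated on each trace ball T(z n, 2 rho) separately. The bound is
    constant there, and the mu-measure of the trace ball over the nu-measure of
    the boundary ball is at most a multiple of rho^theta. *)
Lemma layer_bound (rho c : R) (z : nat -> B) (P : set nat) (E : set Om)
    (F : Om -> \bar R) (h : nat -> B -> \bar R) :
  0 < rho -> 16 * rho <= Rmax -> is_net i j rho z P -> 0 <= c ->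
  (forall n w, (0 <= h n w)%E) -> (forall x, E x -> delta x < rho) ->
  (forall x n, E x -> P n -> mdist (i x) (j (z n)) < 2 * rho ->
    (F x <= (c / nuv (z n) (16 * rho))%:E *
      \int[nu]_(w in ball (z n) (16 * rho)%R) h n w)%E) ->
  outer_le mu E F ((c * (Ct * (16 * rho) `^ theta))%:E *
    \sum_(n <oo) \int[nu]_(w in netB j z P n (16 * rho)%R) h n w)%E.
Proof.
move=> rho0 rhoR [_ cover] c0 h0 Edelta hF.
have r160 : 0 < 16 * rho by lra.
have r30 : 0 < 2 * rho by lra.
have K0 : 0 <= c * (Ct * (16 * rho) `^ theta).
  by rewrite !mulr_ge0 ?powR_ge0// ltW.
have I0 n r : (0 <= \int[nu]_(w in netB j z P n r) h n w)%E.
  by apply: integral_ge0.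
rewrite -nneseriesZl//.
apply: (@outer_le_bigcup _ _ _ mu _ (fun n => E `&` netT i j z P n (2 * rho))).
  move=> x Ex; have [u xu] := delta_lt (Edelta _ Ex).
  have [n Pn un] := cover u; exists n => //; split => //; split => //=.
  rewrite metric_sym; apply: le_lt_trans (metric_triangle _ (j u) _) _; lra.
move=> n; have [Pn|nP] := pselect (P n); last first.
  exists (cst 0%E); split => //; first by move=> x [_ []].
  by rewrite integral0 mule_ge0// lee_fin.
have n0 : 0 < nuv (z n) (16 * rho) by exact: nuv_gt0.
have J0 : (0 <= (c / nuv (z n) (16 * rho))%:E *
      \int[nu]_(w in ball (z n) (16 * rho)%R) h n w)%E.
  by rewrite mule_ge0 ?integral_ge0// lee_fin divr_ge0// ltW.
apply: (@outer_le_sub _ _ _ mu _ (netT i j z P n (2 * rho)) _ (cst ((c / nuv (z n) (16 * rho))%:E *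
      \int[nu]_(w in ball (z n) (16 * rho)%R) h n w)%E) _ _ _ _ (lexx _)) => //.
- by move=> x [Ex [_ xn]]; apply: hF => //; rewrite metric_sym.
apply: outer_le_integral => //; first exact: (measurable_netT isoi).
rewrite integral_cst; last exact: (measurable_netT isoi).
rewrite netTE// netBE// (mu_tball isoi densi dbl)// muleAC -EFinM.
apply: lee_wpmul2r; first exact: integral_ge0.
rewrite lee_fin mulrAC ler_pdivrMr// -mulrA; apply: ler_wpM2l => //.
have [le _] := @reg_real _ _ _ mu _ _ _ isoi densi dbl _ _ j nu fin theta Ct Rmax hCt reg (z n) _ r160 rhoR.
apply: le_trans le; apply: (le_vol isoi densi dbl) => //.
by rewrite mdistxx; lra.
Qed.

Lemma net_integral_le (rho : R) (z : nat -> B) (P : set nat) m (h : B -> \bar R) :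
  0 < rho -> is_net i j rho z P -> measurable_fun [set: B] h ->
  (forall w, (0 <= h w)%E) ->
  (\sum_(n <oo) \int[nu]_(w in netB j z P n (2 ^+ m * rho)%R) h w <=
    (D ^+ (m + 3))%:E * \int[nu]_w h w)%E.
Proof.
move=> rho0 netz mh h0; apply: sum_integral_overlap => //.
  by move=> n; exact: (measurable_netB isoj).
by move=> x N; exact: (overlapB isoi densi dbl rho0 netz).
Qed.

Definition CS m := Ct ^+ 2 * D ^+ (m + 5).

(** A net ball B n has radius r = 2 ^+ m * rho; for w in B n it is contained in
    B(w, 2 r) and has a comparable measure, hence the deviation of f w from its
    mean over B n is at most the mean oscillation of f about w at scale 2 r.
    The net balls overlap boundedly. *)
Lemma net_dev_le (rho p : R) (z : nat -> B) (P : set nat) m (f : B -> R) :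
  0 < rho -> 1 <= p -> 2 ^+ m.+1 * rho <= Rmax -> is_net i j rho z P -> locint f ->
  (\sum_(n <oo) \int[nu]_(w in netB j z P n (2 ^+ m * rho)%R)
     (`|f w - avg f (z n) (2 ^+ m * rho)| `^ p)%:E <=
    (CS m)%:E * besov_osc nu p (2 ^+ m.+1 * rho) f)%E.
Proof.
move=> rho0 p1 rhoR netz lf; have [mf intf] := lf.
pose r := 2 ^+ m * rho; have r0 : 0 < r by rewrite mulr_gt0// exprn_gt0.
have r2E : 2 ^+ m.+1 * rho = 2 * r by rewrite exprS mulrA.
rewrite r2E -/r; rewrite r2E in rhoR.
have mg n : measurable_fun [set: B] (fun w => (`|f w - avg f (z n) r| `^ p)%:E).
  apply: measurable_norm_powR.
  by apply: measurable_funB => //; exact: measurable_cst.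
have CS0 : 0 <= CS m by rewrite /CS mulr_ge0// ltW// exprn_gt0.
pose osc w := ((nu (ball w (2 * r)))^-1 * \int[nu]_(y in ball w (2 * r)%R) (`|f y - f w| `^ p)%:E)%E.
have osc0 w : (0 <= osc w)%E by rewrite mule_ge0 ?inve_ge0 ?integral_ge0// => y _; rewrite lee_fin powR_ge0.
have pt w n : netB j z P n r w ->
    ((`|f w - avg f (z n) r| `^ p)%:E <= (Ct ^+ 2 * D ^+ 2)%:E * osc w)%E.
  move=> [Pn nw]; have nn0 : 0 < nuv (z n) r by exact: nuv_gt0.
  apply: (le_trans (avg_dev_pow (z n) (f w) r0 p1 lf)).
  rewrite /osc (nuE fin); last by lra.
  have n20 : 0 < nuv w (2 * r) by apply: (nuv_gt0 fin); lra.
  rewrite inver gt_eqF// muleA -EFinM; apply: lee_pmul.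
  - by rewrite lee_fin invr_ge0 ltW.
  - by apply: integral_ge0 => y _; rewrite lee_fin powR_ge0.
  - rewrite lee_fin ler_pdivlMr// mulrC ler_pdivrMr//.
    apply: (@nuv_cmp _ _ _ mu _ _ _ isoi densi dbl _ _ j nu fin theta Ct Rmax htheta hCt reg) => //; first by lra.
    by rewrite !exprS expr0; lra.
  rewrite integral_mkcond [leRHS]integral_mkcond.
  apply: ge0_le_integral_outer => y _; rewrite !patchE.
    by case: ifP => _; rewrite ?lexx// lee_fin powR_ge0.
  case: ifPn => [/set_mem zy|_]; last first.
    by case: ifP => _; [rewrite lee_fin powR_ge0|exact: lexx].
  have wy : ball w (2 * r) y.
    rewrite ballEmdist/=; move: zy; rewrite ballEmdist/= => zy.
    apply: le_lt_trans (metric_triangle _ (z n) _) _.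
    by rewrite metric_sym -isoj; lra.
  by rewrite mem_set// distrC.
rewrite (eq_eseriesr (g := fun n => (\int[nu]_w ((\1_(netB j z P n r) w)%:E * (`|f w - avg f (z n) r| `^ p)%:E))%E)); last first.
  move=> n _; rewrite integral_mkcond; apply: eq_integral => x _.
  by rewrite patchE indicE; case: (x \in _); rewrite ?mul1e ?mul0e.
have mB n : measurable (netB j z P n r) by exact: (measurable_netB isoj).
rewrite -integral_nneseries//; last first.
  move=> n; apply: emeasurable_funM => //; apply/measurable_EFinP.
  exact: measurable_indic.
apply: (@le_trans _ _ (\int[nu]_w ((CS m)%:E * osc w))%E); last first.
  apply: ge0_integralZl_outer => //.
  by apply: mulr_gt0; apply: exprn_gt0 => //; exact: lt_le_trans ltr01 D1.
apply: ge0_le_integral_outer => w _.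
  by apply: nneseries_ge0 => n _ _; rewrite mule_ge0// lee_fin powR_ge0.
apply: lime_le; first by apply: is_cvg_nneseries => n _ _; rewrite mule_ge0// lee_fin powR_ge0.
near=> N; apply: (@le_trans _ _ (\sum_(n < N) ((\1_(netB j z P n r) w)%:E * ((Ct ^+ 2 * D ^+ 2)%:E * osc w)))%E).
  rewrite big_mkord; apply: lee_sum => n _; rewrite indicE.
  case: (boolP (w \in _)) => [/set_mem wn|_]; last by rewrite !mul0e.
  by rewrite !mul1e; exact: pt.
rewrite -ge0_sume_distrl; last by move=> n _; rewrite lee_fin.
rewrite sumEFin muleA -EFinM; apply: lee_wpmul2r => //.
rewrite lee_fin /CS mulrCA; apply: ler_wpM2l; first by rewrite exprn_ge0// ltW.
rewrite mulrC; have -> : D ^+ (m + 5) = D ^+ 2 * D ^+ (m + 3).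
  by rewrite -exprD addnCA.
by apply: ler_wpM2l => //; exact: (overlapB isoi densi dbl rho0 netz).
Unshelve. all: by end_near. Qed.

End layers.

Section trace_bound.
Context (R : realType) (dO : measure_display) (Om : borelMetricType R dO)
  (mu : {measure set Om -> \bar R}) (Y : metricType R) (i : Om -> Y)
  (Cmu : R).
Hypothesis isoi : forall x y, mdist (i x) (i y) = mdist x y.
Hypothesis densi : forall y (e : R), 0 < e -> exists x, mdist y (i x) < e.
Hypothesis dbl : doubling_with mu Cmu.
Context (dB : measure_display) (B : borelMetricType R dB) (j : B -> Y).
Hypothesis isoj : forall x y, mdist (j x) (j y) = mdist x y.
Hypothesis sep : forall x, exists2 e : R, 0 < e & forall z, e <= mdist (i x) (j z).
Context (nu : {measure set B -> \bar R}).
Hypothesis fin : forall z (r : R), 0 < r ->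
  (0 < nu (ball z r))%E /\ (nu (ball z r) < +oo)%E.
Context (theta Ct Rmax : R).
Hypothesis htheta : 0 < theta.
Hypothesis hCt : 1 <= Ct.
Hypothesis reg : forall z (r : R), 0 < r -> r <= Rmax ->
  (Ct^-1%:E * (mu (tball i (j z) r) / (r `^ theta)%:E) <= nu (ball z r))%E /\
  (nu (ball z r) <= Ct%:E * (mu (tball i (j z) r) / (r `^ theta)%:E))%E.

Local Notation delta := (delta i j).
Local Notation vol := (vol mu i).
Local Notation nuv := (nuv nu).
Local Notation D := (Dbl Cmu).
Local Notation Av := (Av i j nu).
Local Notation locint := (locint nu).
Local Notation CA := (CA Cmu Ct).

Let D1 : 1 <= D. Proof. exact: Dbl_ge1 dbl. Qed.
Let D0 n : 0 <= D ^+ n. Proof. by rewrite exprn_ge0// (le_trans ler01). Qed.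
Let Ct0 : 0 < Ct. Proof. exact: lt_le_trans ltr01 hCt. Qed.
Local Notation avg := (avg nu).

Let CA1 : 1 <= CA. Proof. exact: (CA_ge1 dbl hCt). Qed.

(** The last factor is the sum of the geometric series of the layers. *)
Definition KA p := CA `^ p * Ct * 16 `^ theta * D ^+ 7 / (1 - 2 `^ (- theta)).

(** In the layer delta ~ rho / 2 ^+ k, the mu-mass of a trace ball is
    (rho / 2 ^+ k)^theta times the nu-mass of a boundary ball; this is summable
    in k. *)
Lemma Av_Lp_outer (rho p : R) (g : B -> R) : 0 < rho -> 16 * rho <= Rmax ->
  1 <= p -> locint g ->
  outer_le mu [set x | delta x < rho] (fun x => (`|Av g x| `^ p)%:E)
    ((KA p * rho `^ theta)%:E * \int[nu]_w (`|g w| `^ p)%:E)%E.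
Proof.
move=> rho0 rhoR p1 lg; pose x2 := 2 `^ (- theta).
have x20 : 0 < x2 by exact: powR_gt0.
have x21 : x2 < 1 by exact: powR2N_lt1.
pose rk k := rho / 2 ^+ k.
have rk0 k : 0 < rk k by rewrite divr_gt0// exprn_gt0.
have rkR k : 16 * rk k <= Rmax.
  apply: le_trans rhoR; rewrite ler_wpM2l// /rk ler_pdivrMr ?exprn_gt0//.
  by rewrite ler_peMr ?(ltW rho0)// exprn_ege1// ler1n.
pose I := (\int[nu]_w (`|g w| `^ p)%:E)%E.
have I0 : (0 <= I)%E by apply: integral_ge0 => w _; rewrite lee_fin powR_ge0.
pose a := CA `^ p * (Ct * (16 * rho) `^ theta) * D ^+ 7.
have a0 : 0 <= a.
  rewrite /a; apply: mulr_ge0 => //; apply: mulr_ge0; first exact: powR_ge0.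
  by apply: mulr_ge0; rewrite ?(ltW Ct0) ?powR_ge0.
(* each layer is covered by trace balls from a net of its own size *)
pose E k := [set x : Om | rk k / 2 <= delta x /\ delta x < rk k].
have rkE k : (16 * rk k) `^ theta = (16 * rho) `^ theta * x2 ^+ k.
  rewrite /rk mulrA powRM ?mulr_ge0 ?invr_ge0 ?exprn_ge0 ?(ltW rho0)//; congr (_ * _).
  rewrite /x2 -powR_mulrn ?powR_ge0// -powRrM -powR_invn// -powRrM.
  by congr (_ `^ _); ring.
apply: (@outer_le_sub _ _ _ mu _ (\bigcup_k E k) _ (fun x => (`|Av g x| `^ p)%:E) (\sum_(k <oo) ((x2 ^+ k)%:E * (a%:E * I)))%E) => //.
- by move=> x /= xr; have [k hk] := dyadic_layer (delta_gt0 sep x) xr; exists k.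
- apply: (le_trans (nneseries_geometric_le (ltW x20) x21 _)); first by rewrite mule_ge0.
  rewrite muleA -EFinM; apply: lee_wpmul2r => //.
  rewrite lee_fin /KA /a powRM ?(ltW rho0)//.
  by rewrite le_eqVlt; apply/orP; left; apply/eqP; rewrite -/x2; ring.
apply: (@outer_le_bigcup _ _ _ mu _ E) => // k.
have [z [P netz]] := net_exists isoi densi dbl j (rk0 k).
have h := layer_bound isoi densi dbl isoj fin hCt reg (rk0 k) (rkR k) netz
  (powR_ge0 CA p) (E := E k) (F := fun x => (`|Av g x| `^ p)%:E)
  (h := fun _ w => (`|g w| `^ p)%:E).
have rkk := rk0 k.
apply: (outer_le_sub _ _ _ (h _ _ _)) => //.
- rewrite rkE.
  have mg := measurable_norm_powR p lg.1.
  have := net_integral_le isoi densi dbl isoj nu 4 (rk0 k) netz mg.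
  have -> : 2 ^+ 4 * rk k = 16 * rk k by rewrite -natrX.
  move=> h2.
  apply: (@le_trans _ _ ((CA `^ p * (Ct * ((16 * rho) `^ theta * x2 ^+ k)))%:E * ((D ^+ 7)%:E * I))%E).
    apply: lee_wpmul2l.
      by rewrite lee_fin; apply: mulr_ge0; rewrite ?powR_ge0//; apply: mulr_ge0; rewrite ?(ltW Ct0)// mulr_ge0 ?powR_ge0 ?exprn_ge0 ?(ltW x20).
    by apply: h2 => w; rewrite lee_fin powR_ge0.
  rewrite !muleA -!EFinM; apply: lee_wpmul2r => //.
  by rewrite lee_fin /a le_eqVlt; apply/orP; left; apply/eqP; ring.
- by move=> x [].
- move=> x n [x1 x2'] Pn xn.
  apply: (Av_pow isoi densi dbl isoj sep fin htheta hCt reg) => //; lra.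
Qed.

Definition ball_restr (g : B -> R) w (r : R) : B -> R := g \_ (ball w r).

Lemma locint_ball_restr g w r : locint g -> locint (ball_restr g w r).
Proof.
move=> [mg intg]; have mb := measurable_bball w r; split.
  by apply/(measurable_restrictT _ mb); exact: measurable_funTS.
move=> u s s0; rewrite [X in _.-integrable _ X](_ : _ = (EFin \o g) \_ (ball w r)).
  apply/integrable_restrict => //; first exact: measurable_bball.
  by apply: integrableS (intg u s s0) => //; [exact: measurable_bball|apply: measurableI => //; exact: measurable_bball].
by rewrite /ball_restr restrict_EFin.
Qed.

(** At points of the trace ball about w, the kernel lives in B(w, 8 rho), so f
    may be replaced by 0 outside this ball. *)
Lemma Av_Lp_local (rho p : R) (g : B -> R) w : 0 < rho -> 16 * rho <= Rmax ->
  1 <= p -> locint g ->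
  (\int[mu]_(x in tball i (j w) rho) (`|Av g x| `^ p)%:E <=
    (KA p * rho `^ theta)%:E * \int[nu]_(z in ball w (8 * rho)%R) (`|g z| `^ p)%:E)%E.
Proof.
move=> rho0 rhoR p1 lg; set r := 8 * rho.
have -> : (\int[nu]_(z in ball w r) (`|g z| `^ p)%:E = \int[nu]_z (`|ball_restr g w r z| `^ p)%:E)%E.
  rewrite integral_mkcond; apply: eq_integral => z _; rewrite /ball_restr !patchE.
  case: ifP => _ //; change (0%:E = (`|0 : R| `^ p)%:E); rewrite normr0 powR0 ?gt_eqF//; lra.
apply: outer_le_int; first by move=> x _; rewrite lee_fin powR_ge0.
apply: outer_le_sub (Av_Lp_outer rho0 rhoR p1 (locint_ball_restr w r lg)) => //.
  move=> x; rewrite tballE /= metric_sym => /(le_lt_trans (delta_le _ _ _ _)).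
  exact.
move=> x xw; rewrite (@Av_eq _ _ _ _ i _ _ j nu g (ball_restr g w r)) => // z xz.
rewrite /ball_restr patchE mem_set// ballEmdist/= -isoj; move: xw; rewrite tballE => xw.
have := metric_triangle (j w) (i x) (j z).
have := delta_le i j x w; rewrite (metric_sym (i x) (j w)) /r; lra.
Qed.

End trace_bound.

Lemma KA_ge0 (R : realType) (Cmu theta Ct p : R) : 0 < theta -> 1 <= Cmu -> 1 <= Ct ->
  0 <= KA Cmu theta Ct p.
Proof.
move=> theta0 Cmu1 Ct1; rewrite /KA; apply: mulr_ge0; last first.
  by rewrite invr_ge0 subr_ge0 ltW// powR2N_lt1.
have D1 : 1 <= Dbl Cmu by rewrite /Dbl exprn_ege1.
apply: mulr_ge0; last by rewrite exprn_ge0// (le_trans ler01).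
apply: mulr_ge0; rewrite ?powR_ge0//; apply: mulr_ge0; first exact: powR_ge0.
exact: le_trans ler01 Ct1.
Qed.

(** * Oscillation at one scale *)

Section oscillation.
Context (R : realType) (d : measure_display) (T : borelMetricType R d)
  (mu : {measure set T -> \bar R}).
Hypothesis fin : forall z (r : R), 0 < r ->
  (0 < mu (ball z r))%E /\ (mu (ball z r) < +oo)%E.

(** The function of x integrated in besov_osc. *)
Definition oscf (p t : R) (u : T -> R) x : \bar R :=
  ((mu (ball x t))^-1 * \int[mu]_(y in ball x t) (`|u y - u x| `^ p)%:E)%E.

Lemma oscf_ge0 p t u x : (0 <= oscf p t u x)%E.
Proof.
by rewrite mule_ge0 ?inve_ge0 ?integral_ge0// => y _; rewrite lee_fin powR_ge0.
Qed.

Lemma besov_oscE p t u : besov_osc mu p t u = (\int[mu]_x oscf p t u x)%E.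
Proof. by []. Qed.

Lemma oscf_le p t (u : T -> R) x (h : T -> \bar R) (M : \bar R) : 0 < t ->
  (forall y, mdist x y < t -> ((`|u y - u x| `^ p)%:E <= h y)%E) ->
  (\int[mu]_(y in ball x t) h y <= M * mu (ball x t))%E ->
  (oscf p t u x <= M)%E.
Proof.
move=> t0 uh hM; rewrite /oscf.
have n0 : 0 < nuv mu x t by exact: (nuv_gt0 fin).
rewrite (nuE fin x t0) inver gt_eqF// in hM *.
rewrite lee_pdivrMl// muleC; apply: le_trans hM.
apply: ge0_le_integral_outer => y; first by rewrite lee_fin powR_ge0.
by rewrite ballEmdist/=; exact: uh.
Qed.

Lemma oscf_le_cst p t (u : T -> R) x (M : \bar R) : 0 < t -> (0 <= M)%E ->
  (forall y, mdist x y < t -> ((`|u y - u x| `^ p)%:E <= M)%E) ->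
  (oscf p t u x <= M)%E.
Proof.
move=> t0 M0 uM; apply: (@oscf_le _ _ _ _ (cst M)) => //.
by rewrite integral_cst//; exact: measurable_bball.
Qed.

Lemma powR_distD p (a b c : R) : 0 <= p ->
  `|a - b| `^ p <= 2 `^ p * (`|a - c| `^ p + `|b - c| `^ p).
Proof.
move=> p0; apply: le_trans (powR_addle p0 (normr_ge0 _) (normr_ge0 _)).
by apply: powR_le => //; rewrite (distrC b c) ler_distD.
Qed.

(** Product rule: phi v varies by the variation of v plus that of phi times the
    value v x at the centre, which is constant in the inner integral. *)
Lemma oscf_cutoff (p t L : R) (v phi : T -> R) (x : T) : 0 < t -> 0 <= p ->
  0 <= L -> measurable_fun [set: T] v ->
  (forall y, 0 <= phi y <= 1) -> (forall y z, (`|phi y - phi z| <= L * mdist y z)%R) ->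
  (oscf p t (phi \* v)%R x <=
   (2 `^ p)%:E * (oscf p t v x + ((L * t) `^ p * `|v x| `^ p)%:E))%E.
Proof.
move=> t0 p0 L0 mv phi01 phiL.
pose b := (L * t) `^ p * `|v x| `^ p.
have b0 : 0 <= b by rewrite mulr_ge0 ?powR_ge0.
apply: (@oscf_le _ _ _ _ (fun y => (2 `^ p)%:E * ((`|v y - v x| `^ p)%:E + b%:E))%E) => //.
  move=> y xy /=.
  have -> : phi y * v y - phi x * v x = phi y * (v y - v x) + (phi y - phi x) * v x.
    by ring.
  rewrite -EFinD -EFinM lee_fin; apply: (@le_trans _ _ ((`|v y - v x| + L * t * `|v x|) `^ p)).
    apply: powR_le => //; apply: (le_trans (ler_normD _ _)); rewrite !normrM; apply: lerD.
      by have /andP[? ?] := phi01 y; rewrite ger0_norm// ler_piMl.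
    rewrite ler_wpM2r//; apply: (le_trans (phiL _ _)); rewrite ler_wpM2l//.
    by rewrite metric_sym ltW.
  apply: le_trans (powR_addle p0 _ _) _ => //; first by rewrite !mulr_ge0// ltW.
  rewrite ler_wpM2l ?powR_ge0// lerD2l /b powRM//.
  by rewrite mulr_ge0// ltW.
have mb := measurable_bball x t.
have n0 : 0 < nuv mu x t by exact: (nuv_gt0 fin).
have mvx : measurable_fun (ball x t) (fun y => (`|v y - v x| `^ p)%:E).
  apply: measurable_norm_powR; apply: measurable_funB => //.
  exact: measurable_funTS.
rewrite ge0_integralZl_EFin ?powR_ge0//; last 2 first.
- by move=> y _; rewrite adde_ge0// lee_fin ?powR_ge0.
- exact: emeasurable_funD.
rewrite -muleA; apply: lee_wpmul2l; first by rewrite lee_fin powR_ge0.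
rewrite ge0_integralD// integral_cst// (nuE fin x t0) muleDl//; last first.
  by rewrite ge0_adde_def// inE ?oscf_ge0// lee_fin.
rewrite leeD2r// /oscf (nuE fin x t0) inver gt_eqF// muleAC -EFinM mulVf ?gt_eqF//.
by rewrite mul1e.
Qed.

End oscillation.

Section near_boundary.
Context (R : realType) (dO : measure_display) (Om : borelMetricType R dO)
  (mu : {measure set Om -> \bar R}) (Y : metricType R) (i : Om -> Y)
  (Cmu : R).
Hypothesis isoi : forall x y, mdist (i x) (i y) = mdist x y.
Hypothesis densi : forall y (e : R), 0 < e -> exists x, mdist y (i x) < e.
Hypothesis dbl : doubling_with mu Cmu.
Context (dB : measure_display) (B : borelMetricType R dB) (j : B -> Y).

Local Notation delta := (delta i j).
Local Notation vol := (vol mu i).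
Local Notation D := (Dbl Cmu).

Let D1 : 1 <= D. Proof. exact: Dbl_ge1 dbl. Qed.
Let D0 n : 0 <= D ^+ n. Proof. by rewrite exprn_ge0// (le_trans ler01). Qed.

Lemma ball_mu_fin (x : Om) (r : R) : 0 < r ->
  (0 < mu (ball x r))%E /\ (mu (ball x r) < +oo)%E.
Proof.
move=> r0; rewrite (ball_tball isoi) (mu_tball isoi densi dbl)// ltry lte_fin.
by rewrite (vol_gt0 isoi densi dbl).
Qed.

Definition KN p := 2 `^ p * (1 + D ^+ 6).

(** The difference u y - u x is split at the constant c n attached to a net
    point, and the mean over B(x, t) is compared with the mean over a trace ball
    of radius 16 tau, which contains this ball. *)
Lemma near_osc (tau t p : R) (u : Om -> R) (z : nat -> B) (P : set nat) (c : nat -> R) :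
  0 < tau -> tau / 2 <= t -> t <= tau -> 0 <= p -> is_net i j tau z P ->
  measurable_fun [set: Om] u ->
  outer_le mu [set x | delta x < 8 * tau] (oscf mu p t u)
    ((KN p)%:E * \sum_(n <oo) \int[mu]_(x in netT i j z P n (16 * tau)%R)
       (`|u x - c n| `^ p)%:E)%E.
Proof.
move=> tau0 t1 t2 p0 [_ cover] mu_.
have t0 : 0 < t by lra.
have t16 : 0 < 16 * tau by lra.
have KN0 : 0 <= KN p by rewrite /KN mulr_ge0 ?powR_ge0// addr_ge0.
have I0 n E : (0 <= \int[mu]_(x in E) (`|u x - c n| `^ p)%:E)%E.
  by apply: integral_ge0 => x _; rewrite lee_fin powR_ge0.
rewrite -nneseriesZl//.
apply: (@outer_le_bigcup _ _ _ mu _ (fun n => netT i j z P n (9 * tau))).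
  move=> x /= x8; have [w xw] := delta_lt x8.
  have [n Pn wn] := cover w; exists n => //; split => //=.
  rewrite metric_sym; apply: le_lt_trans (metric_triangle _ (j w) _) _; lra.
move=> n; have [Pn|nP] := pselect (P n); last first.
  by rewrite netT0//; apply: outer_le_set0; rewrite mule_ge0// lee_fin.
rewrite !netTE//; set Tn := tball i (j (z n)) (16 * tau).
have mTn : measurable Tn by exact: measurable_tball.
have mud c' : measurable_fun [set: Om] (fun x => (`|u x - c'| `^ p)%:E).
  by apply: measurable_norm_powR; apply: measurable_funB => //; exact: measurable_cst.
pose J := (\int[mu]_(x in Tn) (`|u x - c n| `^ p)%:E)%E.
have J0 : (0 <= J)%E by exact: I0.
pose q := D ^+ 6 / vol (j (z n)) (16 * tau).
have v0 : 0 < vol (j (z n)) (16 * tau) by exact: (vol_gt0 isoi densi dbl).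
have q0 : 0 <= q by rewrite divr_ge0// ltW.
pose G x := ((2 `^ p)%:E * ((`|u x - c n| `^ p)%:E + q%:E * J))%E.
have G0 x : (0 <= G x)%E.
  by rewrite mule_ge0 ?lee_fin ?powR_ge0// adde_ge0 ?lee_fin ?powR_ge0// mule_ge0.
have mG : measurable_fun Tn G.
  apply: measurable_funTS; apply: measurable_funeM; apply: emeasurable_funD => //.
apply: (@outer_le_sub _ _ _ mu _ Tn _ G _ _ _ _ (lexx _)).
- by move=> x; rewrite /Tn !tballE; lra.
- move=> x; rewrite tballE => xz; rewrite /G.
  have n0 : 0 < nuv mu x t by exact: (nuv_gt0 ball_mu_fin).
  apply: (@oscf_le _ _ _ mu ball_mu_fin _ _ _ _ (fun y => (2 `^ p)%:E * ((`|u y - c n| `^ p)%:E + (`|u x - c n| `^ p)%:E))%E) => //.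
    by move=> y _; rewrite -EFinD -EFinM lee_fin powR_distD.
  have mb := measurable_bball x t.
  rewrite ge0_integralZl_EFin ?powR_ge0//; last 2 first.
  + by move=> y _; rewrite adde_ge0// lee_fin powR_ge0.
  + by apply: measurable_funTS; apply: emeasurable_funD.
  rewrite -muleA; apply: lee_wpmul2l; first by rewrite lee_fin powR_ge0.
  rewrite ge0_integralD//; last exact: measurable_funTS.
  rewrite integral_cst// addeC muleDl; last 2 first.
  + by rewrite (nuE ball_mu_fin).
  + by rewrite ge0_adde_def// inE ?lee_fin ?powR_ge0// mule_ge0.
  apply: leeD2l; rewrite (nuE ball_mu_fin x t0) muleAC -EFinM.
  apply: (@le_trans _ _ (1%:E * J)%E).
    rewrite mul1e; apply: ge0_subset_integral => //.
    - exact: measurable_funTS.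
    - by move=> y; rewrite ballEmdist/= /Tn tballE -isoi => xy; apply: le_lt_trans (metric_triangle _ (i x) _) _; lra.
  apply: lee_wpmul2r => //; rewrite lee_fin /q mulrAC ler_pdivlMr// mul1r.
  rewrite /nuv (ball_tball isoi) -/(vol _ _).
  apply: (vol_cmp isoi densi dbl) => //.
  rewrite metric_sym !exprS expr0; lra.
apply: outer_le_integral => //.
rewrite /G ge0_integralZl_EFin ?powR_ge0//; last 2 first.
- by move=> x _; rewrite adde_ge0 ?lee_fin ?powR_ge0// mule_ge0.
- by apply: measurable_funTS; apply: emeasurable_funD.
rewrite ge0_integralD//; [|exact: measurable_funTS|by move=> x _; rewrite mule_ge0].
rewrite integral_cst// (mu_tball isoi densi dbl)// muleAC -EFinM.
rewrite /q mulfVK ?gt_eqF// -/J /KN (EFinM (2 `^ p)) -[leRHS]muleA.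
apply: lee_wpmul2l; first by rewrite lee_fin powR_ge0.
by rewrite EFinD ge0_muleDl ?lee_fin ?D0// mul1e.
Qed.

(** The net bound with all the constants equal to 0. If x has distance at
    least 8 t to the boundary, then u vanishes on B(x, t). *)
Lemma large_osc (t p : R) (u : Om -> R) : 0 < t -> 0 < p ->
  (forall x y, mdist (j x) (j y) = mdist x y) ->
  measurable_fun [set: Om] u -> (forall x, t <= delta x -> u x = 0) ->
  (besov_osc mu p t u <=
    (KN p * D ^+ 7)%:E * \int[mu]_x (`|u x| `^ p)%:E)%E.
Proof.
move=> t0 p0 isoj mu_ u0.
have KN0 : 0 <= KN p by rewrite /KN mulr_ge0 ?powR_ge0// addr_ge0.
have [z [P netz]] := net_exists isoi densi dbl j t0.
have t2 : t / 2 <= t by lra.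
have near := near_osc (fun=> 0) t0 t2 (lexx t) (ltW p0) netz mu_.
rewrite besov_oscE; apply: outer_leP; first by move=> x; exact: oscf_ge0.
apply: (@outer_le_supp _ _ _ mu [set x | delta x < 8 * t]).
  move=> x /= /negP; rewrite -leNgt => x8.
  apply: (oscf_le_cst ball_mu_fin) => // y xy.
  have := delta_lip isoi j x y => dxy.
  by rewrite !u0 ?subrr ?normr0 ?powR0 ?gt_eqF//; lra.
apply: outer_le_sub near => //.
rewrite (EFinM (KN p)) -[leRHS]muleA; apply: lee_wpmul2l; first by rewrite lee_fin.
under eq_eseriesr do under eq_integral do rewrite subr0.
apply: sum_integral_overlap => //.
- by move=> n; exact: measurable_netT.
- move=> x N; have := overlapT isoi densi dbl t0 netz 4 x N.
  by have -> : 2 ^+ 4 * t = 16 * t by rewrite -natrX.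
- exact: measurable_norm_powR.
Qed.

Lemma cutoff_osc (t p L : R) (v phi : Om -> R) (W : set Om) a b : 0 < t -> 0 < p -> 0 <= L ->
  measurable_fun [set: Om] v ->
  (forall y, 0 <= phi y <= 1) -> (forall x y, `|phi x - phi y| <= L * mdist x y) ->
  (forall x y, ~ W x -> mdist x y < t -> phi y = 0) ->
  outer_le mu W (oscf mu p t v) a ->
  outer_le mu W (fun x => (`|v x| `^ p)%:E) b ->
  (besov_osc mu p t (phi \* v)%R <= (2 `^ p)%:E * (a + ((L * t) `^ p)%:E * b))%E.
Proof.
move=> t0 p0 L0 mv phi01 phiL phiW va vb.
rewrite besov_oscE; apply: outer_leP; first by move=> x; exact: oscf_ge0.
apply: (@outer_le_supp _ _ _ mu W).
  move=> x nW; apply: (oscf_le_cst ball_mu_fin) => // y xy /=.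
  rewrite (phiW x y)// (phiW x x)// ?mdistxx//.
  by rewrite !mul0r subrr normr0 powR0 ?gt_eqF.
apply: (@outer_leZ _ _ _ mu _ _ (fun x => oscf mu p t v x + ((L * t) `^ p * `|v x| `^ p)%:E)%E).
- exact: powR_ge0.
- by move=> x _; apply: (oscf_cutoff ball_mu_fin) => //; exact: ltW.
- apply: (@outer_leD _ _ _ mu _ _ (oscf mu p t v) (fun x => ((L * t) `^ p * `|v x| `^ p)%:E)) => //.
  by apply: (outer_leZ _ _ vb); [exact: powR_ge0|move=> x _; rewrite EFinM].
Qed.

End near_boundary.

(** * Oscillation of averages *)

Section Av_oscillation.
Context (R : realType) (dO : measure_display) (Om : borelMetricType R dO)
  (mu : {measure set Om -> \bar R}) (Y : metricType R) (i : Om -> Y)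
  (Cmu : R).
Hypothesis isoi : forall x y, mdist (i x) (i y) = mdist x y.
Hypothesis densi : forall y (e : R), 0 < e -> exists x, mdist y (i x) < e.
Hypothesis dbl : doubling_with mu Cmu.
Context (dB : measure_display) (B : borelMetricType R dB) (j : B -> Y).
Hypothesis isoj : forall x y, mdist (j x) (j y) = mdist x y.
Hypothesis sep : forall x, exists2 e : R, 0 < e & forall z, e <= mdist (i x) (j z).
Context (nu : {measure set B -> \bar R}).
Hypothesis fin : forall z (r : R), 0 < r ->
  (0 < nu (ball z r))%E /\ (nu (ball z r) < +oo)%E.
Context (theta Ct Rmax : R).
Hypothesis htheta : 0 < theta.
Hypothesis hCt : 1 <= Ct.
Hypothesis reg : forall z (r : R), 0 < r -> r <= Rmax ->
  (Ct^-1%:E * (mu (tball i (j z) r) / (r `^ theta)%:E) <= nu (ball z r))%E /\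
  (nu (ball z r) <= Ct%:E * (mu (tball i (j z) r) / (r `^ theta)%:E))%E.

Local Notation delta := (delta i j).
Local Notation vol := (vol mu i).
Local Notation nuv := (nuv nu).
Local Notation D := (Dbl Cmu).
Local Notation Av := (Av i j nu).
Local Notation locint := (locint nu).
Local Notation CA := (CA Cmu Ct).

Let D1 : 1 <= D. Proof. exact: Dbl_ge1 dbl. Qed.
Let D0 n : 0 <= D ^+ n. Proof. by rewrite exprn_ge0// (le_trans ler01). Qed.
Let Ct0 : 0 < Ct. Proof. exact: lt_le_trans ltr01 hCt. Qed.
Local Notation avg := (avg nu).

Let CA1 : 1 <= CA. Proof. exact: (CA_ge1 dbl hCt). Qed.
Local Notation KA := (KA Cmu theta Ct).
Local Notation CS := (CS Cmu Ct).
Local Notation CL := (CL Cmu Ct).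
Local Notation KN := (KN Cmu).

Let CS0 m : 0 <= CS m.
Proof. by rewrite /CS mulr_ge0// exprn_ge0// ltW. Qed.
Let CL0 : 0 <= CL.
Proof. by rewrite /CL mulr_ge0// exprn_ge0//; have := CA1; lra. Qed.
Let KN0 p : 0 <= KN p.
Proof. by rewrite /KN mulr_ge0 ?powR_ge0// addr_ge0. Qed.
Let KA0 p : 0 <= KA p. Proof. exact: KA_ge0 htheta (Cmu_ge1 dbl) hCt. Qed.

Lemma locint_sub f c : locint f -> locint (fun z => f z - c).
Proof.
move=> lf; have := locintD 1 lf (locint_cst fin (- c)).
by rewrite (_ : (fun z => _) = (fun z => f z - c))//; apply/funext => z; rewrite mul1r.
Qed.

Definition Kfar p := CL `^ p * (Ct * 16 `^ theta) * CS 7.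

(** In the layer delta ~ rho and at scales t much smaller than rho, Av f is
    Lipschitz with slope 1 / rho times the deviation of f from a constant; the
    gain is (t / rho)^p. *)
Lemma far_osc (rho t p : R) (f : B -> R) : 0 < rho -> 0 < t -> 8 * t <= rho ->
  2 ^+ 8 * rho <= Rmax -> 1 <= p -> locint f ->
  outer_le mu [set x | rho / 2 <= delta x /\ delta x < rho] (oscf mu p t (Av f))
   ((Kfar p * ((t / rho) `^ p * rho `^ theta))%:E * besov_osc nu p (2 ^+ 8 * rho) f)%E.
Proof.
move=> rho0 t0 t8 rhoR p1 lf.
have p0 : 0 <= p by lra.
have rhoR16 : 16 * rho <= Rmax.
  apply: le_trans rhoR; rewrite ler_wpM2r ?(ltW rho0)//.
  by rewrite (_ : 2 ^+ 8 = 256%:R) ?ler_nat// -natrX.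
have [z [P netz]] := net_exists isoi densi dbl j rho0.
(* the constants c n drop out of the differences of Av, and net_dev_le bounds
   the deviations by the oscillation of f at scale 2 ^+ 8 * rho *)
pose c n := avg f (z n) (2 ^+ 7 * rho).
have b0 : 0 <= (CL * (t / rho)) `^ p by exact: powR_ge0.
have h := layer_bound isoi densi dbl isoj fin hCt reg rho0 rhoR16 netz b0
  (E := [set x | rho / 2 <= delta x /\ delta x < rho]) (F := oscf mu p t (Av f))
  (h := fun n w => (`|f w - c n| `^ p)%:E).
apply: (outer_le_sub _ _ _ (h _ _ _)) => //.
- have S := net_dev_le isoi densi dbl isoj fin htheta hCt reg rho0 p1 rhoR netz lf.
  apply: (@le_trans _ _ (((CL * (t / rho)) `^ p * (Ct * (16 * rho) `^ theta))%:E *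
     ((CS 7)%:E * besov_osc nu p (2 ^+ 8 * rho) f))%E).
    apply: lee_wpmul2l.
      by rewrite lee_fin; apply: mulr_ge0 => //; apply: mulr_ge0; rewrite ?powR_ge0 ?(ltW Ct0).
    apply: le_trans S; apply: lee_nneseries => [n _ _|n _].
      by apply: integral_ge0 => w _; rewrite lee_fin powR_ge0.
    apply: ge0_subset_integral.
    - exact: measurable_netB.
    - exact: measurable_netB.
    - apply: measurable_funTS; apply: measurable_norm_powR.
      by apply: measurable_funB; [exact: lf.1|exact: measurable_cst].
    - by move=> w _; rewrite lee_fin powR_ge0.
    - move=> w [Pn nw]; split => //; apply: (lt_le_trans nw).
      rewrite ler_wpM2r ?(ltW rho0)//.
      by rewrite (_ : 2 ^+ 7 = 128%:R) ?ler_nat// -natrX.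
  rewrite muleA -EFinM; apply: lee_wpmul2r.
    by rewrite besov_oscE integral_ge0// => x _; exact: oscf_ge0.
  have trho : 0 <= t / rho by rewrite divr_ge0 ?(ltW rho0) ?(ltW t0).
  rewrite lee_fin /Kfar (powRM p CL0 trho) (powRM theta _ (ltW rho0))//.
  by rewrite le_eqVlt; apply/orP; left; apply/eqP; ring.
- by move=> x [].
- move=> x n [x1 x2] Pn xn.
  have M0 : (0 <= ((CL * (t / rho)) `^ p / nuv (z n) (16 * rho))%:E *
      \int[nu]_(w in ball (z n) (16 * rho)%R) (`|f w - c n| `^ p)%:E)%E.
    apply: mule_ge0; last by apply: integral_ge0 => w _; rewrite lee_fin powR_ge0.
    by rewrite lee_fin; apply: mulr_ge0 => //; rewrite invr_ge0 ltW// (nuv_gt0 fin)//; lra.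
  apply: (oscf_le_cst (ball_mu_fin isoi densi dbl)) => // y xy.
  have := delta_lip isoi j x y; have := delta_lip isoi j y x.
  rewrite (metric_sym y x) => dyx dxy.
  have tri := metric_triangle (i y) (i x) (j (z n)); rewrite isoi (metric_sym y x) in tri.
  have -> : Av f y - Av f x = Av (fun w => f w - c n) y - Av (fun w => f w - c n) x.
    by rewrite !(Av_subcst isoj sep fin)//; ring.
  have Q := Av_diff_pow isoi densi dbl isoj sep fin htheta hCt reg rho0 rhoR16 p1 (locint_sub (c n) lf) (x := y) (y := x) (w := z n).
  clear h M0; apply: (le_trans (Q _ _ _ _ _ _)); clear Q; [lra|lra|lra|lra|lra|lra|].
  apply: lee_wpmul2r; first by apply: integral_ge0 => w _; rewrite lee_fin powR_ge0.
  rewrite lee_fin ler_wpM2r ?invr_ge0 ?(ltW (nuv_gt0 fin _ _))//; first lra.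
  apply: powR_le => //; first by rewrite mulr_ge0// divr_ge0 ?mdist_ge0// ltW.
  by rewrite ler_wpM2l// ler_wpM2r ?invr_ge0 ?(ltW rho0)// metric_sym ltW.
Qed.

Definition Knear p := KN p * (KA p * 16 `^ theta) * CS 7.

(** At distance less than 8 tau to the boundary, Av f is compared with the mean
    of f over the net ball, which costs the L^p norm of Av (f - c n) on the
    trace ball. *)
Lemma near_osc_Av (tau t p : R) (f : B -> R) : 0 < tau -> tau / 2 <= t -> t <= tau ->
  2 ^+ 8 * tau <= Rmax -> 1 <= p -> locint f ->
  outer_le mu [set x | delta x < 8 * tau] (oscf mu p t (Av f))
   ((Knear p * tau `^ theta)%:E * besov_osc nu p (2 ^+ 8 * tau) f)%E.
Proof.
move=> tau0 t1 t2 tauR p1 lf.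
have p0 : 0 <= p by lra.
have [z [P netz]] := net_exists isoi densi dbl j tau0.
pose c n := avg f (z n) (2 ^+ 7 * tau).
have tau16 : 0 < 16 * tau by lra.
have e7 : 8 * (16 * tau) = 2 ^+ 7 * tau by rewrite mulrA -natrM -natrX.
have e8 : 16 * (16 * tau) = 2 ^+ 8 * tau by rewrite mulrA -natrM -natrX.
have mA := measurable_Av isoi isoj sep fin lf.
apply: (outer_le_sub _ _ _ (near_osc isoi densi dbl c tau0 t1 t2 p0 netz mA)) => //.
rewrite /Knear -2!mulrA (EFinM (KN p)) -[leRHS]muleA; apply: lee_wpmul2l.
  by rewrite lee_fin.
have S := net_dev_le isoi densi dbl isoj fin htheta hCt reg tau0 p1 tauR netz lf.
pose a := KA p * (16 * tau) `^ theta.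
have a0 : 0 <= a by rewrite /a; apply: mulr_ge0; rewrite ?powR_ge0.
apply: (@le_trans _ _ (a%:E * ((CS 7)%:E * besov_osc nu p (2 ^+ 8 * tau) f))%E); last first.
  rewrite muleA -EFinM; apply: lee_wpmul2r.
    by rewrite besov_oscE integral_ge0// => x _; exact: oscf_ge0.
  rewrite lee_fin /a (powRM theta _ (ltW tau0))//.
  by rewrite le_eqVlt; apply/orP; left; apply/eqP; ring.
apply: (@le_trans _ _ (a%:E * \sum_(n <oo) \int[nu]_(w in netB j z P n (2 ^+ 7 * tau)%R)
     (`|f w - c n| `^ p)%:E)%E); last by apply: lee_wpmul2l.
rewrite -nneseriesZl; last first.
  by move=> n _; apply: integral_ge0 => w _; rewrite lee_fin powR_ge0.
apply: lee_nneseries => [n _ _|n _].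
  by apply: integral_ge0 => w _; rewrite lee_fin powR_ge0.
have [Pn|nP] := pselect (P n); last first.
  by rewrite netT0// netB0// !integral_set0 mule0.
rewrite netTE// netBE// -e7.
apply: (le_trans _ (Av_Lp_local isoi densi dbl isoj sep fin htheta hCt reg (z n) tau16 _ p1 (locint_sub (c n) lf))).
  apply: ge0_le_integral_outer => x _; first by rewrite lee_fin powR_ge0.
  by rewrite (Av_subcst isoj sep fin).
by rewrite e8.
Qed.

(** The points with delta < 8 tau_k, where tau_m = R1 / 2 ^+ m, are treated by
    near_osc_Av, and the others lie in the layers delta ~ tau_m with m < k. *)
Lemma Av_osc (R1 t p : R) (f : B -> R) (k : nat) (a : nat -> R) :
  0 < R1 -> 2 ^+ 8 * R1 <= Rmax -> 1 <= p -> locint f ->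
  R1 / 2 ^+ k / 2 <= t -> t <= R1 / 2 ^+ k -> (forall m, 0 <= a m) ->
  (forall m, (m <= k)%N -> (besov_osc nu p (2 ^+ 8 * (R1 / 2 ^+ m)) f <= (a m)%:E)%E) ->
  outer_le mu [set x | delta x < R1 \/ delta x < 8 * (R1 / 2 ^+ k)] (oscf mu p t (Av f))
    ((Kfar p + Knear p) * \sum_(m < k.+1)
       ((R1 / 2 ^+ k) / (R1 / 2 ^+ m)) `^ p * (R1 / 2 ^+ m) `^ theta * a m)%:E.
Proof.
move=> R10 R1R p1 lf t1 t2 a0 ha.
pose tau m := R1 / 2 ^+ m.
have tau0 m : 0 < tau m by rewrite divr_gt0// exprn_gt0.
have tauR m : 2 ^+ 8 * tau m <= Rmax.
  apply: le_trans R1R; rewrite ler_wpM2l ?exprn_ge0// /tau ler_pdivrMr ?exprn_gt0//.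
  by rewrite ler_peMr ?(ltW R10)// exprn_ege1// ler1n.
have t0 : 0 < t by apply: lt_le_trans t1; rewrite divr_gt0// tau0.
have Kfar0 : 0 <= Kfar p.
  by rewrite /Kfar; apply: mulr_ge0 => //; apply: mulr_ge0; rewrite ?powR_ge0//; apply: mulr_ge0; rewrite ?powR_ge0 ?(ltW Ct0).
have Knear0 : 0 <= Knear p.
  by rewrite /Knear; apply: mulr_ge0 => //; apply: mulr_ge0 => //; apply: mulr_ge0; rewrite ?powR_ge0.
pose b m := (tau k / tau m) `^ p * tau m `^ theta * a m.
have b0 m : 0 <= b m by rewrite !mulr_ge0 ?powR_ge0.
pose E m := [set x : Om | (tau m / 2 <= delta x /\ delta x < tau m) /\ 8 * tau k <= delta x].
have near := near_osc_Av (tau0 k) t1 t2 (tauR k) p1 lf.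
have far m : (m < k)%N -> outer_le mu (E m) (oscf mu p t (Av f)) (Kfar p * b m)%:E.
  move=> mk; have Kb : (0 <= (Kfar p * b m)%:E)%E by rewrite lee_fin mulr_ge0.
  have [h|h] := ltP (8 * tau k) (tau m); last first.
    rewrite (_ : E m = set0); first exact: outer_le_set0.
    by apply/seteqP; split => // x [[_ ?] ?]; move: h; lra.
  have t8 : 8 * t <= tau m by move: t2; rewrite -/(tau k); move: h; lra.
  apply: outer_le_sub (far_osc (tau0 m) t0 t8 (tauR m) p1 lf) => //.
    by move=> x [].
  apply: (@le_trans _ _ ((Kfar p * ((t / tau m) `^ p * tau m `^ theta))%:E * (a m)%:E)%E).
    apply: lee_wpmul2l; last by apply: ha; exact: ltnW.
    by rewrite lee_fin; apply: mulr_ge0 => //; apply: mulr_ge0; exact: powR_ge0.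
  rewrite -EFinM lee_fin -[leLHS]mulrA; apply: ler_wpM2l => //.
  rewrite /b ler_wpM2r// ler_wpM2r ?powR_ge0//; apply: powR_le; first by lra.
    by rewrite divr_ge0 ?(ltW t0) ?(ltW (tau0 m)).
  by rewrite ler_wpM2r ?invr_ge0 ?(ltW (tau0 m)).
have all := outer_leU (outer_le_bigcup_ord far) near.
apply: outer_le_sub all => //.
- move=> x /= hx; have [h|h] := ltP (delta x) (8 * tau k); [by right|left].
  have xR1 : delta x < R1 by case: hx => //; rewrite -/(tau k); lra.
  have [m [m1 m2]] := dyadic_layer (delta_gt0 sep x) xR1; exists m => //.
  rewrite ltnNge; apply/negP => km.
  have : tau m <= tau k.
    rewrite /tau ler_wpM2l ?(ltW R10)// lef_pV2 ?posrE ?exprn_gt0//.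
    by rewrite ler_eXn2l// ltr1n.
  by move: m2; rewrite -/(tau m); have := tau0 k; lra.
- apply: (@le_trans _ _ ((\sum_(m < k) (Kfar p * b m)) + Knear p * b k)%:E).
    rewrite EFinD -sumEFin; apply: leeD2l.
    apply: (@le_trans _ _ ((Knear p * tau k `^ theta)%:E * (a k)%:E)%E).
      apply: lee_wpmul2l; last exact: ha.
      by rewrite lee_fin mulr_ge0// powR_ge0.
    by rewrite -EFinM lee_fin /b divff ?gt_eqF// powR1 mul1r mulrA.
  rewrite lee_fin big_ord_recr/= -mulr_sumr -/(tau k) -/(b k) mulrDr mulrDl mulrDl.
  have S0 : 0 <= \sum_(m < k) b m by apply: sumr_ge0.
  have := mulr_ge0 Knear0 S0; have := mulr_ge0 Kfar0 (b0 k).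
  by rewrite -/(b _) /b -/(tau _) /=; lra.
Qed.

End Av_oscillation.

(** * Weighted sequence norms *)

Section sequences.
Context (R : realType).
Implicit Types (p lam : R) (q : \bar R).

(** For X >= 0: the l^q norm of the sequence x k ^ (1 / p) is at most X. *)
Definition lqb p q (x : nat -> R) (X : R) : Prop :=
  match q with
  | r%:E => forall n, \sum_(k < n) x k `^ (r / p) <= X `^ r
  | _ => forall k, x k `^ p^-1 <= X
  end.

(** For r < 1 the power is subadditive with the good constant lam^r, but for
    r > 1 a factor close to lam^r on b can only be kept at the price of a large
    factor on a. Whether a is small compared with b decides between the terms,
    for all r at once. *)
Lemma powR_contract lam r : 0 < lam -> lam < 1 -> 0 < r ->
  exists G m, [/\ 0 <= G, 0 <= m, m < 1 & forall a b, 0 <= a -> 0 <= b ->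
    (a + lam * b) `^ r <= G * a `^ r + m * b `^ r].
Proof.
move=> l0 l1 r0; pose ka := lam `^ 2^-1.
have ka0 : 0 < ka by exact: powR_gt0.
have ka2 : ka * ka = lam.
  by rewrite /ka -powRD ?(gt_eqF l0) ?implybT// -[RHS]powRr1 ?(ltW l0)//; congr (_ `^ _); field.
have ka1 : ka < 1 by rewrite ltNge; apply/negP => h; move: l1; rewrite -ka2; nra.
have lk : lam < ka by rewrite -ka2; nra.
exists ((ka / (ka - lam)) `^ r), (ka `^ r); split; rewrite ?powR_ge0//.
  have := gt0_ltr_powR r0; move=> /(_ ka 1); rewrite powR1; apply => //; rewrite nnegrE//; exact: ltW.
move=> a b a0 b0; have [h|h] := leP a ((ka - lam) * b).
  apply: (@le_trans _ _ (ka `^ r * b `^ r)); last by rewrite lerDr mulr_ge0 ?powR_ge0.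
  rewrite -powRM ?(ltW ka0)//; apply: powR_le; first exact: ltW.
    by rewrite addr_ge0// mulr_ge0// ltW.
  by lra.
apply: (@le_trans _ _ ((ka / (ka - lam)) `^ r * a `^ r)); last by rewrite lerDl mulr_ge0 ?powR_ge0.
have kl : 0 < ka - lam by lra.
rewrite -powRM ?divr_ge0 ?(ltW ka0) ?(ltW kl)//; apply: powR_le; first exact: ltW.
  by rewrite addr_ge0// mulr_ge0// ltW.
rewrite mulrAC ler_pdivlMr//; nra.
Qed.

Lemma powR_sum_le (r X Y : R) : 0 <= r -> 0 <= X -> 0 <= Y ->
  X `^ r + Y `^ r <= 2 * (X + Y) `^ r.
Proof.
move=> r0 X0 Y0; rewrite mulrC mulr_natr mulr2n; apply: lerD; apply: powR_le => //.
  by rewrite lerDl.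
by rewrite lerDr.
Qed.

(** A discrete Hardy inequality. *)
Lemma lqb_rec p q lam : 1 <= p -> (1 <= q)%E -> 0 < lam -> lam < 1 ->
  exists2 C : R, 0 <= C & forall (a b : nat -> R) (M X : R),
    (forall k, 0 <= a k) -> (forall k, 0 <= b k) -> 0 <= M -> 0 <= X ->
    b 0%N <= a 0%N + M -> (forall k, b k.+1 <= a k.+1 + lam * b k) ->
    lqb p q a X -> lqb p q b (C * (X + M `^ p^-1)).
Proof.
move=> p1 + l0 l1; have p0 : 0 < p by lra.
case: q => [r|_|//].
- rewrite lee_fin => r1; have r0 : 0 < r by lra.
  have rp0 : 0 < r / p by rewrite divr_gt0.
  have [G [m [G0 m0 m1 con]]] := powR_contract l0 l1 rp0.
  pose E := 2 * ((2 `^ (r / p) + G) / (1 - m)).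
  have m10 : 0 < 1 - m by lra.
  have E0 : 0 <= E by rewrite mulr_ge0// divr_ge0 ?(ltW m10)// addr_ge0 ?powR_ge0.
  exists (E `^ r^-1); first exact: powR_ge0.
  move=> a b M X a0 b0 M0 X0 hb0 hb ha n; set Y := M `^ p^-1.
  have Y0 : 0 <= Y by exact: powR_ge0.
  have Yr : Y `^ r = M `^ (r / p) by rewrite /Y -powRrM mulrC.
  rewrite powRM ?powR_ge0 ?addr_ge0// -powRrM mulVf ?gt_eqF// powRr1//.
  apply: (@le_trans _ _ (\sum_(k < n.+1) b k `^ (r / p))).
    by rewrite big_ord_recr/= lerDl powR_ge0.
  set S := \sum_(k < n.+1) _.
  have h0 : b 0%N `^ (r / p) <= 2 `^ (r / p) * (X `^ r + Y `^ r).
    apply: (@le_trans _ _ ((a 0%N + M) `^ (r / p))); first by apply: powR_le => //; exact: ltW.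
    apply: le_trans (powR_addle (ltW rp0) (a0 0%N) M0) _.
    rewrite ler_wpM2l ?powR_ge0// Yr lerD2r.
    by have := ha 1%N; rewrite big_ord_recr big_ord0/= add0r.
  (* the sum S on both sides: it is absorbed on the left because m < 1 *)
  have hS : S <= b 0%N `^ (r / p) + (G * X `^ r + m * S).
    rewrite {1}/S big_ord_recl/= lerD2l.
    apply: (@le_trans _ _ (\sum_(k < n) (G * a k.+1 `^ (r / p) + m * b k `^ (r / p)))).
      apply: ler_sum => k _; rewrite /bump/= add1n.
      apply: le_trans (con _ _ (a0 _) (b0 _)); apply: powR_le => //; exact: ltW.
    rewrite big_split/= -!mulr_sumr; apply: lerD; rewrite ler_wpM2l//.
      apply: le_trans (ha n.+1); rewrite big_ord_recl/=.
      rewrite -[leLHS]add0r; apply: lerD; first exact: powR_ge0.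
      by rewrite le_eqVlt; apply/orP; left; apply/eqP; apply: eq_bigr => k _.
    by rewrite /S big_ord_recr/= lerDl powR_ge0.
  have XY := powR_sum_le (ltW r0) X0 Y0.
  have Xr : 0 <= X `^ r by exact: powR_ge0.
  have Yr0 : 0 <= Y `^ r by exact: powR_ge0.
  apply: (@le_trans _ _ ((2 `^ (r / p) + G) / (1 - m) * (X `^ r + Y `^ r))).
    rewrite mulrAC ler_pdivlMr//.
    have : 0 <= G * Y `^ r by rewrite mulr_ge0.
    lra.
  have W0 : 0 <= (2 `^ (r / p) + G) / (1 - m).
    by rewrite divr_ge0 ?(ltW m10)// addr_ge0 ?powR_ge0.
  by have := ler_wpM2l W0 XY; rewrite /E; lra.
- have l10 : 0 < 1 - lam by lra.
  exists ((2 / (1 - lam)) `^ p^-1); first exact: powR_ge0.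
  move=> a b M X a0 b0 M0 X0 hb0 hb ha k; set Y := M `^ p^-1.
  have Y0 : 0 <= Y by exact: powR_ge0.
  have Yp : Y `^ p = M by rewrite /Y -powRrM mulVf ?powRr1// gt_eqF.
  have aX m : a m <= X `^ p.
    have := powR_le (ltW p0) (powR_ge0 _ _) (ha m).
    by rewrite -powRrM mulVf ?gt_eqF// powRr1.
  have bX : b k * (1 - lam) <= X `^ p + M.
    elim: k => [|k ih].
      apply: (@le_trans _ _ (b 0%N)); last by have := aX 0%N; lra.
      by have := b0 0%N; nra.
    have := hb k; have := aX k.+1; have : 0 <= lam * M by rewrite mulr_ge0// ltW.
    nra.
  have XY := powR_sum_le (ltW p0) X0 Y0; rewrite Yp in XY.
  have bE : b k <= 2 / (1 - lam) * (X + Y) `^ p.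
    by rewrite mulrAC ler_pdivlMr//; lra.
  have := powR_le (_ : 0 <= p^-1) (b0 k) bE; rewrite invr_ge0 => /(_ (ltW p0)) /le_trans; apply.
  rewrite powRM ?powR_ge0 ?divr_ge0 ?(ltW l10)// -powRrM mulfV ?gt_eqF// powRr1//.
  by rewrite addr_ge0.
Qed.

End sequences.

(** * Discretisation of the Besov seminorm *)

Lemma dyadic_large (R : realType) (r t : R) : 0 < r -> r <= t ->
  exists k, 2 ^+ k * r <= t /\ t <= 2 ^+ k.+1 * r.
Proof.
move=> r0 rt; have ex : exists n, t < 2 ^+ n * r.
  exists (Num.truncn (t / r)).+1; rewrite -ltr_pdivrMr//.
  apply: (lt_trans (truncnS_gt _)).
  by rewrite -natrX ltr_nat ltn_expl.
case: (ex_minnP ex) => [[|k]]; first by rewrite expr0 mul1r ltNge rt.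
move=> hk mink; exists k; split; last exact: ltW.
by rewrite leNgt; apply/negP => /mink; rewrite ltnn.
Qed.

Lemma outer_le_itv (R : realType) (a b c : R) (F : R -> \bar R) :
  a <= b -> 0 <= c -> (forall t, a <= t -> t <= b -> (F t <= c%:E)%E) ->
  outer_le (@lebesgue_measure R) [set t | a <= t /\ t <= b] F (c * (b - a))%:E.
Proof.
move=> ab c0 Fc.
have E : [set t | a <= t /\ t <= b] = [set` `[a, b]] :> set R.
  by apply/seteqP; split => t /=; rewrite in_itv/=; [by move=> [-> ->]|by move=> /andP].
rewrite E.
apply: (@outer_le_sub _ _ _ (@lebesgue_measure R) _ [set` `[a, b]] _ (cst c%:E) _ _ _ _ (lexx _)) => //.
  by move=> t /=; rewrite in_itv/= => /andP[t1 t2]; exact: Fc.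
apply: outer_le_integral => //.
rewrite integral_cst//.
have E2 : (@lebesgue_measure R [set` `[a, b]] = (b - a)%:E)%E.
  apply: (eq_trans (lebesgue_measure_itv _)); rewrite /= lte_fin.
  case: ltP => h; first by rewrite EFinB.
  by have -> : b = a; [apply/eqP; rewrite eq_le h|rewrite subrr].
rewrite [X in (_ * X <= _)%E]E2.
by rewrite EFinM.
Qed.

Section HBnorm_upper_bound.
Context (R : realType).

(** Below R1 the seminorm is a sum over the dyadic scales; above R1 the bound
    N on the oscillation is integrated against a negative power of t. The
    constant C does not depend on the space. *)
Lemma HBnorm_upper (p s R1 : R) (q : \bar R) : 1 <= p -> (1 <= q)%E -> 0 < s ->
  0 < R1 -> exists2 C : R, 0 <= C & forall d (T : borelMetricType R d)
    (mu : {measure set T -> \bar R}) (u : T -> R) (b : nat -> R) (N X : R),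
    (forall k, 0 <= b k) -> 0 <= N -> 0 <= X ->
    (forall k t, R1 / 2 ^+ k / 2 <= t -> t <= R1 / 2 ^+ k ->
      (besov_osc mu p t u <= ((R1 / 2 ^+ k) `^ (s * p) * b k)%:E)%E) ->
    (forall t, R1 <= t -> (besov_osc mu p t u <= N%:E)%E) ->
    lqb p q b X ->
    (HBnorm mu s p q u <= (C * (X + N `^ p^-1))%:E)%E.
Proof.
move=> p1 + s0 R10; have p0 : 0 < p by lra.
case: q => [r|_|//].
- rewrite lee_fin => r1; have r0 : 0 < r by lra.
  have rp0 : 0 <= r / p by rewrite divr_ge0 ?ltW.
  have sr0 : 0 < s * r by rewrite mulr_gt0.
  pose x := 2 `^ (- (s * r)).
  have x0 : 0 < x by exact: powR_gt0.
  have x1 : x < 1 by exact: powR2N_lt1.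
  pose W := 2 `^ (s * r) + (1 - x)^-1 * R1 `^ (- (s * r)).
  have W0 : 0 <= W.
    by rewrite addr_ge0 ?powR_ge0// mulr_ge0 ?powR_ge0// invr_ge0; lra.
  exists ((2 * W) `^ r^-1); first exact: powR_ge0.
  move=> d T mu u b N X b0 N0 X0 small large hb; set Y := N `^ p^-1.
  have Y0 : 0 <= Y by exact: powR_ge0.
  have Yr : N `^ (r / p) = Y `^ r by rewrite /Y -powRrM mulrC.
  pose F t : \bar R := (besov_osc mu p t u `^ (r / p) / (t `^ (s * r + 1))%:E)%E.
  have osc0 t : (0 <= besov_osc mu p t u)%E.
    by rewrite besov_oscE integral_ge0// => z _; exact: oscf_ge0.
  have F0 t : (0 <= F t)%E by rewrite mule_ge0 ?poweR_ge0// inve_ge0 lee_fin powR_ge0.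
  have Fle (a t c : R) : 0 < a -> a <= t -> (besov_osc mu p t u <= c%:E)%E ->
      (F t <= (c `^ (r / p) / a `^ (s * r + 1))%:E)%E.
    move=> a0 at_ hc; have t0 : 0 < t by exact: lt_le_trans at_.
    rewrite /F inver gt_eqF ?powR_gt0// EFinM; apply: lee_pmul.
    - exact: poweR_ge0.
    - by rewrite lee_fin invr_ge0 powR_ge0.
    - by rewrite -poweR_EFin; apply: lee_poweR.
    - rewrite lee_fin lef_pV2 ?posrE ?powR_gt0//; apply: powR_le => //; last exact: ltW.
      by rewrite addr_ge0// ltW.
  pose tau k := R1 / 2 ^+ k.
  have tau0 k : 0 < tau k by rewrite divr_gt0// exprn_gt0.
  pose I k := [set t : R | tau k / 2 <= t /\ t <= tau k].
  pose J k := [set t : R | 2 ^+ k * R1 <= t /\ t <= 2 ^+ k.+1 * R1].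
  have hI k : outer_le (@lebesgue_measure R) (I k) F (2 `^ (s * r) * b k `^ (r / p))%:E.
    have t2 : 0 < tau k / 2 by rewrite divr_gt0.
    have := @outer_le_itv R (tau k / 2) (tau k) ((tau k `^ (s * p) * b k) `^ (r / p) / (tau k / 2) `^ (s * r + 1)) F.
    have -> : (tau k `^ (s * p) * b k) `^ (r / p) / (tau k / 2) `^ (s * r + 1) * (tau k - tau k / 2)
       = 2 `^ (s * r) * b k `^ (r / p).
      rewrite powRM ?powR_ge0// -powRrM (_ : s * p * (r / p) = s * r); last by field; rewrite gt_eqF.
      rewrite (_ : tau k - tau k / 2 = tau k / 2); last by field.
      rewrite powRD; last by rewrite (gt_eqF t2) implybT.
      rewrite powRr1 ?(ltW t2)//.
      have E2 : tau k `^ (s * r) = 2 `^ (s * r) * (tau k / 2) `^ (s * r).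
        by rewrite -powRM ?(ltW t2)//; congr (_ `^ _); field.
      rewrite E2; have : (tau k / 2) `^ (s * r) != 0 by rewrite gt_eqF ?powR_gt0.
      have : tau k / 2 != 0 by rewrite gt_eqF.
      by move: (tau k / 2) ((tau k / 2) `^ _) => y z y0 z0; field; rewrite y0.
    apply.
    - by have := tau0 k; lra.
    - by rewrite divr_ge0 ?powR_ge0.
    - move=> t t1 t3; apply: Fle => //; exact: small.
  have hJ k : outer_le (@lebesgue_measure R) (J k) F
      ((x ^+ k)%:E * (Y `^ r * R1 `^ (- (s * r)))%:E)%E.
    have a0 : 0 < 2 ^+ k * R1 by rewrite mulr_gt0// exprn_gt0.
    have := @outer_le_itv R (2 ^+ k * R1) (2 ^+ k.+1 * R1) (N `^ (r / p) / (2 ^+ k * R1) `^ (s * r + 1)) F.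
    rewrite -EFinM /J exprS -mulrA; set a := 2 ^+ k * R1 in a0 *.
    have -> : N `^ (r / p) / a `^ (s * r + 1) * (2 * a - a) = x ^+ k * (Y `^ r * R1 `^ (- (s * r))).
      rewrite Yr powRD; last by rewrite (gt_eqF a0) implybT.
      rewrite powRr1 ?(ltW a0)//.
      have -> : x ^+ k * (Y `^ r * R1 `^ (- (s * r))) = Y `^ r * a `^ (- (s * r)).
        rewrite /a powRM ?exprn_ge0 ?(ltW R10)// mulrCA; congr (_ * (_ * _)).
        by rewrite /x powR_exprn.
      rewrite powRN; have : a `^ (s * r) != 0 by rewrite gt_eqF ?powR_gt0.
      by move=> h; field; rewrite h gt_eqF.
    apply.
    - by lra.
    - by rewrite divr_ge0 ?powR_ge0.
    - by move=> t t1 _; apply: Fle => //; apply: large; apply: le_trans t1; rewrite /a ler_peMl ?(ltW R10)// exprn_ege1// ler1n.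
  have all := outer_leU (outer_le_bigcup (@subset_refl _ _) hI) (outer_le_bigcup (@subset_refl _ _) hJ).
  have tot : (\int[@lebesgue_measure R]_(t in [set t : R | (0 < t)%R]) F t <= (2 * W * (X + Y) `^ r)%:E)%E.
    apply: outer_le_int => //; apply: outer_le_sub all => //.
    - move=> t /= t0; have [tR|tR] := ltP t R1.
        by left; have [k [k1 k2]] := dyadic_layer t0 tR; exists k => //; split => //; exact: ltW.
      by right; have [k [k1 k2]] := dyadic_large R10 tR; exists k.
    - apply: (@le_trans _ _ ((2 `^ (s * r) * X `^ r)%:E + ((1 - x)^-1)%:E * (Y `^ r * R1 `^ (- (s * r)))%:E)%E).
        apply: leeD; last by apply: nneseries_geometric_le => //; [exact: ltW|rewrite lee_fin mulr_ge0 ?powR_ge0].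
        apply: lime_le.
          by apply: is_cvg_nneseries => n _ _; rewrite lee_fin mulr_ge0 ?powR_ge0.
        near=> n; rewrite sumEFin lee_fin -mulr_sumr ler_wpM2l ?powR_ge0// big_mkord.
        exact: hb.
      rewrite -EFinM -EFinD lee_fin.
      have XY := powR_sum_le (ltW r0) X0 Y0.
      have Xr : 0 <= X `^ r by exact: powR_ge0.
      have Yr0 : 0 <= Y `^ r by exact: powR_ge0.
      apply: (@le_trans _ _ (W * (X `^ r + Y `^ r))); last by have := ler_wpM2l W0 XY; lra.
      have h1 : 0 <= 2 `^ (s * r) * Y `^ r by rewrite mulr_ge0// powR_ge0.
      have h2 : 0 <= (1 - x)^-1 * R1 `^ (- (s * r)) * X `^ r.
        by rewrite mulr_ge0// mulr_ge0 ?powR_ge0// invr_ge0; lra.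
      by rewrite /W; lra.
  rewrite /HBnorm; apply: (@le_trans _ _ (((2 * W * (X + Y) `^ r)%:E) `^ r^-1)%E).
    apply: lee_poweR; rewrite ?invr_ge0 ?(ltW r0)//.
    by apply: integral_ge0 => t _; exact: F0.
  have XY0 : 0 <= X + Y by exact: addr_ge0.
  rewrite poweR_EFin lee_fin powRM ?powR_ge0 ?mulr_ge0// -powRrM mulfV ?gt_eqF// powRr1//.
- exists (2 `^ s + R1 `^ (- s)); first by rewrite addr_ge0 ?powR_ge0.
  move=> d T mu u b N X b0 N0 X0 small large hb; set Y := N `^ p^-1.
  have Y0 : 0 <= Y by exact: powR_ge0.
  have XY0 : 0 <= X + Y by exact: addr_ge0.
  have osc0 t : (0 <= besov_osc mu p t u)%E.
    by rewrite besov_oscE integral_ge0// => z _; exact: oscf_ge0.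
  rewrite /HBnorm; apply: ge_ereal_sup => _ [t /= t0 <-].
  have Fle (a c : R) : 0 < a -> a <= t -> 0 <= c -> (besov_osc mu p t u <= c%:E)%E ->
      ((t `^ s)^-1%:E * besov_osc mu p t u `^ p^-1 <= (a `^ (- s) * c `^ p^-1)%:E)%E.
    move=> a0 at_ c0 hc; rewrite EFinM; apply: lee_pmul.
    - by rewrite lee_fin invr_ge0 powR_ge0.
    - exact: poweR_ge0.
    - rewrite lee_fin powRN lef_pV2 ?posrE ?powR_gt0//; apply: powR_le => //; exact: ltW.
    - by rewrite -poweR_EFin; apply: lee_poweR; rewrite // invr_ge0 ltW.
  have h1 : 0 <= 2 `^ s by exact: powR_ge0.
  have h2 : 0 <= R1 `^ (- s) by exact: powR_ge0.
  have [tR|tR] := ltP t R1.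
    have [k [k1 k2]] := dyadic_layer t0 tR.
    have tk0 : 0 < R1 / 2 ^+ k by rewrite divr_gt0// exprn_gt0.
    have tk2 : 0 < R1 / 2 ^+ k / 2 by rewrite divr_gt0.
    apply: (le_trans (Fle _ _ tk2 k1 _ (small k t k1 (ltW k2)))).
      by rewrite mulr_ge0 ?powR_ge0.
    rewrite lee_fin (powRM p^-1 (powR_ge0 _ _) (b0 k)) -powRrM mulfK ?gt_eqF//.
    rewrite (_ : _ `^ (- s) * _ = 2 `^ s * b k `^ p^-1).
      have := hb k => /= hk.
      have := ler_wpM2l h1 hk; have := mulr_ge0 h2 XY0; have := mulr_ge0 h1 Y0; lra.
    rewrite mulrA; congr (_ * _); rewrite powRN.
    have E2 : (R1 / 2 ^+ k) `^ s = 2 `^ s * (R1 / 2 ^+ k / 2) `^ s.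
      by rewrite -powRM ?(ltW tk2)//; congr (_ `^ _); field; rewrite expf_neq0.
    by rewrite E2 mulrCA mulVf ?mulr1// gt_eqF// powR_gt0.
  apply: (le_trans (Fle _ _ R10 tR N0 (large t tR))).
  rewrite lee_fin -/Y; have := mulr_ge0 h1 XY0; have := mulr_ge0 h2 X0; lra.
Unshelve. all: by end_near. Qed.

End HBnorm_upper_bound.

Section HBnorm_lower_bound.
Context (R : realType).

Lemma integral_dyadic_ge (r0 : R) (G : R -> \bar R) (K : nat -> \bar R) n :
  0 < r0 -> (forall t, 0 < t -> (0 <= G t)%E) -> (forall m, (0 <= K m)%E) ->
  (forall m t, r0 / 2 ^+ m <= t -> t < 2 * (r0 / 2 ^+ m) -> (K m <= G t)%E) ->
  (\sum_(m < n) K m * (r0 / 2 ^+ m)%:E <=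
    \int[@lebesgue_measure R]_(t in [set t : R | (0 < t)%R]) G t)%E.
Proof.
move=> r00 G0 K0 KG; pose r m := r0 / 2 ^+ m.
have rm0 m : 0 < r m by rewrite divr_gt0// exprn_gt0.
pose L m : set R := [set` `[r m, (2 * r m)%R[].
have mL m : measurable (L m : set R) by exact: measurable_itv.
have LE m t : L m t = ((r m <= t) && (t < 2 * r m)) :> Prop by rewrite /L/= in_itv.
pose h m t := (K m * (\1_(L m) t)%:E)%E.
have h0 m t : (0 <= h m t)%E by rewrite mule_ge0// lee_fin.
have mh m : measurable_fun [set: R] (h m).
  apply: emeasurable_funM; first exact: measurable_cst.
  by apply/measurable_EFinP; exact: measurable_indic.
have hE m : (\int[@lebesgue_measure R]_t h m t = K m * (r m)%:E)%E.
  rewrite /h ge0_integralZl//; last first.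
    by apply/measurable_EFinP; apply: measurable_indic; exact: mL.
  rewrite (integral_indic _ measurableT (mL m : measurable (L m : set (measurableTypeR R)))) setIT; congr (_ * _)%E.
  apply: (eq_trans (lebesgue_measure_itv _)); rewrite /= lte_fin.
  have rm := rm0 m; case: ltP => hh; last by exfalso; move: hh; lra.
  by rewrite -EFinB; congr (_%:E); ring.
rewrite -(eq_bigr _ (fun (m : 'I_n) _ => hE m)) -ge0_integral_sum//; last by move=> m; exact: mh.
rewrite [leRHS]integral_mkcond; apply: ge0_le_integral_outer => t _.
  by apply: sume_ge0 => m _.
have [[m Lm]|nL] := pselect (exists m : 'I_n, L m t).
  have [t1 t2] : r m <= t /\ t < 2 * r m by apply/andP; rewrite -LE.
  rewrite (bigD1 m)//= big1 ?adde0.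
    rewrite patchE mem_set/=; last exact: lt_le_trans t1.
    by rewrite /h indicE mem_set// mule1; exact: KG.
  move=> k km; rewrite /h indicE memNset ?mule0// LE => /andP[k1 k2].
  have [mk|] := ltnP m k; last first.
    rewrite leq_eqVlt => /orP[/eqP/val_inj kmE|km']; first by rewrite kmE eqxx in km.
    have : 2 * r m <= r k.
      rewrite /r mulrCA ler_wpM2l ?(ltW r00)// ler_pdivrMr ?exprn_gt0//.
      rewrite mulrC ler_pdivlMr ?exprn_gt0// -exprS.
      by rewrite ler_eXn2l// ltr1n.
    by lra.
  have : 2 * r k <= r m.
    rewrite /r mulrCA ler_wpM2l ?(ltW r00)// ler_pdivrMr ?exprn_gt0//.
    rewrite mulrC ler_pdivlMr ?exprn_gt0// -exprS.
    by rewrite ler_eXn2l// ltr1n.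
  by lra.
rewrite big1 => [|m _]; last first.
  by rewrite /h indicE memNset ?mule0// => Lm; apply: nL; exists m.
by rewrite patchE; case: ifPn => [/set_mem/G0//|_]; exact: lexx.
Qed.

(** D m stands for the oscillation at the scale r0 / 2 ^+ m. Doubling of the
    measure makes it comparable to the oscillation at all t of the dyadic
    interval above this scale. Finiteness of the seminorm makes all the D m
    finite. *)
Lemma HBnorm_lower (p alpha r0 Cd : R) (q : \bar R) : 1 <= p -> (1 <= q)%E ->
  0 < alpha -> 0 < r0 -> 1 <= Cd ->
  exists2 C : R, 0 <= C & forall d (T : borelMetricType R d)
    (mu : {measure set T -> \bar R}) (f : T -> R) (D : nat -> \bar R),
    (forall m, (0 <= D m)%E) ->
    (forall m t, r0 / 2 ^+ m <= t -> t <= 2 * (r0 / 2 ^+ m) ->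
      (D m <= Cd%:E * besov_osc mu p t f)%E) ->
    (HBnorm mu alpha p q f < +oo)%E ->
    exists2 a : nat -> R, (forall m, 0 <= a m /\ D m = (a m)%:E) &
      lqb p q (fun m => (r0 / 2 ^+ m) `^ (- (alpha * p)) * a m)
        (C * fine (HBnorm mu alpha p q f)).
Proof.
move=> p1 + al0 r00 Cd1; have p0 : 0 < p by lra.
have Cd0 : 0 < Cd by lra.
case: q => [r|_|//].
- rewrite lee_fin => r1; have rr0 : 0 < r by lra.
  have rp0 : 0 < r / p by rewrite divr_gt0.
  exists ((Cd `^ (r / p) * 2 `^ (alpha * r + 1)) `^ r^-1); first exact: powR_ge0.
  move=> d T mu f D D0 hD fin.
  have osc0 t : (0 <= besov_osc mu p t f)%E.
    by rewrite besov_oscE integral_ge0// => z _; exact: oscf_ge0.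
  pose G t : \bar R := (besov_osc mu p t f `^ (r / p) / (t `^ (alpha * r + 1))%:E)%E.
  have G0 t : (0 <= G t)%E by rewrite mule_ge0 ?poweR_ge0// inve_ge0 lee_fin powR_ge0.
  pose I := (\int[@lebesgue_measure R]_(t in [set t : R | (0 < t)%R]) G t)%E.
  have I0 : (0 <= I)%E by apply: integral_ge0.
  have HE : HBnorm mu alpha p r%:E f = (I `^ r^-1)%E by [].
  set H := fine _; have H0 : 0 <= H by rewrite fine_ge0// HE poweR_ge0.
  have IE : I = (H `^ r)%:E.
    have Hf : HBnorm mu alpha p r%:E f = H%:E.
      by rewrite /H fineK// ge0_fin_numE// HE poweR_ge0.
    by rewrite -poweR_EFin -Hf HE -poweRrM mulVf ?gt_eqF// poweRe1.
  pose rk m := r0 / 2 ^+ m.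
  have rk0 m : 0 < rk m by rewrite divr_gt0// exprn_gt0.
  pose v m := (Cd `^ (r / p) * (2 * rk m) `^ (alpha * r + 1))^-1.
  have v0 m : 0 < v m.
    by rewrite invr_gt0 mulr_gt0 ?powR_gt0// mulr_gt0.
  have low n : (\sum_(m < n) (D m `^ (r / p) * (v m)%:E) * (rk m)%:E <= (H `^ r)%:E)%E.
    rewrite -IE; apply: (@integral_dyadic_ge _ _ (fun m => D m `^ (r / p) * (v m)%:E)%E) => //.
      by move=> m; rewrite mule_ge0 ?poweR_ge0// lee_fin ltW.
    move=> m t t1 t2; have t0 : 0 < t by apply: lt_le_trans t1; exact: rk0.
    rewrite /v invfM EFinM muleA /G; apply: lee_pmul.
    - by rewrite mule_ge0 ?poweR_ge0// lee_fin invr_ge0 powR_ge0.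
    - by rewrite lee_fin invr_ge0 powR_ge0.
    - rewrite muleC lee_pdivrMl ?powR_gt0// -poweR_EFin -poweRM ?lee_fin ?(ltW Cd0)//.
      by apply: lee_poweR; rewrite ?(ltW rp0)//; exact: hD (ltW t2).
    - rewrite inver gt_eqF ?powR_gt0// lee_fin lef_pV2 ?posrE ?powR_gt0// ?mulr_gt0//.
      apply: powR_le; [by rewrite addr_ge0// mulr_ge0// ltW|exact: ltW|exact: ltW].
  have Dfin m : (D m < +oo)%E.
    rewrite ltNge leye_eq; apply/negP => /eqP Dy.
    have := low m.+1; rewrite big_ord_recr/= Dy poweRyr ?gt_eqF//.
    rewrite gt0_mulye ?lte_fin// gt0_mulye ?lte_fin ?rk0//.
    rewrite addey ?leye_eq// gt_eqF// (lt_le_trans (ltNyr 0))//.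
    apply: sume_ge0 => k _; rewrite mule_ge0 ?lee_fin ?(ltW (rk0 _))// mule_ge0 ?poweR_ge0//.
    by rewrite lee_fin ltW.
  have DE m : D m = (fine (D m))%:E by rewrite fineK// ge0_fin_numE.
  exists (fun m => fine (D m)).
    by move=> m; split => //; exact: fine_ge0.
  move=> n /=; rewrite powRM ?powR_ge0// -powRrM mulVf ?gt_eqF// powRr1; last first.
    by rewrite mulr_ge0 ?powR_ge0.
  have lown : \sum_(m < n) fine (D m) `^ (r / p) * v m * rk m <= H `^ r.
    rewrite -lee_fin -sumEFin; apply: le_trans (low n); apply: lee_sum => m _.
    by rewrite [in leRHS]DE poweR_EFin -!EFinM.
  have Cc0 : 0 <= Cd `^ (r / p) * 2 `^ (alpha * r + 1) by rewrite mulr_ge0 ?powR_ge0.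
  apply: le_trans (ler_wpM2l Cc0 lown); rewrite mulr_sumr; apply: ler_sum => m _.
  rewrite powRM ?powR_ge0 ?fine_ge0// -powRrM.
  rewrite (_ : - (alpha * p) * (r / p) = - (alpha * r)); last by field; rewrite gt_eqF.
  have rm := rk0 m; rewrite -/(rk m) /v (powRM (alpha * r + 1) (ler0n _ 2) (ltW rm)).
  rewrite (powRD (x := rk m)); last by rewrite (gt_eqF rm) implybT.
  rewrite (powRr1 (ltW rm)) powRN.
  have e1 : Cd `^ (r / p) != 0 by rewrite gt_eqF// powR_gt0.
  have e2 : 2 `^ (alpha * r + 1) != 0 :> R by rewrite gt_eqF// powR_gt0.
  have e3 : rk m `^ (alpha * r) != 0 by rewrite gt_eqF// powR_gt0.
  rewrite le_eqVlt; apply/orP; left; apply/eqP.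
  by field; rewrite e1 e2 e3 gt_eqF.
- exists (Cd `^ p^-1); first exact: powR_ge0.
  move=> d T mu f D D0 hD fin.
  have osc0 t : (0 <= besov_osc mu p t f)%E.
    by rewrite besov_oscE integral_ge0// => z _; exact: oscf_ge0.
  set H := fine _.
  have Hn0 : (0 <= HBnorm mu alpha p +oo%E f)%E.
    rewrite /HBnorm; apply: (@le_trans _ _ ((1 `^ alpha)^-1%:E * besov_osc mu p 1 f `^ p^-1)%E).
      by rewrite mule_ge0 ?poweR_ge0// lee_fin invr_ge0 powR_ge0.
    by apply: ereal_sup_ubound; exists 1 => //; exact: ltr01.
  have Hf : HBnorm mu alpha p +oo%E f = H%:E by rewrite /H fineK// ge0_fin_numE.
  have H0 : 0 <= H by rewrite fine_ge0.
  pose rk m := r0 / 2 ^+ m.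
  have rk0 m : 0 < rk m by rewrite divr_gt0// exprn_gt0.
  have low m : (D m `^ p^-1 <= (Cd `^ p^-1 * rk m `^ alpha * H)%:E)%E.
    have ip0 : 0 <= p^-1 by rewrite invr_ge0 ltW.
    apply: (@le_trans _ _ ((Cd%:E * besov_osc mu p (rk m) f) `^ p^-1)%E).
      apply: lee_poweR => //; apply: hD => //; rewrite -/(rk m); have := rk0 m; lra.
    rewrite poweRM ?lee_fin ?(ltW Cd0)// poweR_EFin -mulrA EFinM.
    apply: lee_wpmul2l; first by rewrite lee_fin powR_ge0.
    rewrite EFinM -lee_pdivrMl ?powR_gt0// -Hf /HBnorm.
    by apply: ereal_sup_ubound; exists (rk m) => //=.
  have Dfin m : (D m < +oo)%E.
    apply: (@lty_poweRy _ _ p^-1); first by rewrite invr_neq0// gt_eqF.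
    exact: le_lt_trans (low m) (ltry _).
  have DE m : D m = (fine (D m))%:E by rewrite fineK// ge0_fin_numE.
  exists (fun m => fine (D m)).
    by move=> m; split => //; exact: fine_ge0.
  move=> m /=; have := low m; rewrite [in X in (X <= _)%E -> _]DE poweR_EFin lee_fin => h.
  have rm := rk0 m.
  rewrite powRM ?powR_ge0 ?fine_ge0// -powRrM mulNr mulfK ?gt_eqF// -/(rk m).
  rewrite powRN mulrC ler_pdivrMr ?powR_gt0//; lra.
Qed.

End HBnorm_lower_bound.

(** * The extension operator *)

Section Lp.
Context (R : realType) d (T : measurableType d) (mu : {measure set T -> \bar R}).

Lemma Lnorm_powE (p : R) (f : T -> R) :
  ('N[mu]_p%:E [EFin \o f] = (\int[mu]_x (`|f x| `^ p)%:E) `^ p^-1)%E.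
Proof. by rewrite unlock. Qed.

Lemma Lfun_powP (p : R) (f : T -> R) : p != 0 ->
  (f \in Lfun mu p%:E) <->
  measurable_fun [set: T] f /\ (\int[mu]_x (`|f x| `^ p)%:E < +oo)%E.
Proof.
move=> p0; rewrite inE; split.
  move=> /andP[/[!inE]/= mf]; rewrite /finite_norm Lnorm_powE => h; split => //.
  by apply: lty_poweRy h; rewrite invr_neq0.
move=> [mf h]; apply/andP; split; rewrite inE//=.
by rewrite /finite_norm Lnorm_powE; exact: poweR_lty.
Qed.

Lemma integrable_of_pow (p : R) (D : set T) (f : T -> R) : 1 <= p ->
  measurable D -> (mu D < +oo)%E -> measurable_fun [set: T] f ->
  (\int[mu]_x (`|f x| `^ p)%:E < +oo)%E -> mu.-integrable D (EFin \o f).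
Proof.
move=> p1 mD muD mf h; apply/integrableP; split.
  by apply/measurable_EFinP; exact: measurable_funTS.
apply: (@le_lt_trans _ _ (\int[mu]_(x in D) (1 + (`|f x| `^ p)%:E))%E).
  apply: ge0_le_integral_outer => x Dx; first exact: abse_ge0.
  rewrite /= -EFinD lee_fin; have [f1|f1] := leP `|f x| 1.
    by apply: (le_trans f1); rewrite lerDl powR_ge0.
  by apply: (le_trans (le1r_powR (ltW f1) p1)); rewrite lerDr.
have mp := measurable_norm_powR p mf.
rewrite ge0_integralD//; last exact: measurable_funTS.
rewrite integral_cst// mul1e lte_add_pinfty//; apply: le_lt_trans h.
by apply: ge0_subset_integral => // x _; rewrite lee_fin powR_ge0.
Qed.

End Lp.

Section extension.
Context (R : realType) (dO : measure_display) (Om : borelMetricType R dO)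
  (mu : {measure set Om -> \bar R}) (Y : metricType R) (i : Om -> Y)
  (Cmu : R).
Hypothesis isoi : forall x y, mdist (i x) (i y) = mdist x y.
Hypothesis densi : forall y (e : R), 0 < e -> exists x, mdist y (i x) < e.
Hypothesis dbl : doubling_with mu Cmu.
Context (dB : measure_display) (B : borelMetricType R dB) (j : B -> Y).
Hypothesis isoj : forall x y, mdist (j x) (j y) = mdist x y.
Hypothesis sep : forall x, exists2 e : R, 0 < e & forall z, e <= mdist (i x) (j z).
Context (nu : {measure set B -> \bar R}).
Hypothesis fin : forall z (r : R), 0 < r ->
  (0 < nu (ball z r))%E /\ (nu (ball z r) < +oo)%E.
Variables (R1 : R) (R10 : 0 < R1).

Local Notation delta := (delta i j).
Local Notation D := (Dbl Cmu).
Local Notation Av := (Av i j nu).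
Local Notation locint := (locint nu).

(** It vanishes for delta >= R1 / 2, where boundary balls beyond the range of the
    regularity of nu would enter. *)
Definition cutoff x : R := Num.max 0 (1 - 2 / R1 * delta x).

Lemma cutoff01 x : 0 <= cutoff x <= 1.
Proof.
rewrite /cutoff le_max lexx/= ge_max ler01/= gerBl.
by rewrite mulr_ge0 ?divr_ge0 ?(ltW R10)// ltW// (delta_gt0 sep).
Qed.

Lemma cutoff_lip x y : `|cutoff x - cutoff y| <= 2 / R1 * mdist x y.
Proof.
have c0 : 0 <= 2 / R1 by rewrite divr_ge0 ?(ltW R10).
apply: le_trans (max0_lip _ _) _.
rewrite (_ : _ - _ - _ = 2 / R1 * (delta y - delta x)); last by ring.
rewrite normrM (ger0_norm c0) distrC.
by rewrite ler_wpM2l// delta_lipN.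
Qed.

Lemma cutoff_out x : R1 / 2 <= delta x -> cutoff x = 0.
Proof.
move=> h; apply/max_idPl; rewrite subr_le0 mulrAC ler_pdivlMr//.
by move: h; lra.
Qed.

Definition Ext f x : R := cutoff x * Av f x.

Lemma Ext_lin a f g : locint f -> locint g ->
  Ext (fun z => a * f z + g z) = (fun x => a * Ext f x + Ext g x).
Proof.
by move=> lf lg; apply/funext => x; rewrite /Ext (Av_lin isoj sep)//; ring.
Qed.

Lemma measurable_Ext f : locint f -> measurable_fun [set: Om] (Ext f).
Proof.
move=> lf; apply: measurable_funM; last exact: (measurable_Av isoi isoj sep fin lf).
by apply: lip_measurable_fun => x y; exact: cutoff_lip.
Qed.

Lemma Ext_le f x : `|Ext f x| <= `|Av f x|.
Proof.
have /andP[h0 h1] := cutoff01 x.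
by rewrite normrM (ger0_norm h0) ler_piMl.
Qed.

Lemma Ext_out f x : R1 / 2 <= delta x -> Ext f x = 0.
Proof. by move=> h; rewrite /Ext cutoff_out// mul0r. Qed.

Lemma Ext_Lp p f c : 0 < p ->
  outer_le mu [set x | delta x < R1] (fun x => (`|Av f x| `^ p)%:E) c ->
  (\int[mu]_x (`|Ext f x| `^ p)%:E <= c)%E.
Proof.
move=> p0 h; apply: outer_leP; first by move=> x; rewrite lee_fin powR_ge0.
apply: (@outer_le_supp _ _ _ mu [set x | delta x < R1]).
  move=> x /negP; rewrite -leNgt => h1; rewrite Ext_out ?normr0 ?powR0 ?gt_eqF//.
  by have := R10; lra.
apply: outer_le_sub h => // x _; rewrite lee_fin; apply: powR_le => //; first exact: ltW.
exact: Ext_le.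
Qed.

(** Outside the set of points with delta < R1 or delta < 8 tau, the cutoff
    vanishes on the whole ball B(x, t). *)
Lemma Ext_osc (p t tau : R) f a b : 0 < p -> 0 < t -> t <= tau -> locint f ->
  outer_le mu [set x | delta x < R1 \/ delta x < 8 * tau] (oscf mu p t (Av f)) a ->
  outer_le mu [set x | delta x < R1 \/ delta x < 8 * tau] (fun x => (`|Av f x| `^ p)%:E) b ->
  (besov_osc mu p t (Ext f) <= (2 `^ p)%:E * (a + ((2 / R1 * t) `^ p)%:E * b))%E.
Proof.
move=> p0 t0 tt lf ha hb.
apply: (cutoff_osc isoi densi dbl t0 p0 _ _ cutoff01 cutoff_lip _ ha hb).
- by rewrite divr_ge0 ?(ltW R10).
- exact: (measurable_Av isoi isoj sep fin lf).
- move=> x y nW xy; apply: cutoff_out; rewrite leNgt; apply/negP => dy; apply: nW.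
  have := delta_lip isoi j x y; have := R10.
  have [?|? ? ?] := ltP (delta x) (8 * tau); first by right.
  by left; lra.
Qed.

Lemma Ext_large (p t : R) f : 0 < p -> R1 <= t -> locint f ->
  (besov_osc mu p t (Ext f) <=
    (KN Cmu p * D ^+ 7)%:E * \int[mu]_x (`|Ext f x| `^ p)%:E)%E.
Proof.
move=> p0 tR lf; have t0 : 0 < t by exact: lt_le_trans tR.
apply: (large_osc isoi densi dbl (j := j)) => //; first exact: measurable_Ext.
by move=> x tx; apply: Ext_out; have := R10; lra.
Qed.

Lemma Ext_L1loc p f : 1 <= p -> locint f ->
  (\int[mu]_x (`|Ext f x| `^ p)%:E < +oo)%E -> L1loc mu (Ext f).
Proof.
move=> p1 lf h; split; first exact: measurable_Ext.
move=> x; exists 1 => //; apply: (integrable_of_pow p1 _ _ (measurable_Ext lf) h).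
  exact: measurable_bball.
by case: (ball_mu_fin isoi densi dbl x ltr01).
Qed.

End extension.

Section osc_sum.
Context (R : realType).

(** All the ratios tau k / tau m are halved when k increases by 1, so the sum
    over the layers obeys a one-step recursion. *)
Lemma osc_sum_rec (R1 p theta K M : R) (a : nat -> R) : 0 < R1 ->
  let tau k := R1 / 2 ^+ k in
  let c k := K * (\sum_(m < k.+1) (tau k / tau m) `^ p * tau m `^ theta * a m)
             + (tau k / R1) `^ p * M in
  c 0%N = K * (tau 0%N `^ theta * a 0%N) + M /\
  forall k, c k.+1 = 2 `^ (- p) * c k + K * (tau k.+1 `^ theta * a k.+1).
Proof.
move=> R10 tau c.
have tau0 k : 0 < tau k by rewrite divr_gt0// exprn_gt0.
have t1 : tau 0%N = R1 by rewrite /tau expr0 divr1.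
split.
  by rewrite /c big_ord_recr big_ord0/= add0r t1 divff ?gt_eqF// powR1 !mul1r.
move=> k.
have h z : 0 <= z -> (tau k.+1 / z) `^ p = 2 `^ (- p) * (tau k / z) `^ p.
  move=> z0; rewrite (_ : tau k.+1 / z = 2^-1 * (tau k / z)); last first.
    by rewrite /tau exprS invfM; ring.
  have tz : 0 <= tau k / z by rewrite divr_ge0 ?(ltW (tau0 k)).
  have h2 : 0 <= 2^-1 :> R by rewrite invr_ge0.
  rewrite (powRM p h2 tz); congr (_ * _).
  by rewrite -[2^-1]powR_inv1// -powRrM mulN1r.
rewrite /c big_ord_recr/= divff ?gt_eqF// powR1 mul1r h ?(ltW R10)//.
rewrite (eq_bigr (fun m : 'I_k.+1 => 2 `^ (- p) * ((tau k / tau m) `^ p * tau m `^ theta * a m))).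
  by rewrite -mulr_sumr; ring.
by move=> m _; rewrite h ?(ltW (tau0 m))// !mulrA.
Qed.

Lemma lqb_scale p (q : \bar R) (x : nat -> R) (k X : R) : 0 < p -> (1 <= q)%E -> 0 <= k -> 0 <= X ->
  (forall n, 0 <= x n) -> lqb p q x X -> lqb p q (fun n => k * x n) (k `^ p^-1 * X).
Proof.
move=> p0 + k0 X0 x0; case: q => [r|_|//].
  move=> r1 /= h n; have r0 : 0 < r by move: r1; rewrite lee_fin; lra.
  rewrite powRM ?powR_ge0// -powRrM.
  rewrite (eq_bigr (fun m : 'I_n => k `^ (r / p) * x m `^ (r / p))); last first.
    by move=> m _; rewrite powRM.
  by rewrite -mulr_sumr [p^-1 * r]mulrC ler_wpM2l ?powR_ge0.
by move=> /= h n; rewrite powRM// ler_wpM2l ?powR_ge0.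
Qed.

End osc_sum.

(** The hypotheses on the space and its boundary, with the regularity of nu on
    the radii up to Rmax. *)
Record trace_setting (R : realType) (Cmu theta Ct Rmax : R)
    dO (Om : borelMetricType R dO) (mu : {measure set Om -> \bar R})
    (Y : metricType R) (i : Om -> Y) dB (B : borelMetricType R dB) (j : B -> Y)
    (nu : {measure set B -> \bar R}) : Prop := TraceSetting {
  ts_isoi : forall x y, mdist (i x) (i y) = mdist x y;
  ts_dens : forall y (e : R), 0 < e -> exists x, mdist y (i x) < e;
  ts_dbl : doubling_with mu Cmu;
  ts_isoj : forall x y, mdist (j x) (j y) = mdist x y;
  ts_sep : forall x, exists2 e : R, 0 < e & forall z, e <= mdist (i x) (j z);
  ts_fin : forall z (r : R), 0 < r ->
    (0 < nu (ball z r))%E /\ (nu (ball z r) < +oo)%E;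
  ts_reg : forall z (r : R), 0 < r -> r <= Rmax ->
    (Ct^-1%:E * (mu (tball i (j z) r) / (r `^ theta)%:E) <= nu (ball z r))%E /\
    (nu (ball z r) <= Ct%:E * (mu (tball i (j z) r) / (r `^ theta)%:E))%E
}.

Section besov_bound.
Context (R : realType) (Cmu theta Ct Rmax : R).

(** The balls of radius t contain those of radius r and have comparable
    measure. *)
Lemma osc_cmp (htheta : 0 < theta) (hCt : 1 <= Ct) dO (Om : borelMetricType R dO)
    (mu : {measure set Om -> \bar R})
    (Y : metricType R) (i : Om -> Y) dB (B : borelMetricType R dB) (j : B -> Y)
    (nu : {measure set B -> \bar R}) (p r t : R) (f : B -> R) :
  trace_setting Cmu theta Ct Rmax mu i j nu ->
  0 < r -> 2 * r <= Rmax -> r <= t -> t <= 2 * r ->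
  (besov_osc nu p r f <= (Ct ^+ 2 * Dbl Cmu)%:E * besov_osc nu p t f)%E.
Proof.
move=> [isoi densi dbl isoj sep fin reg] r0 rR rt t2.
have D1 := Dbl_ge1 dbl.
have t0 : 0 < t by lra.
have c0 : 0 < Ct ^+ 2 * Dbl Cmu.
  by apply: mulr_gt0; [apply: exprn_gt0|]; exact: (lt_le_trans ltr01).
rewrite !besov_oscE; apply: le_trans (ge0_integralZl_outer _ c0 _); last first.
  by move=> x; exact: oscf_ge0.
apply: ge0_le_integral_outer => x _; first exact: oscf_ge0.
rewrite /oscf (nuE fin x r0) (nuE fin x t0).
have nr := nuv_gt0 fin x r0; have nt := nuv_gt0 fin x t0.
rewrite !inver !gt_eqF// muleA -EFinM; apply: lee_pmul.
- by rewrite lee_fin invr_ge0 ltW.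
- by apply: integral_ge0 => y _; rewrite lee_fin powR_ge0.
- rewrite lee_fin ler_pdivlMr// mulrC ler_pdivrMr//.
  have := nuv_cmp (n := 1) isoi densi dbl fin htheta hCt reg (z := x) (w := x) r0 (_ : r <= 2 * r) rR.
  rewrite mdistxx !expr1 add0r => h; apply: (@le_trans _ _ (nuv nu x (2 * r))); last by apply: h; lra.
  by apply: le_nuv => //; rewrite ?mdistxx; lra.
- rewrite integral_mkcond [leRHS]integral_mkcond.
  apply: ge0_le_integral_outer => y _; rewrite !patchE.
    by case: ifP => _; rewrite ?lexx// lee_fin powR_ge0.
  case: ifPn => [/set_mem xy|_]; last by case: ifP => _; [rewrite lee_fin powR_ge0|exact: lexx].
  by rewrite mem_set//; move: xy; rewrite !ballEmdist/=; lra.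
Qed.

End besov_bound.

(** * The Besov bound *)

Lemma HBnorm_ge0 (R : realType) d (T : borelMetricType R d)
    (mu : {measure set T -> \bar R}) (alpha p : R) (q : \bar R) f :
  (0 <= HBnorm mu alpha p q f)%E.
Proof.
have h : (0 <= ereal_sup [set (t `^ alpha)^-1%:E * besov_osc mu p t f `^ p^-1
                         | t in [set t : R | (0 < t)%R]])%E.
  apply: le_trans (ereal_sup_ubound _); last by exists 1 => //; exact: ltr01.
  by rewrite mule_ge0 ?poweR_ge0// lee_fin invr_ge0 powR_ge0.
by case: q => [r||]//=; exact: poweR_ge0.
Qed.

Section Ext_bound.
Context (R : realType) (alpha p theta : R) (q : \bar R) (Cmu Ct R1 : R).
Hypothesis alpha0 : 0 < alpha.
Hypothesis p1 : 1 <= p.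
Hypothesis q1 : (1 <= q)%E.
Hypothesis theta0 : 0 < theta.
Hypothesis smooth : alpha < 1 - theta / p.
Hypothesis Cmu1 : 1 <= Cmu.
Hypothesis Ct1 : 1 <= Ct.
Hypothesis R10 : 0 < R1.

Local Notation Rmax := (2 ^+ 10 * R1).

Lemma Besov_locint dO (Om : borelMetricType R dO) (mu : {measure set Om -> \bar R})
    (Y : metricType R) (i : Om -> Y) dB (B : borelMetricType R dB) (j : B -> Y)
    (nu : {measure set B -> \bar R}) (f : B -> R) :
  trace_setting Cmu theta Ct Rmax mu i j nu ->
  Besov nu alpha p q f ->
  [/\ locint nu f, (\int[nu]_z (`|f z| `^ p)%:E < +oo)%E &
     (HBnorm nu alpha p q f < +oo)%E].
Proof.
move=> S [[[mf _] HBf] /= Lf]; have p0 : p != 0 by rewrite gt_eqF//; have := p1; lra.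
have [_ If] := (Lfun_powP nu f p0).1 Lf; split => //; split => // w r r0.
apply: (integrable_of_pow p1) => //; first exact: measurable_bball.
by case: (ts_fin S w r0).
Qed.

(** The constant comes before the space: it depends on the parameters and on the
    height R1 of the collar only. *)
Theorem Ext_Besov : exists C : R, 1 <= C /\
  forall dO (Om : borelMetricType R dO) (mu : {measure set Om -> \bar R})
    (Y : metricType R) (i : Om -> Y) dB (B : borelMetricType R dB) (j : B -> Y)
    (nu : {measure set B -> \bar R}),
  trace_setting Cmu theta Ct Rmax mu i j nu ->
  forall f, Besov nu alpha p q f ->
  [/\ Besov mu (alpha + theta / p) p q (Ext i j nu R1 f),
    ('N[mu]_p%:E [EFin \o Ext i j nu R1 f] <= C%:E * 'N[nu]_p%:E [EFin \o f])%E &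
    (HBnorm mu (alpha + theta / p) p q (Ext i j nu R1 f) <=
      C%:E * (HBnorm nu alpha p q f + 'N[nu]_p%:E [EFin \o f]))%E].
Proof.
have p0 : 0 < p by have := p1; lra.
have alpha0' := alpha0; have theta0' := theta0; have R10' := R10.
pose s := alpha + theta / p.
have tp0 : 0 < theta / p by rewrite divr_gt0.
have s0 : 0 < s by rewrite addr_gt0.
have s1 : s < 1 by rewrite /s; have := smooth; lra.
have spE : s * p = alpha * p + theta by rewrite /s mulrDl divfK// gt_eqF.
have D1 : 1 <= Dbl Cmu by rewrite /Dbl exprn_ege1.
pose lam := 2 `^ (s * p - p).
have lam0 : 0 < lam by exact: powR_gt0.
have lam1 : lam < 1.
  rewrite /lam (_ : s * p - p = - ((1 - s) * p)); last by ring.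
  by apply: powR2N_lt1; rewrite mulr_gt0//; lra.
(* f enters at the scales 2 ^+ 8 * (R1 / 2 ^+ m), as in Av_osc *)
pose r0 := 2 ^+ 8 * R1.
have r00 : 0 < r0 by rewrite mulr_gt0// exprn_gt0.
have Cd1 : 1 <= Ct ^+ 2 * Dbl Cmu.
  by have : 1 <= Ct ^+ 2; [exact: exprn_ege1|nra].
have [C1 C10 low] := HBnorm_lower p1 q1 alpha0 r00 Cd1.
have [C2 C20 rec] := lqb_rec p1 q1 lam0 lam1.
have [C3 C30 up] := HBnorm_upper p1 q1 s0 R10.
pose K := 2 `^ p * (Kfar Cmu theta Ct p + Knear Cmu theta Ct p).
pose k1 := K * (2 ^+ 8) `^ (alpha * p).
pose kM := 2 `^ p * (2 `^ p * (KA Cmu theta Ct p * (8 * R1) `^ theta)).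
pose k3 := R1 `^ (- (s * p)) * kM.
pose k5 := KA Cmu theta Ct p * R1 `^ theta.
pose k4 := KN Cmu p * Dbl Cmu ^+ 7 * k5.
have KA0 : 0 <= KA Cmu theta Ct p by exact: KA_ge0.
have Ct0 : 0 <= Ct by exact: le_trans ler01 Ct1.
have D0 n : 0 <= Dbl Cmu ^+ n by rewrite exprn_ge0// (le_trans ler01).
have KN0 : 0 <= KN Cmu p by rewrite /KN mulr_ge0 ?powR_ge0// addr_ge0.
have CS0 : 0 <= CS Cmu Ct 7 by rewrite /CS mulr_ge0// exprn_ge0.
have K0 : 0 <= K.
  rewrite /K mulr_ge0 ?powR_ge0// addr_ge0//.
    rewrite /Kfar; apply: mulr_ge0 => //; apply: mulr_ge0; first exact: powR_ge0.
    by rewrite mulr_ge0// powR_ge0.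
  rewrite /Knear; apply: mulr_ge0 => //; apply: mulr_ge0 => //.
  by apply: mulr_ge0; rewrite ?powR_ge0.
have k10 : 0 <= k1 by rewrite /k1 mulr_ge0 ?powR_ge0.
have kM0 : 0 <= kM.
  rewrite /kM mulr_ge0 ?powR_ge0// mulr_ge0 ?powR_ge0//.
  by apply: mulr_ge0; rewrite ?powR_ge0.
have k30 : 0 <= k3 by rewrite /k3 mulr_ge0 ?powR_ge0.
have k50 : 0 <= k5 by rewrite /k5; apply: mulr_ge0; rewrite ?powR_ge0.
have k40 : 0 <= k4 by rewrite /k4 mulr_ge0// mulr_ge0.
pose C4 := C3 * (C2 * (k1 `^ p^-1 * C1 + k3 `^ p^-1) + k4 `^ p^-1).
have C40 : 0 <= C4.
  rewrite /C4 mulr_ge0// addr_ge0 ?powR_ge0// mulr_ge0// addr_ge0 ?powR_ge0//.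
  by rewrite mulr_ge0 ?powR_ge0.
have k5p := powR_ge0 k5 p^-1.
have C5k : k5 `^ p^-1 <= 1 + k5 `^ p^-1 + C4 by rewrite addrAC lerDr addr_ge0.
have C54 : C4 <= 1 + k5 `^ p^-1 + C4 by rewrite lerDr addr_ge0.
exists (1 + k5 `^ p^-1 + C4); split; first by rewrite -addrA lerDl addr_ge0.
move=> dO Om mu Y i dB B j nu S f Bf.
have [lf If HBf] := Besov_locint S Bf.
have [isoi densi dbl isoj sep fin reg] := S.
pose I := (\int[nu]_z (`|f z| `^ p)%:E)%E.
have I0 : (0 <= I)%E by apply: integral_ge0 => z _; rewrite lee_fin powR_ge0.
pose N := fine I.
have NE : I = N%:E by rewrite /N fineK// ge0_fin_numE.
have N0 : 0 <= N by rewrite fine_ge0.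
have nfE : ('N[nu]_p%:E [EFin \o f] = (N `^ p^-1)%:E)%E.
  by rewrite Lnorm_powE -/I NE poweR_EFin.
have pn0 : p != 0 by rewrite gt_eqF.
pose u := Ext i j nu R1 f.
have mu_ : measurable_fun [set: Om] u by exact: (measurable_Ext isoi isoj sep fin R10 lf).
have Rle c : c <= 2 ^+ 10 -> c * R1 <= Rmax by move=> h; rewrite ler_wpM2r// ltW.
have R16 : 16 * R1 <= Rmax by apply: Rle; rewrite (_ : 2 ^+ 10 = 1024%:R) ?ler_nat// -natrX.
have R128 : 16 * (8 * R1) <= Rmax.
  by rewrite mulrA -natrM; apply: Rle; rewrite (_ : 2 ^+ 10 = 1024%:R) ?ler_nat// -natrX.
have R80 : 0 < 8 * R1 by lra.
have Lp := Ext_Lp sep R10 p0 (Av_Lp_outer isoi densi dbl isoj sep fin theta0 Ct1 reg R10 R16 p1 lf).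
rewrite -/I NE -/u -/k5 -EFinM in Lp.
have Lpu : (\int[mu]_x (`|u x| `^ p)%:E < +oo)%E by apply: (le_lt_trans Lp); rewrite ltry.
have Nu : ('N[mu]_p%:E [EFin \o u] <= (k5 `^ p^-1 * N `^ p^-1)%:E)%E.
  rewrite Lnorm_powE -powRM// -poweR_EFin; apply: lee_poweR => //.
    by rewrite invr_ge0 ltW.
  by apply: integral_ge0 => x _; rewrite lee_fin powR_ge0.
pose H := fine (HBnorm nu alpha p q f).
have osc0 dT (T : borelMetricType R dT) (m : {measure set T -> \bar R}) t g : (0 <= besov_osc m p t g)%E.
  by rewrite besov_oscE integral_ge0// => z _; exact: oscf_ge0.
pose Dm m := besov_osc nu p (r0 / 2 ^+ m) f.
have r0E m : 2 ^+ 8 * (R1 / 2 ^+ m) = r0 / 2 ^+ m by rewrite /r0; ring.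
pose tau k := R1 / 2 ^+ k.
have tau00 k : 0 < tau k by rewrite divr_gt0// exprn_gt0.
have rm0 m : 0 < r0 / 2 ^+ m by rewrite divr_gt0// exprn_gt0.
have pow2_ge1 m : 1 <= 2 ^+ m :> R by rewrite exprn_ege1// ler1n.
have rmR m : 2 * (r0 / 2 ^+ m) <= Rmax.
  rewrite (_ : 2 * _ = 2 ^+ 9 * R1 / 2 ^+ m); last by rewrite /r0; ring.
  apply: (@le_trans _ _ (2 ^+ 9 * R1)).
    by rewrite ler_pdivrMr ?exprn_gt0// ler_peMr// mulr_ge0 ?exprn_ge0// ltW.
  by apply: Rle; rewrite ler_eXn2l// ltr1n.
have [a aE la] := low _ _ nu f Dm (fun m => osc0 _ _ _ _ _) (fun m t t1 t2 =>
   osc_cmp theta0 Ct1 p f S (rm0 m) (rmR m) t1 t2) HBf.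
have a0 m : 0 <= a m by have [] := aE m.
(* c k bounds the oscillation of Ext f at scale tau k: the first term is Av_osc,
   the second one the variation of the cutoff *)
pose c k := K * (\sum_(m < k.+1) (tau k / tau m) `^ p * tau m `^ theta * a m)
             + (tau k / R1) `^ p * (kM * N).
have c0 k : 0 <= c k.
  rewrite /c; apply: addr_ge0; last by rewrite mulr_ge0 ?powR_ge0// mulr_ge0.
  apply: mulr_ge0 => //.
  by apply: sumr_ge0 => m _; rewrite mulr_ge0// mulr_ge0 ?powR_ge0.
pose b k := c k / tau k `^ (s * p).
have b0 k : 0 <= b k by rewrite divr_ge0 ?powR_ge0.
pose A k := k1 * ((r0 / 2 ^+ k) `^ (- (alpha * p)) * a k).
have A0 k : 0 <= A k by rewrite mulr_ge0// mulr_ge0 ?powR_ge0.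
have AE k : K * (tau k `^ theta * a k) / tau k `^ (s * p) = A k.
  have tE : r0 / 2 ^+ k = 2 ^+ 8 * tau k by rewrite /r0 /tau mulrA.
  rewrite /A /k1 tE (powRM (- (alpha * p)) (exprn_ge0 8 (ler0n _ 2)) (ltW (tau00 k))).
  rewrite spE powRD; last by rewrite (gt_eqF (tau00 k)) implybT.
  rewrite !powRN; have e1 : (2 ^+ 8) `^ (alpha * p) != 0 :> R by rewrite gt_eqF// powR_gt0// exprn_gt0.
  have e2 : tau k `^ (alpha * p) != 0 by rewrite gt_eqF// powR_gt0.
  have e3 : tau k `^ theta != 0 by rewrite gt_eqF// powR_gt0.
  by field; rewrite e1 e2 e3.
have [cz cS] := osc_sum_rec p theta K (kM * N) a R10.
rewrite -/(c _) in cz.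
have bz : b 0%N <= A 0%N + k3 * N.
  have t1 : tau 0%N = R1 by rewrite /tau expr0 divr1.
  rewrite -AE /b [c 0%N]cz /k3 powRN mulrDl lerD2l t1.
  by rewrite le_eqVlt; apply/orP; left; apply/eqP; ring.
have bS k : b k.+1 <= A k.+1 + lam * b k.
  rewrite -AE /b [c k.+1]cS mulrDl addrC lerD2l -/(c k) le_eqVlt; apply/orP; left; apply/eqP.
  have -> : tau k `^ (s * p) = 2 `^ (s * p) * tau k.+1 `^ (s * p).
    rewrite -powRM ?(ltW (tau00 _))//; congr (_ `^ _); rewrite /tau exprS.
    by field; rewrite expf_neq0.
  rewrite /lam powRD; last by rewrite pnatr_eq0 implybT.
  have e1 : 2 `^ (s * p) != 0 :> R by rewrite gt_eqF// powR_gt0.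
  have e2 : tau k.+1 `^ (s * p) != 0 by rewrite gt_eqF// powR_gt0.
  by field; rewrite e1 e2.
have H0 : 0 <= H by rewrite /H fine_ge0// HBnorm_ge0.
have X0 : 0 <= C1 * H by rewrite mulr_ge0.
have lA : lqb p q A (k1 `^ p^-1 * (C1 * H)).
  apply: lqb_scale => //; by move=> n; rewrite mulr_ge0 ?powR_ge0.
have XA0 : 0 <= k1 `^ p^-1 * (C1 * H) by rewrite mulr_ge0 ?powR_ge0.
have k3N : 0 <= k3 * N by rewrite mulr_ge0.
have lb := rec A b (k3 * N) _ A0 b0 k3N XA0 bz bS lA.
have small k t : tau k / 2 <= t -> t <= tau k ->
    (besov_osc mu p t u <= (tau k `^ (s * p) * b k)%:E)%E.
  move=> t1 t2; have t0 : 0 < t by apply: lt_le_trans t1; rewrite divr_gt0// tau00.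
  have hR : 2 ^+ 8 * R1 <= Rmax by apply: Rle; rewrite ler_eXn2l// ltr1n.
  have ha m : (m <= k)%N -> (besov_osc nu p (2 ^+ 8 * (R1 / 2 ^+ m)) f <= (a m)%:E)%E.
    by move=> _; rewrite r0E; have [_ <-] := aE m.
  have oscA := Av_osc isoi densi dbl isoj sep fin theta0 Ct1 reg R10 hR p1 lf t1 t2 a0 ha.
  have LA : outer_le mu [set x | delta i j x < R1 \/ delta i j x < 8 * tau k]
      (fun x => (`|Av i j nu f x| `^ p)%:E) (KA Cmu theta Ct p * (8 * R1) `^ theta * N)%:E.
    have := Av_Lp_outer isoi densi dbl isoj sep fin theta0 Ct1 reg R80 R128 p1 lf.
    rewrite -/I NE -EFinM; apply: outer_le_sub => // x /=.
    have tR : tau k <= R1 by rewrite ler_pdivrMr ?exprn_gt0// ler_peMr// ltW.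
    case=> /lt_le_trans; apply; last by rewrite ler_wpM2l.
    by rewrite ler_peMl ?(ltW R10)// ler1n.
  apply: (le_trans (Ext_osc isoi densi dbl isoj sep fin R10 p0 t0 t2 lf oscA LA)).
  set SS := \sum_(m < _) _.
  change ((2 `^ p * ((Kfar Cmu theta Ct p + Knear Cmu theta Ct p) * SS +
    (2 / R1 * t) `^ p * (KA Cmu theta Ct p * (8 * R1) `^ theta * N)))%:E
    <= (tau k `^ (s * p) * b k)%:E)%E.
  rewrite lee_fin.
  have -> : tau k `^ (s * p) * b k = c k by rewrite /b mulrC divfK// gt_eqF// powR_gt0.
  have cE : c k = K * SS + (tau k / R1) `^ p * (kM * N) by [].
  have hT : (2 / R1 * t) `^ p <= 2 `^ p * (tau k / R1) `^ p.
    rewrite -powRM ?divr_ge0 ?(ltW (tau00 k)) ?(ltW R10)//.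
    rewrite (_ : 2 / R1 * t = 2 * (t / R1)); last by ring.
    apply: powR_le; first exact: ltW.
      by rewrite mulr_ge0// divr_ge0 ?ltW.
    by rewrite ler_wpM2l// ler_wpM2r// invr_ge0 ltW.
  have Z0 : 0 <= KA Cmu theta Ct p * (8 * R1) `^ theta * N.
    by apply: mulr_ge0 => //; apply: mulr_ge0; rewrite ?powR_ge0.
  have := ler_wpM2r Z0 (ler_wpM2l (powR_ge0 2 p) hT).
  rewrite cE /K /kM; move: (Kfar _ _ _ _ + _) => K1; move: (KA _ _ _ _ * _) => Z.
  by clear; lra.
have large t : R1 <= t -> (besov_osc mu p t u <= (k4 * N)%:E)%E.
  move=> tR; apply: (le_trans (Ext_large isoi densi dbl isoj sep fin R10 p0 tR lf)).
  have c40 : (0 <= (KN Cmu p * Dbl Cmu ^+ 7)%:E)%E by rewrite lee_fin mulr_ge0.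
  apply: (le_trans (lee_wpmul2l c40 Lp)).
  by rewrite -EFinM lee_fin /k4 -(mulrA (KN Cmu p * Dbl Cmu ^+ 7)).
have k4N : 0 <= k4 * N by rewrite mulr_ge0.
have X2 : 0 <= C2 * (k1 `^ p^-1 * (C1 * H) + (k3 * N) `^ p^-1).
  by rewrite mulr_ge0// addr_ge0 ?powR_ge0.
have HBu := up _ _ mu u b (k4 * N) _ b0 k4N X2 small large lb.
have HBE : HBnorm nu alpha p q f = H%:E.
  by rewrite /H fineK// ge0_fin_numE// HBnorm_ge0.
have Nf0 : 0 <= N `^ p^-1 by exact: powR_ge0.
have HBu' : (HBnorm mu s p q u <= (C4 * (H + N `^ p^-1))%:E)%E.
  apply: (le_trans HBu); rewrite lee_fin (powRM p^-1 k30 N0) (powRM p^-1 k40 N0) /C4 -(mulrA C3); apply: ler_wpM2l => //.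
  set x1 := k1 `^ _; set x3 := k3 `^ _; set x4 := k4 `^ _; set n := N `^ _.
  have h1 : 0 <= C2 * (x1 * C1) * n by rewrite !mulr_ge0 ?powR_ge0.
  have h3 : 0 <= C2 * x3 * H by rewrite !mulr_ge0 ?powR_ge0.
  have h4 : 0 <= x4 * H by rewrite mulr_ge0 ?powR_ge0.
  by move: h1 h3 h4; clear; lra.
split.
- split; [split|] => //.
  + exact: (Ext_L1loc isoi densi dbl isoj sep fin R10 p1 lf).
  + exact: le_lt_trans HBu' (ltry _).
  + by rewrite /=; apply/(Lfun_powP mu u pn0).
- apply: (le_trans Nu); rewrite nfE -EFinM lee_fin ler_wpM2r//.
- apply: (le_trans HBu'); rewrite nfE HBE -EFinD -EFinM lee_fin ler_wpM2r// addr_ge0//.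
Qed.

End Ext_bound.

(** * The trace of the extension *)

Lemma cvge0_near (R : realType) (F : set_system R) {FF : Filter F} (f : R -> \bar R) :
  (\forall t \near F, 0 <= f t)%E ->
  (forall e : R, 0 < e -> \forall t \near F, (f t <= e%:E)%E) ->
  f @ F --> 0%E.
Proof.
move=> f0 h; apply/fine_cvgP; split.
  near=> t; rewrite ge0_fin_numE; last by near: t.
  by apply: (@le_lt_trans _ _ 1%:E); [near: t; exact: h|exact: ltry].
apply/cvgrPdist_le => e e0; near=> t; rewrite sub0r normrN /=.
have t0 : (0 <= f t)%E by near: t.
have te : (f t <= e%:E)%E by near: t; exact: h.
rewrite ger0_norm ?fine_ge0//; rewrite -lee_fin fineK// ge0_fin_numE//.
by apply: le_lt_trans te _; exact: ltry.
Unshelve. all: by end_near. Qed.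

Lemma lqb_term (R : realType) (p : R) (q : \bar R) (x : nat -> R) (X : R) k :
  0 < p -> (1 <= q)%E -> 0 <= X -> (forall k, 0 <= x k) -> lqb p q x X ->
  x k <= X `^ p.
Proof.
move=> p0 + X0 x0; case: q => [r|_|//].
  rewrite lee_fin => r1 /= h; have r0 : 0 < r by lra.
  have : x k `^ (r / p) <= X `^ r.
    apply: le_trans (h k.+1); rewrite big_ord_recr/= lerDr.
    by apply: sumr_ge0 => m _; exact: powR_ge0.
  have pr : 0 <= p / r by rewrite divr_ge0 ?ltW.
  move=> /(powR_le pr (powR_ge0 _ _)); rewrite -!powRrM.
  rewrite (_ : r / p * (p / r) = 1) ?powRr1//; last by field; rewrite !gt_eqF.
  by rewrite (_ : r * (p / r) = p)//; field; rewrite gt_eqF.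
move=> /(_ k) /= /(powR_le (ltW p0) (powR_ge0 _ _)).
by rewrite -powRrM mulVf ?gt_eqF// powRr1.
Qed.

(** The sum of the g k has a finite integral, so it is finite almost
    everywhere. *)
Lemma ae_term_cvg0 d (T : measurableType d) (R : realType) (mu : {measure set T -> \bar R})
    (g : nat -> T -> \bar R) :
  (forall k, measurable_fun [set: T] (g k)) -> (forall k x, (0 <= g k x)%E) ->
  (\sum_(k <oo) \int[mu]_x g k x < +oo)%E ->
  {ae mu, forall x, forall e : R, 0 < e -> exists N, forall k, (N <= k)%N -> (g k x <= e%:E)%E}.
Proof.
move=> mg g0 h; rewrite -integral_nneseries// in h.
have mS : measurable_fun [set: T] (fun x => \sum_(k <oo) g k x)%E.
  by apply: ge0_emeasurable_sum => // n; exact: mg.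
have S0 x : (0 <= \sum_(k <oo) g k x)%E by apply: nneseries_ge0.
have iS : mu.-integrable [set: T] (fun x => \sum_(k <oo) g k x)%E.
  apply/integrableP; split => //; under eq_integral do rewrite gee0_abs//.
  exact: h.
have := integrable_ae measurableT iS; apply: filterS => x /(_ I) Sx e e0.
have Sy : (\sum_(k <oo) g k x < +oo)%E by rewrite -ge0_fin_numE.
have /fine_cvgP[] := nneseries_tail_cvg Sy (fun k _ => g0 k x).
move=> [N1 _ h1] /cvgrPdist_le/(_ e e0)[N2 _ h2].
exists (maxn N1 N2) => k; rewrite geq_max => /andP[/h1/= k1 /h2/=].
rewrite sub0r normrN => k2.
apply: (@le_trans _ _ (\sum_(k <= n <oo) g n x)%E).
  have := @nneseries_lim_ge _ (fun n => g n x) xpredT k k.+1 (fun n _ _ => g0 n x).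
  by rewrite big_nat1.
rewrite -[leLHS]fineK// lee_fin; apply: le_trans k2; exact: ler_norm.
Qed.

Section trace.
Context (R : realType) (dO : measure_display) (Om : borelMetricType R dO)
  (mu : {measure set Om -> \bar R}) (Y : metricType R) (i : Om -> Y)
  (Cmu : R).
Hypothesis isoi : forall x y, mdist (i x) (i y) = mdist x y.
Hypothesis densi : forall y (e : R), 0 < e -> exists x, mdist y (i x) < e.
Hypothesis dbl : doubling_with mu Cmu.
Context (dB : measure_display) (B : borelMetricType R dB) (j : B -> Y).
Hypothesis isoj : forall x y, mdist (j x) (j y) = mdist x y.
Hypothesis sep : forall x, exists2 e : R, 0 < e & forall z, e <= mdist (i x) (j z).
Variables (R1 : R) (R10 : 0 < R1).

Local Notation delta := (delta i j).
Local Notation vol := (vol mu i).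

Lemma cutoff_ge x : 1 - 2 / R1 * delta x <= cutoff i j R1 x.
Proof. by rewrite /cutoff le_max lexx orbT. Qed.

Local Notation cutoff := (cutoff i j R1).

Lemma cutoff_trace (v : Om -> R) (a t : R) z : 0 < t -> measurable_fun [set: Om] v ->
  ((mu (tball i (j z) t))^-1 * \int[mu]_(x in tball i (j z) t) `|cutoff x * v x - a|%:E <=
   (mu (tball i (j z) t))^-1 * \int[mu]_(x in tball i (j z) t) `|v x - a|%:E
   + (2 / R1 * t * `|a|)%:E)%E.
Proof.
move=> t0 mv; have R10' := R10; set T := tball i (j z) t.
have mT : measurable T by exact: measurable_tball.
have n0 : 0 < vol (j z) t by exact: (vol_gt0 isoi densi dbl).
have c0 : 0 <= 2 / R1 * t * `|a| by rewrite mulr_ge0// mulr_ge0 ?(ltW t0)// divr_ge0// ltW.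
rewrite (mu_tball isoi densi dbl)// inver gt_eqF//.
apply: (@le_trans _ _ ((vol (j z) t)^-1%:E *
   \int[mu]_(x in T) (`|v x - a|%:E + (2 / R1 * t * `|a|)%:E))%E).
  apply: lee_wpmul2l; first by rewrite lee_fin invr_ge0 ltW.
  apply: ge0_le_integral_outer => x; first by [].
  rewrite /T tballE => xz; rewrite -EFinD lee_fin.
  have /andP[h0 h1] := cutoff01 sep R10 x.
  have h2 : 1 - cutoff x <= 2 / R1 * t.
    apply: (@le_trans _ _ (2 / R1 * delta x)); first by have := cutoff_ge x; lra.
    rewrite ler_wpM2l// ?divr_ge0 ?(ltW R10)//.
    by apply: (le_trans (delta_le i j x z)); rewrite metric_sym ltW.
  rewrite (_ : _ - a = cutoff x * (v x - a) - (1 - cutoff x) * a); last by ring.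
  apply: (le_trans (ler_normB _ _)); rewrite !normrM (ger0_norm h0).
  rewrite (@ger0_norm _ (1 - cutoff x)); last by lra.
  by apply: lerD; [rewrite ler_piMl|rewrite ler_wpM2r].
rewrite ge0_integralD//; last first.
  apply/measurable_EFinP; apply: measurableT_comp => //.
  by apply: measurable_funTS; apply: measurable_funB => //; exact: measurable_cst.
rewrite integral_cst// (mu_tball isoi densi dbl)// ge0_muleDr ?integral_ge0//; last first.
  by rewrite -EFinM lee_fin mulr_ge0// ltW.
apply: leeD => //; rewrite -!EFinM lee_fin mulrCA mulVf ?mulr1//.
by rewrite gt_eqF.
Qed.

Context (nu : {measure set B -> \bar R}).
Hypothesis fin : forall z (r : R), 0 < r ->
  (0 < nu (ball z r))%E /\ (nu (ball z r) < +oo)%E.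
Context (theta Ct Rmax : R).
Hypothesis htheta : 0 < theta.
Hypothesis hCt : 1 <= Ct.
Hypothesis reg : forall z (r : R), 0 < r -> r <= Rmax ->
  (Ct^-1%:E * (mu (tball i (j z) r) / (r `^ theta)%:E) <= nu (ball z r))%E /\
  (nu (ball z r) <= Ct%:E * (mu (tball i (j z) r) / (r `^ theta)%:E))%E.
Local Notation nuv := (nuv nu).
Local Notation D := (Dbl Cmu).
Local Notation Av := (Av i j nu).
Local Notation locint := (locint nu).
Local Notation avg := (avg nu).

(** Jensen's inequality on the trace ball, then the local L^p bound for
    Av (f - f z); t^theta over the mu-measure of the trace ball is comparable
    to the inverse of the nu-measure of the boundary ball. *)
Lemma trace_pow (t p : R) f z : 0 < t -> 16 * t <= Rmax -> 1 <= p -> locint f ->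
  (((mu (tball i (j z) t))^-1 * \int[mu]_(x in tball i (j z) t) `|Av f x - f z|%:E) `^ p
    <= (KA Cmu theta Ct p * Ct / nuv z t)%:E *
       \int[nu]_(w in ball z (8 * t)%R) (`|f w - f z| `^ p)%:E)%E.
Proof.
move=> t0 tR p1 lf; have hCt' := hCt.
have p0 : 0 < p by lra.
have mT := measurable_tball isoi (j z) t.
have n0 : 0 < vol (j z) t by exact: (vol_gt0 isoi densi dbl).
have v0 : 0 < nuv z t by exact: nuv_gt0.
have lg : locint (fun w => f w - f z).
  have := locintD (-1) (locint_cst fin (f z)) lf.
  by rewrite (_ : (fun w => _) = (fun w => f w - f z))//; apply/funext => w; rewrite mulN1r addrC.
have mA : measurable_fun [set: Om] (Av f) by exact: (measurable_Av isoi isoj sep fin lf).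
have I0 : (0 <= \int[mu]_(x in tball i (j z) t) `|Av f x - f z|%:E)%E by exact: integral_ge0.
have EJ := mu_tball isoi densi dbl (j z) t0.
rewrite EJ inver gt_eqF// poweRM ?lee_fin ?invr_ge0 ?(ltW n0)//.
have J := @jensen_powR _ _ _ mu _ _ p (fun x => `|Av f x - f z|) mT EJ n0 p1 _ (fun x => normr_ge0 _).
have le2 := Av_Lp_local isoi densi dbl isoj sep fin htheta hCt reg z t0 tR p1 lg.
have subE x : Av (fun w => f w - f z) x = Av f x - f z by exact: (Av_subcst isoj sep fin).
rewrite (eq_integral _ _ (fun x _ => congr1 (fun y => (`|y| `^ p)%:E) (subE x))) in le2.
have V0 : (0 <= (vol (j z) t)^-1%:E `^ p)%E by exact: poweR_ge0.
apply: (le_trans (lee_wpmul2l V0 (J _))).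
  apply: measurableT_comp => //.
  by apply: measurable_funB => //; exact: measurable_cst.
rewrite poweR_EFin muleA -EFinM.
have -> : (vol (j z) t)^-1 `^ p * vol (j z) t `^ (p - 1) = (vol (j z) t)^-1.
  rewrite -powR_inv1 ?(ltW n0)// -powRrM mulN1r -powRD; last by rewrite (gt_eqF n0) implybT.
  by congr (_ `^ _); ring.
have tR' : t <= Rmax by apply: le_trans tR; lra.
have [h1 h2] := reg_real isoi densi dbl fin hCt reg z t0 tR'.
have tt0 : 0 < t `^ theta by exact: powR_gt0.
have V1 : (0 <= (vol (j z) t)^-1%:E)%E by rewrite lee_fin invr_ge0 ltW.
apply: (le_trans (lee_wpmul2l V1 le2)); rewrite muleA -EFinM.
apply: lee_wpmul2r; first by apply: integral_ge0 => w _; rewrite lee_fin powR_ge0.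
rewrite lee_fin; move: (KA_ge0 p htheta (Cmu_ge1 dbl) hCt); move: (KA _ _ _ _) => K K0.
rewrite mulrCA -!mulrA; apply: ler_wpM2l => //.
rewrite mulrC ler_pdivrMr// mulrAC ler_pdivlMr//.
have h3 : t `^ theta * (vol (j z) t / t `^ theta) = vol (j z) t.
  by rewrite mulrCA mulfV ?mulr1// gt_eqF.
have := ler_wpM2l (ltW tt0) h2.
by rewrite mulrCA h3.
Qed.

Definition KT p := KA Cmu theta Ct p * Ct * (2 `^ p * (Ct ^+ 2 * D ^+ 6)).

Lemma KT_ge0 p : 0 <= KT p.
Proof.
have Ct0 : 0 <= Ct by apply: le_trans hCt.
have D0 : 0 <= D by apply: le_trans (Dbl_ge1 dbl).
rewrite /KT; apply: mulr_ge0; first by apply: mulr_ge0 => //; exact: (KA_ge0 p htheta (Cmu_ge1 dbl) hCt).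
by apply: mulr_ge0; [exact: powR_ge0|apply: mulr_ge0; apply: exprn_ge0].
Qed.

(** The mean of |f - f z|^p about z is at most the deviation of f z from the mean
    c of f over a net ball, plus the mean deviation of f from c over that ball.
    With c fixed on the net ball, both are measurable in z, and have the same
    integral over the ball. *)
Lemma net_trace (rho p : R) f : 0 < rho -> 2 ^+ 5 * rho <= Rmax -> 1 <= p -> locint f ->
  exists g : B -> \bar R, [/\ measurable_fun [set: B] g, (forall z, (0 <= g z)%E),
    (\int[nu]_z g z <= (2 * KT p * CS Cmu Ct 4)%:E * besov_osc nu p (2 ^+ 5 * rho) f)%E &
    forall z t, rho / 2 <= t -> t <= rho ->
      (((mu (tball i (j z) t))^-1 * \int[mu]_(x in tball i (j z) t) `|Av f x - f z|%:E) `^ p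
        <= g z)%E].
Proof.
move=> rho0 rhoR p1 lf; have p0 : 0 < p by lra.
have rE : 2 ^+ 4 * rho = 16 * rho by rewrite -natrX.
have rhoR' : 32 * rho <= Rmax by move: rhoR; rewrite -natrX.
have [z [P netz]] := net_exists isoi densi dbl j rho0.
pose r := 2 ^+ 4 * rho; have r0 : 0 < r by rewrite /r rE; lra.
pose Bn n := netB j z P n r.
have mB n : measurable (Bn n) by exact: (measurable_netB isoj).
pose F n w := (`|f w - avg f (z n) r| `^ p)%:E.
have F0 n w : (0 <= F n w)%E by rewrite lee_fin powR_ge0.
have mF n : measurable_fun [set: B] (F n).
  by apply: measurable_norm_powR; apply: measurable_funB; [exact: lf.1|exact: measurable_cst].
pose I n := (\int[nu]_(w in Bn n) F n w)%E.
have I0 n : (0 <= I n)%E by exact: integral_ge0.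
have nn0 n : 0 < nuv (z n) r by exact: nuv_gt0.
pose J n := ((nuv (z n) r)^-1%:E * I n)%E.
have J0 n : (0 <= J n)%E by rewrite mule_ge0// lee_fin invr_ge0 ltW.
pose G n := (fun w => F n w + J n)%E \_ (Bn n).
have G0 n w : (0 <= G n w)%E by apply: erestrict_ge0 => x _; exact: adde_ge0.
have mG n : measurable_fun [set: B] (G n).
  apply/(measurable_restrictT _ (mB n)); apply: emeasurable_funD; last exact: measurable_cst.
  exact: measurable_funTS.
have K0 := KT_ge0 p.
exists (fun w => (KT p)%:E * \sum_(n <oo) G n w)%E; split.
- by apply: measurable_funeM; apply: ge0_emeasurable_sum => // n.
- by move=> w; rewrite mule_ge0// nneseries_ge0.
- have IG n : (\int[nu]_w G n w <= 2%:E * I n)%E.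
    rewrite -integral_mkcond ge0_integralD//; last exact: measurable_funTS.
    rewrite integral_cst// -/(I n) (_ : 2%:E = 1 + 1 :> \bar R)%E// ge0_muleDl// mul1e.
    apply: leeD => //; have [Pn|nP] := pselect (P n).
      rewrite /Bn netBE// (nuE fin)// /J muleAC -EFinM mulVf ?gt_eqF// mul1e.
      exact: lexx.
    by rewrite /Bn (netB0 j z r nP) measure0 mule0.
  rewrite ge0_integralZl//; last 2 first.
    by apply: ge0_emeasurable_sum => // n.
    by move=> w _; apply: nneseries_ge0.
  rewrite integral_nneseries//.
  have SI : (\sum_(n <oo) \int[nu]_w G n w <= 2%:E * \sum_(n <oo) I n)%E.
    rewrite -nneseriesZl//; apply: lee_nneseries => n _ *; [exact: integral_ge0|exact: IG].
  have dev := net_dev_le isoi densi dbl isoj fin htheta hCt reg rho0 p1 rhoR netz lf (m := 4).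
  apply: (@le_trans _ _ ((KT p)%:E * (2%:E * ((CS Cmu Ct 4)%:E * besov_osc nu p (2 ^+ 5 * rho) f)))%E).
    apply: lee_wpmul2l => //; apply: (le_trans SI); exact: lee_wpmul2l.
  by rewrite !muleA -!EFinM (mulrC (KT p)).
- move=> w t t1 t2; have t0 : 0 < t by lra.
  have [n Pn wn] := netz.2 w.
  apply: (le_trans (trace_pow w t0 _ p1 lf)); first by lra.
  apply: (@le_trans _ _ ((KT p)%:E * G n w)%E); last first.
    apply: lee_wpmul2l => //; exact: nneseries_ge_term.
  have Bw : Bn n w.
    by split => //; rewrite metric_sym; apply: (lt_le_trans wn); rewrite /r rE; lra.
  have Ct0 : 0 <= Ct by apply: le_trans hCt.
  have K1 : 0 <= KA Cmu theta Ct p * Ct.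
    by apply: mulr_ge0 => //; exact: (KA_ge0 p htheta (Cmu_ge1 dbl) hCt).
  have vt0 : 0 < nuv w t by exact: nuv_gt0.
  rewrite /G patchE mem_set// /KT.
  move: (KA _ _ _ _ * Ct) K1 => K K1.
  have le1 : (\int[nu]_(y in ball w (8 * t)%R) (`|f y - f w| `^ p)%:E <=
      (2 `^ p)%:E * (nuv (z n) r)%:E * (F n w + J n))%E.
    have mf2 : measurable_fun [set: B] (fun y => (`|f y - f w| `^ p)%:E).
      by apply: measurable_norm_powR; apply: measurable_funB; [exact: lf.1|exact: measurable_cst].
    apply: (@le_trans _ _ (\int[nu]_(y in Bn n) ((2 `^ p)%:E * (F n y + F n w)))%E).
      apply: (@le_trans _ _ (\int[nu]_(y in Bn n) (`|f y - f w| `^ p)%:E)%E).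
        apply: ge0_subset_integral => //.
        - exact: measurable_bball.
        - exact: measurable_funTS.
        - move=> y; rewrite ballEmdist/= -isoj => wy; split => //.
          apply: le_lt_trans (metric_triangle _ (j w) _) _.
          by rewrite metric_sym /r rE; lra.
      apply: ge0_le_integral_outer => y _; first by rewrite lee_fin powR_ge0.
      by have := powR_distD (f y) (f w) (avg f (z n) r) (ltW p0); rewrite -lee_fin.
    rewrite ge0_integralZl_EFin ?powR_ge0//; last 2 first.
      by move=> y _; exact: adde_ge0.
      by apply: emeasurable_funD; [exact: measurable_funTS|exact: measurable_cst].
    rewrite -muleA; apply: lee_wpmul2l; first by rewrite lee_fin powR_ge0.
    rewrite ge0_integralD//; last exact: measurable_funTS.
    rewrite integral_cst// -/(I n) /Bn netBE// (nuE fin)// ge0_muleDr// addeC.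
    apply: leeD; first by rewrite muleC.
    by rewrite /J muleA -EFinM mulfV ?gt_eqF// mul1e.
  have V1 : (0 <= (K / nuv w t)%:E)%E by rewrite lee_fin divr_ge0// ltW.
  apply: (le_trans (lee_wpmul2l V1 le1)); rewrite muleA -!EFinM.
  apply: lee_wpmul2r; first exact: adde_ge0.
  rewrite lee_fin -!mulrA; apply: ler_wpM2l => //; rewrite mulrCA; apply: ler_wpM2l; first exact: powR_ge0.
  rewrite ler_pdivrMl// [leRHS]mulrC (_ : Ct * _ = Ct ^+ 2 * D ^+ 6); last by rewrite expr2 mulrA.
  apply: (nuv_cmp isoi densi dbl fin htheta hCt reg) => //; rewrite ?/r ?rE; try lra.
Qed.

End trace.

Section Ext_trace.
Context (R : realType) (alpha p theta : R) (q : \bar R) (Cmu Ct R1 : R).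
Hypothesis alpha0 : 0 < alpha.
Hypothesis p1 : 1 <= p.
Hypothesis q1 : (1 <= q)%E.
Hypothesis theta0 : 0 < theta.
Hypothesis Ct1 : 1 <= Ct.
Hypothesis R10 : 0 < R1.

(** Membership in a Besov space with alpha > 0 makes the oscillations of f at
    the scales 2 ^+ 5 * R1 / 2 ^+ k decay like 2^(- alpha p k), so the majorants
    of net_trace have summable integrals. *)
Theorem Ext_trace dO (Om : borelMetricType R dO) (mu : {measure set Om -> \bar R})
    (Y : metricType R) (i : Om -> Y) dB (B : borelMetricType R dB) (j : B -> Y)
    (nu : {measure set B -> \bar R}) (f : B -> R) :
  trace_setting Cmu theta Ct (2 ^+ 10 * R1) mu i j nu -> Besov nu alpha p q f ->
  {ae nu, forall z, ((mu (tball i (j z) r))^-1 *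
    \int[mu]_(x in tball i (j z) r) `|Ext i j nu R1 f x - f z|%:E)%E @[r --> 0^'+] --> 0%E}.
Proof.
move=> S Bf; have p0 : 0 < p by have := p1; lra.
have R10' := R10.
have [lf _ HBf] := Besov_locint p1 S Bf.
have [isoi densi dbl isoj sep fin reg] := S.
pose r0 := 2 ^+ 5 * R1; have r00 : 0 < r0 by rewrite mulr_gt0// exprn_gt0.
have Cd1 : 1 <= Ct ^+ 2 * Dbl Cmu.
  have := exprn_ege1 2 Ct1; have := Dbl_ge1 dbl; nra.
have [C1 C10 low] := HBnorm_lower p1 q1 alpha0 r00 Cd1.
pose tau k := R1 / 2 ^+ k.
have tau0 k : 0 < tau k by rewrite divr_gt0// exprn_gt0.
have rm0 m : 0 < r0 / 2 ^+ m by rewrite divr_gt0// exprn_gt0.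
have pow2_ge1 m : 1 <= 2 ^+ m :> R by rewrite exprn_ege1// ler1n.
have rmR m : 2 * (r0 / 2 ^+ m) <= 2 ^+ 10 * R1.
  rewrite (_ : 2 * _ = 2 ^+ 6 * R1 / 2 ^+ m); last by rewrite /r0; ring.
  apply: (@le_trans _ _ (2 ^+ 6 * R1)).
    by rewrite ler_pdivrMr ?exprn_gt0// ler_peMr// mulr_ge0 ?exprn_ge0// ltW.
  by rewrite ler_wpM2r ?(ltW R10')// ler_eXn2l// ltr1n.
have osc0 t : (0 <= besov_osc nu p t f)%E.
  by rewrite besov_oscE integral_ge0// => z _; exact: oscf_ge0.
have [a aE la] := low _ _ nu f (fun m => besov_osc nu p (r0 / 2 ^+ m) f)
   (fun m => osc0 _) (fun m t t1 t2 =>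
   osc_cmp theta0 Ct1 p f S (rm0 m) (rmR m) t1 t2) HBf.
have a0 m : 0 <= a m by have [] := aE m.
set X := C1 * _ in la.
have X0 : 0 <= X by rewrite /X mulr_ge0// fine_ge0// HBnorm_ge0.
have x0 m : 0 <= (r0 / 2 ^+ m) `^ (- (alpha * p)) * a m by rewrite mulr_ge0 ?powR_ge0.
have ap0 : 0 < alpha * p by rewrite mulr_gt0.
pose x2 := 2 `^ (- (alpha * p)).
have x20 : 0 < x2 by exact: powR_gt0.
have x21 : x2 < 1 by exact: powR2N_lt1.
have aX m : a m <= x2 ^+ m * (X `^ p * r0 `^ (alpha * p)).
  have := lqb_term m p0 q1 X0 x0 la.
  rewrite powRN ler_pdivrMl ?powR_gt0// => /le_trans; apply.
  rewrite powRM ?invr_ge0 ?exprn_ge0 ?(ltW r00)// le_eqVlt; apply/orP; left; apply/eqP.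
  have -> : (2 ^- m) `^ (alpha * p) = x2 ^+ m.
    rewrite /x2 -powR_mulrn ?powR_ge0// -powRrM -powR_invn// -powRrM.
    by congr (_ `^ _); ring.
  by ring.
have tauE m : 2 ^+ 5 * tau m = r0 / 2 ^+ m by rewrite /tau /r0 mulrA.
have tauR m : 2 ^+ 5 * tau m <= 2 ^+ 10 * R1.
  by rewrite tauE; apply: le_trans (rmR m); have := rm0 m; lra.
have /choice[g hg] : forall k, exists g : B -> \bar R, _ :=
  fun k => net_trace isoi densi dbl isoj sep fin theta0 Ct1 reg (tau0 k) (tauR k) p1 lf.
have mg k : measurable_fun [set: B] (g k) by have [] := hg k.
have g0 k z : (0 <= g k z)%E by have [_ + _ _] := hg k.
pose K := 2 * KT Cmu theta Ct p * CS Cmu Ct 4.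
have K0 : 0 <= K.
  have Ct0 : 0 <= Ct by apply: le_trans Ct1.
  have D0 : 0 <= Dbl Cmu by apply: le_trans (Dbl_ge1 dbl).
  rewrite /K; apply: mulr_ge0; first by apply: mulr_ge0 => //; exact: (KT_ge0 dbl theta0 Ct1).
  by rewrite /CS; apply: mulr_ge0; apply: exprn_ge0.
have sumg : (\sum_(k <oo) \int[nu]_z g k z < +oo)%E.
  pose A := (K * (X `^ p * r0 `^ (alpha * p)))%:E.
  have A0 : (0 <= A)%E by rewrite lee_fin mulr_ge0// mulr_ge0 ?powR_ge0.
  apply: (@le_lt_trans _ _ (\sum_(k <oo) ((x2 ^+ k)%:E * A))%E); last first.
    by apply: (le_lt_trans (nneseries_geometric_le (ltW x20) x21 A0)); rewrite -EFinM ltry.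
  apply: lee_nneseries => k _ *; first by exact: integral_ge0.
  have [_ _ h _] := hg k; apply: (le_trans h).
  have [_ e] := aE k; rewrite tauE e -!EFinM lee_fin.
  apply: (le_trans (ler_wpM2l K0 (aX k))).
  by rewrite le_eqVlt mulrCA eqxx.
have := ae_term_cvg0 mg g0 sumg; apply: filterS => z hz.
apply: cvge0_near.
  by near=> r; rewrite mule_ge0 ?inve_ge0// integral_ge0.
move=> e e0.
have e2p : 0 < (e / 2) `^ p by rewrite powR_gt0// divr_gt0.
have [N hN] := hz _ e2p.
have e2 : 0 < e / 2 by rewrite divr_gt0.
have c0 : 0 < 2 / R1 * (`|f z| + 1).
  by apply: mulr_gt0; [exact: divr_gt0|rewrite ltr_wpDl].
near=> r; have r0' : 0 < r by near: r; exact: nbhs_right_gt.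
have mA : measurable_fun [set: Om] (Av i j nu f) by exact: (measurable_Av isoi isoj sep fin lf).
apply: (le_trans (cutoff_trace isoi densi dbl sep R10 (f z) z r0' mA)).
have -> : e%:E = ((e / 2)%:E + (e / 2)%:E)%E by rewrite -EFinD -splitr.
apply: leeD.
  have rN : r < tau N by near: r; exact: nbhs_right_lt.
  have [k [k1 k2]] := dyadic_layer r0' rN.
  have tE : tau N / 2 ^+ k = tau (N + k)%N by rewrite /tau exprD invfM mulrA.
  rewrite tE in k1 k2.
  have [_ _ _ h] := hg (N + k)%N.
  have := le_trans (h z r k1 (ltW k2)) (hN _ (leq_addr k N)).
  set u := (_ * _)%E => hu.
  have u0 : (0 <= u)%E by rewrite mule_ge0 ?inve_ge0// integral_ge0.
  have pi0 : 0 <= p^-1 by rewrite invr_ge0 ltW.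
  have := lee_poweR pi0 (poweR_ge0 _ _) hu.
  rewrite -poweRrM mulfV ?gt_eqF// poweRe1// poweR_EFin -powRrM mulfV ?gt_eqF// powRr1//.
  by rewrite divr_ge0// ltW.
rewrite lee_fin.
have rc : r < e / 2 / (2 / R1 * (`|f z| + 1)).
  by near: r; apply: nbhs_right_lt; exact: (divr_gt0 e2 c0).
rewrite ltr_pdivlMr// in rc; apply: le_trans (ltW rc).
rewrite (_ : 2 / R1 * r * `|f z| = r * (2 / R1 * `|f z|)); last by ring.
rewrite ler_wpM2l ?(ltW r0')// ler_wpM2l ?divr_ge0 ?(ltW R10')// lerDl ler01.
Unshelve. all: by end_near. Qed.

End Ext_trace.

(** * The boundary in the completion *)

Section completion_geometry.
Context (R : realType) (X : metricType R) (c : completion X).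

Lemma metric_hausdorff (Y : metricType R) : hausdorff_space Y.
Proof.
rewrite ball_hausdorff => a b ab.
have d0 : 0 < mdist a b / 2 by rewrite divr_gt0// mdist_gt0.
exists (PosNum d0, PosNum d0) => /=; apply/eqP/seteqP; split => // z [].
rewrite !ballEmdist/= => az bz.
by have := metric_triangle a z b; rewrite (metric_sym z b); lra.
Qed.

Lemma cembed_approx y (e : R) : 0 < e -> exists x, mdist y (cembed c x) < e.
Proof.
move=> e0; have : closure (range (cembed c)) y by rewrite cembed_dense.
move=> /(_ (ball y e)); case; first by rewrite -nbhs_ballE; exists e.
by move=> _ [[x _ <-]]; rewrite ballEmdist/=; exists x.
Qed.

Lemma cembed_continuous : continuous (cembed c).
Proof.
move=> x; apply/cvg_ballP => e e0; near=> y.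
rewrite ballEmdist/= cembed_isometry; near: y.
by apply/nbhs_ballP; exists e => // y; rewrite ballEmdist.
Unshelve. all: by end_near. Qed.

(** A compact neighbourhood of x stays compact, hence closed, in the completion.
    A boundary point close to x would be a limit of points of this
    neighbourhood, and so would lie in Om. *)
Lemma boundary_separated (ncX : ~ complete_space X) : locally_compact [set: X] ->
  forall x, exists2 e : R, 0 < e &
    forall z : boundary c ncX, e <= mdist (cembed c x) (boundary_val z).
Proof.
move=> lcX x; have := lcX x I; rewrite withinET => -[K xK [cK _]].
have cK' : closed (cembed c @` K).
  apply: (compact_closed (@metric_hausdorff _)); apply: continuous_compact => //.
  by apply: continuous_subspaceT; exact: cembed_continuous.
move/nbhs_ballP : xK => [r /= r0 rK].
exists (r / 2); first by rewrite divr_gt0.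
move=> z; rewrite leNgt; apply/negP => xz.
have zK : (cembed c @` K) (boundary_val z).
  apply: cK' => U /nbhs_ballP[e /= e0 eU].
  have m0 : 0 < Num.min e (r / 2) by rewrite lt_min e0 divr_gt0.
  have [y] := cembed_approx (boundary_val z) m0.
  rewrite lt_min => /andP[ye yr]; exists (cembed c y); split.
    exists y => //; apply: rK; rewrite ballEmdist/= -(cembed_isometry c).
    by apply: (le_lt_trans (metric_triangle _ (boundary_val z) _)); lra.
  by apply: eU; rewrite ballEmdist.
have := set_valP z; apply; case: zK => y _ yz; exists y => //.
Qed.

End completion_geometry.

(** * Boundaries with one point *)

Section one_point.
Context (R : realType) (s p : R) (q : \bar R).
Hypothesis s0 : 0 < s.
Hypothesis s1 : s < 1.
Hypothesis p1 : 1 <= p.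
Hypothesis q1 : (1 <= q)%E.
Context (dO : measure_display) (Om : borelMetricType R dO)
  (mu : {measure set Om -> \bar R}) (Y : metricType R) (i : Om -> Y)
  (Cmu : R).
Hypothesis isoi : forall x y, mdist (i x) (i y) = mdist x y.
Hypothesis densi : forall y (e : R), 0 < e -> exists x, mdist y (i x) < e.
Hypothesis dbl : doubling_with mu Cmu.
Context (dB : measure_display) (B : borelMetricType R dB) (j : B -> Y).
Hypothesis isoj : forall x y, mdist (j x) (j y) = mdist x y.
Hypothesis sep : forall x, exists2 e : R, 0 < e & forall z, e <= mdist (i x) (j z).
Context (nu : {measure set B -> \bar R}).
Hypothesis fin : forall z (r : R), 0 < r ->
  (0 < nu (ball z r))%E /\ (nu (ball z r) < +oo)%E.
Hypothesis one : forall w z : B, w = z.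

Local Notation delta := (delta i j).
Local Notation Av := (Av i j nu).
Local Notation u := (Ext i j nu 1).

Let p0 : 0 < p. Proof. by have := p1; lra. Qed.
Let z0 : B := point.
Let m := nuv nu z0 1.
Let m0 : 0 < m. Proof. exact: nuv_gt0. Qed.
Let V r := vol mu i (j z0) r / m.
Let V0 r : 0 < r -> 0 < V r.
Proof. by move=> r0; rewrite divr_gt0// (vol_gt0 isoi densi dbl). Qed.

Lemma one_cst (f : B -> R) : f = cst (f z0) :> (B -> R).
Proof. by apply/funext => z; rewrite (one z z0). Qed.

Lemma one_locint (f : B -> R) : locint nu f.
Proof. by rewrite (one_cst f); exact: (locint_cst fin). Qed.

Lemma one_Av (f : B -> R) x : Av f x = f z0.
Proof. by rewrite {1}(one_cst f) (Av_cst isoj sep fin). Qed.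

Lemma one_Lp (f : B -> R) : (\int[nu]_z (`|f z| `^ p)%:E = (`|f z0| `^ p * m)%:E)%E.
Proof.
have ballT : ball z0 (1 : R) = [set: B].
  by apply/seteqP; split => // z _; rewrite (one z z0); exact: ballxx.
rewrite (eq_integral (cst (`|f z0| `^ p)%:E)); last by move=> z _; rewrite (one z z0).
by rewrite integral_cst// -ballT (nuE fin z0 ltr01) -EFinM.
Qed.

Lemma one_outer (f : B -> R) (r : R) : 0 < r -> outer_le mu [set x | delta x < r]
  (fun x => (`|Av f x| `^ p)%:E) (V r * (`|f z0| `^ p * m))%:E.
Proof.
move=> r0; have mT := measurable_tball isoi (j z0) r.
have hE : (\int[mu]_(x in tball i (j z0) r) (`|f z0| `^ p)%:E <= (V r * (`|f z0| `^ p * m))%:E)%E.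
  rewrite integral_cst// (mu_tball isoi densi dbl)// -EFinM lee_fin le_eqVlt.
  by apply/orP; left; apply/eqP; rewrite /V; field; rewrite gt_eqF.
apply: (outer_le_sub _ _ (lexx _) (outer_le_integral mT _ _ hE)).
- by move=> x /= /delta_lt[z xz]; rewrite tballE (one z0 z) metric_sym.
- by move=> x _; rewrite one_Av.
- exact: measurable_cst.
- by move=> x _; rewrite lee_fin powR_ge0.
Qed.

(** The average of a constant is that constant, so the extension of f is
    f z0 times the cutoff with R1 = 1, and oscillates through the cutoff only.
    This is the recursion of the general case without the terms from f. Here
    the constant depends on the measure of the point. *)
Lemma Ext_Besov_point : exists2 C : R, 1 <= C & forall f : B -> R,
  [/\ Besov mu s p q (u f),
    ('N[mu]_p%:E [EFin \o u f] <= C%:E * 'N[nu]_p%:E [EFin \o f])%E &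
    (HBnorm mu s p q (u f) <= C%:E * 'N[nu]_p%:E [EFin \o f])%E].
Proof.
have p0' := p0; have s0' := s0; have s1' := s1.
have pn0 : p != 0 by rewrite gt_eqF.
pose lam := 2 `^ (s * p - p).
have lam0 : 0 < lam by exact: powR_gt0.
have lam1 : lam < 1.
  rewrite /lam (_ : s * p - p = - ((1 - s) * p)); last by ring.
  by apply: powR2N_lt1; rewrite mulr_gt0//; lra.
have [C2 C20 rec] := lqb_rec p1 q1 lam0 lam1.
have [C3 C30 up] := HBnorm_upper p1 q1 s0 (@ltr01 R).
pose kM := 2 `^ p * (2 `^ p * V 8).
have kM0 : 0 <= kM by rewrite /kM mulr_ge0 ?powR_ge0// mulr_ge0 ?powR_ge0// ltW// V0.
pose k4 := KN Cmu p * Dbl Cmu ^+ 7 * V 1.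
have D0 n : 0 <= Dbl Cmu ^+ n by rewrite exprn_ge0// (le_trans ler01)// (Dbl_ge1 dbl).
have KN0 : 0 <= KN Cmu p by rewrite /KN mulr_ge0 ?powR_ge0// addr_ge0.
have V10 : 0 <= V 1 by rewrite ltW// V0.
have k40 : 0 <= k4 by rewrite /k4; apply: mulr_ge0 => //; exact: mulr_ge0.
pose C4 := C3 * (C2 * kM `^ p^-1 + k4 `^ p^-1).
have C40 : 0 <= C4 by rewrite /C4 mulr_ge0// addr_ge0 ?powR_ge0// mulr_ge0 ?powR_ge0.
exists (1 + (V 1) `^ p^-1 + C4); first by have := powR_ge0 (V 1) p^-1; lra.
move=> f; pose N := `|f z0| `^ p * m.
have N0 : 0 <= N by rewrite mulr_ge0 ?powR_ge0// ltW.
have lf := one_locint f.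
have NE := one_Lp f; rewrite -/N in NE.
have nfE : ('N[nu]_p%:E [EFin \o f] = (N `^ p^-1)%:E)%E by rewrite Lnorm_powE NE poweR_EFin.
have muf : measurable_fun [set: Om] (u f) by exact: (measurable_Ext isoi isoj sep fin ltr01 lf).
have Lp : (\int[mu]_x (`|u f x| `^ p)%:E <= (V 1 * N)%:E)%E.
  by apply: (Ext_Lp sep ltr01 p0); exact: one_outer.
have Lpu : (\int[mu]_x (`|u f x| `^ p)%:E < +oo)%E by apply: (le_lt_trans Lp); rewrite ltry.
have Nu : ('N[mu]_p%:E [EFin \o u f] <= ((V 1) `^ p^-1 * N `^ p^-1)%:E)%E.
  rewrite Lnorm_powE -powRM// -poweR_EFin; apply: lee_poweR => //.
    by rewrite invr_ge0 ltW.
  by apply: integral_ge0 => x _; rewrite lee_fin powR_ge0.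
pose tau k : R := 1 / 2 ^+ k.
have tau0 k : 0 < tau k by rewrite divr_gt0// exprn_gt0.
pose b k := lam ^+ k * (kM * N).
have kMN : 0 <= kM * N by exact: mulr_ge0.
have b0 k : 0 <= b k by rewrite mulr_ge0// exprn_ge0// ltW.
have lb : lqb p q b (C2 * (0 + (kM * N) `^ p^-1)).
  apply: (rec (fun _ => 0) b (kM * N) 0) => //.
  - by rewrite /b expr0 mul1r add0r.
  - by move=> k; rewrite add0r /b exprS -(mulrA lam) lexx.
  - have pi0 : p^-1 != 0 by rewrite invr_eq0.
    move: q1; case: (q) => [r|_|//] => [|k]; last by rewrite powR0.
    rewrite lee_fin => r1 n; have r0 : r != 0 by rewrite gt_eqF//; lra.
    rewrite big1 ?powR_ge0// => k _; rewrite powR0// mulf_neq0//.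
have tauE k : tau k `^ p = tau k `^ (s * p) * lam ^+ k.
  have -> : lam ^+ k = tau k `^ (p - s * p).
    rewrite /lam /tau div1r -powR_mulrn ?powR_ge0// -powRrM -powR_invn// -powRrM.
    by congr (_ `^ _); ring.
  rewrite -powRD; last by rewrite (gt_eqF (tau0 k)) implybT.
  by rewrite addrC subrK.
have small k t : tau k / 2 <= t -> t <= tau k ->
    (besov_osc mu p t (u f) <= (tau k `^ (s * p) * b k)%:E)%E.
  move=> t1 t2; have t0 : 0 < t by apply: lt_le_trans t1; rewrite divr_gt0// tau0.
  have oscA : outer_le mu [set x | delta x < 1 \/ delta x < 8 * tau k] (oscf mu p t (Av f)) 0.
    exists (cst 0%E); split => //; last by rewrite integral0.
    move=> x _; rewrite /oscf integral0_eq ?mule0// => y _.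
    by rewrite !one_Av subrr normr0 powR0.
  have LA : outer_le mu [set x | delta x < 1 \/ delta x < 8 * tau k]
      (fun x => (`|Av f x| `^ p)%:E) (V 8 * N)%:E.
    apply: outer_le_sub (one_outer f (_ : 0 < 8)) => // x /=.
    have tR : tau k <= 1 by rewrite ler_pdivrMr ?exprn_gt0// mul1r exprn_ege1// ler1n.
    by case; lra.
  apply: (le_trans (Ext_osc isoi densi dbl isoj sep fin ltr01 p0 t0 t2 lf oscA LA)).
  rewrite add0e -!EFinM lee_fin.
  have -> : tau k `^ (s * p) * b k = tau k `^ p * (kM * N) by rewrite tauE /b mulrA.
  have hT : (2 / 1 * t) `^ p <= 2 `^ p * tau k `^ p.
    rewrite divr1 -powRM ?(ltW (tau0 k))//.
    by apply: powR_le; rewrite ?(ltW p0)// ?mulr_ge0 ?ler_wpM2l// ltW.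
  have Z0 : 0 <= V 8 * N by rewrite mulr_ge0// ltW// V0.
  have := ler_wpM2r Z0 (ler_wpM2l (powR_ge0 2 p) hT).
  by rewrite /kM; move: (V 8) => V8; lra.
have large t : 1 <= t -> (besov_osc mu p t (u f) <= (k4 * N)%:E)%E.
  move=> tR; apply: (le_trans (Ext_large isoi densi dbl isoj sep fin ltr01 p0 tR lf)).
  have c40 : (0 <= (KN Cmu p * Dbl Cmu ^+ 7)%:E)%E by rewrite lee_fin mulr_ge0.
  apply: (le_trans (lee_wpmul2l c40 Lp)).
  by rewrite -EFinM lee_fin /k4 -(mulrA (KN Cmu p * Dbl Cmu ^+ 7)).
have k4N : 0 <= k4 * N by rewrite mulr_ge0.
have X2 : 0 <= C2 * (0 + (kM * N) `^ p^-1) by rewrite mulr_ge0// addr_ge0 ?powR_ge0.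
have HBu := up _ _ mu (u f) b (k4 * N) _ b0 k4N X2 small large lb.
have Nf0 : 0 <= N `^ p^-1 by exact: powR_ge0.
have HBu' : (HBnorm mu s p q (u f) <= (C4 * N `^ p^-1)%:E)%E.
  apply: (le_trans HBu); rewrite lee_fin (powRM p^-1 kM0 N0) (powRM p^-1 k40 N0).
  by rewrite add0r /C4 le_eqVlt; apply/orP; left; apply/eqP; ring.
split.
- split; [split|] => //.
  + exact: (Ext_L1loc isoi densi dbl isoj sep fin ltr01 p1 lf).
  + exact: le_lt_trans HBu' (ltry _).
  + by rewrite /=; apply/(Lfun_powP mu (u f) pn0).
- apply: (le_trans Nu); rewrite nfE -EFinM lee_fin ler_wpM2r//.
  by have := powR_ge0 (V 1) p^-1; lra.
- apply: (le_trans HBu'); rewrite nfE -EFinM lee_fin ler_wpM2r//.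
  by have := powR_ge0 (V 1) p^-1; lra.
Qed.

Lemma Ext_trace_point (f : B -> R) (z : B) :
  ((mu (tball i (j z) r))^-1 *
    \int[mu]_(x in tball i (j z) r) `|u f x - f z|%:E)%E @[r --> 0^'+] --> 0%E.
Proof.
apply: cvge0_near.
  by near=> r; rewrite mule_ge0 ?inve_ge0// integral_ge0.
move=> e e0.
have c0 : 0 < 2 * (`|f z| + 1) by apply: mulr_gt0 => //; rewrite ltr_wpDl.
near=> r; have r0 : 0 < r by near: r; exact: nbhs_right_gt.
have mA : measurable_fun [set: Om] (Av f) by exact: (measurable_Av isoi isoj sep fin (one_locint f)).
apply: (le_trans (cutoff_trace isoi densi dbl sep ltr01 (f z) z r0 mA)).
rewrite integral0_eq ?mule0 ?add0e; last first.
  by move=> x _; rewrite one_Av (one z z0) subrr normr0.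
have rc : r < e / (2 * (`|f z| + 1)).
  by near: r; apply: nbhs_right_lt; exact: (divr_gt0 e0 c0).
rewrite lee_fin divr1; rewrite ltr_pdivlMr// in rc; apply: le_trans (ltW rc).
rewrite (_ : 2 * r * `|f z| = r * (2 * `|f z|)); last by ring.
by rewrite ler_wpM2l ?(ltW r0)// ler_wpM2l// lerDl ler01.
Unshelve. all: by end_near. Qed.

End one_point.

(** * Measures of boundary balls *)

Lemma Besov_zero (R : realType) (s p : R) (q : \bar R) d (T : borelMetricType R d)
    (mu : {measure set T -> \bar R}) : 0 < s -> 1 <= p -> (1 <= q)%E ->
  [/\ Besov mu s p q (cst 0), ('N[mu]_p%:E [EFin \o (cst 0%R : T -> R)] = 0)%E &
    HBnorm mu s p q (cst 0%R) = 0%E].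
Proof.
move=> s0 p1 q1; have p0 : p != 0 by rewrite gt_eqF//; lra.
have pi0 : p^-1 != 0 by rewrite invr_eq0.
have c00 : `|0 : R| `^ p = 0 by rewrite normr0 powR0.
have I0 : (\int[mu]_x (`|(cst 0 : T -> R) x| `^ p)%:E = 0)%E.
  by rewrite integral0_eq// => x _; rewrite c00.
have osc0 t : besov_osc mu p t (cst 0%R) = 0%E.
  rewrite besov_oscE integral0_eq// => x _; rewrite /oscf integral0_eq ?mule0// => y _.
  by rewrite subrr c00.
have HB0 : HBnorm mu s p q (cst 0%R) = 0%E.
  have [C3 C30 up] := HBnorm_upper p1 q1 s0 (@ltr01 R).
  apply/eqP; rewrite eq_le HBnorm_ge0 andbT.
  apply: (le_trans (up _ _ mu (cst 0) (fun _ => 0) 0 0 _ _ _ _ _ _)) => //.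
  - by move=> k t _ _; rewrite osc0 mulr0.
  - by move=> t _; rewrite osc0.
  - move: q1; case: (q) => [r|_|//] => [|k]; last by rewrite powR0.
    rewrite lee_fin => r1 n; have r0 : r != 0 by rewrite gt_eqF//; lra.
    by rewrite big1 ?powR_ge0// => k _; rewrite powR0// mulf_neq0.
  - by rewrite powR0// addr0 mulr0.
split => //; last by rewrite Lnorm_powE I0 poweR0r.
split; first split; first split.
- exact: measurable_cst.
- by move=> x; exists 1 => //; exact: integrable0.
- by rewrite /= HB0.
- by apply/(Lfun_powP mu _ p0); split; [exact: measurable_cst|rewrite I0].
Qed.

Section boundary_measure.
Context (R : realType) (d : measure_display) (Om : borelMetricType R d)
  (mu : {measure set Om -> \bar R}) (ncOm : ~ complete_space Om)
  (c : completion Om) (Cmu theta Ct : R).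
Local Notation bOm := (boundary c ncOm).
Context (nu : {measure set bOm -> \bar R}).
Hypothesis dbl : doubling_with mu Cmu.
Hypothesis reg : codim_regular_with mu nu theta Ct.

Lemma mdist_le_diam (z w : bOm) : ((mdist z w)%:E <= diam bOm)%E.
Proof. by apply: ereal_sup_ubound; exists (z, w). Qed.

Let ball_fin (z : bOm) (r : R) : 0 < r -> (r%:E <= 2%:E * diam bOm)%E ->
  (0 < nu (ball z r))%E /\ (nu (ball z r) < +oo)%E.
Proof.
move=> r0 rd; have [Ct1 /(_ z r r0 rd)[]] := reg.
have Ct0 : 0 < Ct by exact: lt_le_trans ltr01 Ct1.
have tE : trace_ball z r = tball (cembed c) (boundary_val z) r by [].
have dens := @cembed_approx _ _ c.
rewrite tE (mu_tball (cembed_isometry c) dens dbl)//.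
have v0 := vol_gt0 (cembed_isometry c) dens dbl (boundary_val z) r0.
rewrite inver gt_eqF ?powR_gt0// -!EFinM => h1 h2; split.
  by apply: lt_le_trans h1; rewrite lte_fin mulr_gt0 ?invr_gt0// divr_gt0// powR_gt0.
by apply: le_lt_trans h2 _; rewrite ltry.
Qed.

(** Regularity covers the radii up to twice the diameter; beyond, a ball is the
    whole boundary, which is also a ball of radius twice the diameter. *)
Lemma boundary_ball_fin (d0 : R) : 0 < d0 -> (d0%:E <= diam bOm)%E ->
  forall (z : bOm) (r : R), 0 < r -> (0 < nu (ball z r))%E /\ (nu (ball z r) < +oo)%E.
Proof.
move=> d00 d0d z r r0; have dd : (0 <= diam bOm)%E by apply: le_trans d0d; rewrite lee_fin ltW.
have d2 : (diam bOm <= 2%:E * diam bOm)%E.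
  by rewrite -[leLHS]mul1e lee_wpmul2r// lee_fin ler1n.
have mb w s : measurable (ball w s : set bOm) by exact: measurable_bball.
split.
  have s0 : 0 < Num.min r d0 by rewrite lt_min r0.
  have [|h _] := ball_fin z s0.
    by apply: (le_trans _ (le_trans d0d d2)); rewrite lee_fin ge_min lexx orbT.
  apply: (lt_le_trans h); apply: le_measure; rewrite ?inE//.
  by apply: le_ball; rewrite ge_min lexx.
have [|rd] := leP r%:E (2%:E * diam bOm)%E; first by move=> /(ball_fin z r0)[].
have dfin : diam bOm \is a fin_num.
  by rewrite ge0_fin_numE//; apply: le_lt_trans d2 (lt_trans rd (ltry _)).
have DE : diam bOm = (fine (diam bOm))%:E by rewrite fineK.
set D := fine _ in DE.
have D0 : 0 < D by rewrite -lte_fin -DE; apply: lt_le_trans d0d; rewrite lte_fin.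
have D20 : 0 < 2 * D by rewrite mulr_gt0.
have [|_] := ball_fin z D20; first by rewrite DE -EFinM.
apply: le_lt_trans; apply: le_measure; rewrite ?inE//.
move=> w _; rewrite ballEmdist/=; have := mdist_le_diam z w; rewrite DE lee_fin; lra.
Qed.

Lemma boundary_one_point : (forall e : R, 0 < e -> ~ (e%:E <= diam bOm)%E) ->
  forall z w : bOm, z = w.
Proof.
move=> h z w; apply: contrapT => /eqP zw.
by apply: (h (mdist z w)); [rewrite mdist_gt0|exact: mdist_le_diam].
Qed.

End boundary_measure.

Lemma dyadic_small (R : realType) (a e : R) : 0 < e ->
  exists n, a * (1 / 2 ^+ n) <= e.
Proof.
move=> e0; exists (Num.bound (a / e)); rewrite mul1r ler_pdivrMr ?exprn_gt0//.
rewrite -ler_pdivrMl// mulrC.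
have [ae|ae] := ltP (a / e) 0.
  by apply: (le_trans (ltW ae)); exact: exprn_ge0.
apply: (le_trans (ltW (archi_boundP ae))).
by rewrite -natrX ler_nat ltnW// ltn_expl.
Qed.

Local Open Scope ereal_scope.

(** * Extension with a uniform constant *)

(* C is bounded by K delta, where K depends only on alpha, p, q, theta and the
   constants Cmu and Ctheta, as soon as the regularity of nu holds on a range of
   radii 0 < r <= 2 diam with diam >= delta; for an unbounded boundary, C is thus
   bounded by the constants alone. A dependence on this range is unavoidable:
   replacing d by h d and nu by h^(- theta) nu keeps Cmu and Ctheta, while the
   inequality between the HB norms scales like h^(- alpha) as h goes to 0. *)
Theorem theorem1p10 (R : realType) (alpha p theta : R) (q : \bar R)
    (Cmu Ctheta : R) (halpha : (0 < alpha < 1)%R) (hp : (1 <= p)%R)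
    (hq : 1 <= q) (htheta : (0 < theta)%R)
    (hsmooth : (alpha < 1 - theta / p)%R) :
  exists K : R -> R,
  forall (d : measure_display) (Om : borelMetricType R d)
    (mu : {measure set Om -> \bar R})
    (ncOm : ~ complete_space Om) (c : completion Om)
    (nu : {measure set (boundary c ncOm) -> \bar R}),
  locally_compact [set: Om] ->
  doubling_with mu Cmu ->
  codim_regular_with mu nu theta Ctheta ->
  exists (E : (boundary c ncOm -> R) -> (Om -> R)) (C : R),
  [/\ (1 <= C)%R,
      forall delta : R, (0 < delta)%R ->
        delta%:E <= diam (boundary c ncOm) -> (C <= K delta)%R,
      linear_on (Besov nu alpha p q) E,
      extension_on mu nu (Besov nu alpha p q) E &
      forall f, Besov nu alpha p q f ->
      [/\ Besov mu (alpha + theta / p)%R p q (E f),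
          'N[mu]_p%:E [EFin \o E f] <= C%:E * 'N[nu]_p%:E [EFin \o f] &
          HBnorm mu (alpha + theta / p)%R p q (E f)
            <= C%:E * (HBnorm nu alpha p q f + 'N[nu]_p%:E [EFin \o f])]].
Proof.
have /andP[alpha0 _] := halpha.
have p0 : (0 < p)%R by apply: lt_le_trans hp.
have pn0 : p != 0%R by rewrite gt_eqF.
have tp0 : (0 < theta / p)%R by rewrite divr_gt0.
have s0 : (0 < alpha + theta / p)%R by rewrite addr_gt0.
have s1 : (alpha + theta / p < 1)%R by move: hsmooth; lra.
have [Cmu1|Cmu1] := leP 1%R Cmu; last first.
  by exists (fun=> 0%R) => d Om mu ncOm c nu _ [/(lt_le_trans Cmu1)]; rewrite ltxx.
have [Ct1|Ct1] := leP 1%R Ctheta; last first.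
  by exists (fun=> 0%R) => d Om mu ncOm c nu _ _ [/(lt_le_trans Ct1)]; rewrite ltxx.
pose R1 n : R := (1 / 2 ^+ n)%R.
have R10 n : (0 < R1 n)%R by rewrite divr_gt0// exprn_gt0.
(* the collars have the heights 1 / 2 ^+ n, so that countably many constants
   cover all spaces *)
have /choice[C hC] : forall n, exists C : R, _ := fun n =>
  (Ext_Besov alpha0 hp hq htheta hsmooth Cmu1 Ct1 (R10 n)).
have /choice[N hN] (e : R) : exists n, (0 < e)%R -> (2 ^+ 10 * R1 n <= 2 * e)%R.
  have [e0|e0] := ltP 0%R e; last by exists 0%N.
  have e20 : (0 < 2 * e)%R by rewrite mulr_gt0.
  by have [n hn] := dyadic_small (2 ^+ 10) e20; exists n.
exists (fun e => \sum_(m < (N e).+1) C m)%R => d Om mu ncOm c nu lc dbl reg.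
pose B := boundary c ncOm; pose i := cembed c; pose j := @boundary_val _ _ c ncOm.
have isoi : forall x y, mdist (i x) (i y) = mdist x y := cembed_isometry c.
have densi : forall y (e : R), (0 < e)%R -> exists x, (mdist y (i x) < e)%R.
  by move=> y e; exact: cembed_approx.
have isoj (x y : B) : mdist (j x) (j y) = mdist x y by [].
have sep : forall x, exists2 e : R, (0 < e)%R & forall z : B, (e <= mdist (i x) (j z))%R.
  exact: boundary_separated.
have [[d0 d00 d0d]|nd] := pselect (exists2 d0 : R, (0 < d0)%R & d0%:E <= diam B); last first.
  have one : forall z w : B, z = w.
    by apply: boundary_one_point => e e0 ed; apply: nd; exists e.
  (* no delta is admissible, so that C may depend on the space *)
  have noK (e : R) : (0 < e)%R -> e%:E <= diam B -> False.
    by move=> e0 ed; apply: nd; exists e.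
  have allE (z : B) (r : R) : (0 < r)%R -> ball z r = [set: B].
    move=> r0; apply/seteqP; split => // w _; rewrite (one w z); exact: ballxx.
  have [nufin|nuinf] := pselect (0 < nu setT /\ nu setT < +oo).
    have fin (z : B) (r : R) : (0 < r)%R -> 0 < nu (ball z r) /\ nu (ball z r) < +oo.
      by move=> r0; rewrite allE.
    have [C0 C01 hC0] := Ext_Besov_point s0 s1 hp hq isoi densi dbl isoj sep fin one.
    exists (Ext i j nu 1%R), C0; split => //.
    - by move=> e e0 /(noK e e0).
    - by move=> a f g _ _; apply: (Ext_lin isoj sep); exact: (one_locint fin one).
    - move=> f _; apply: filterE => z; exact: (Ext_trace_point isoi densi dbl isoj sep fin one).
    - move=> f _; have [h1 h2 h3] := hC0 f; split => //; apply: (le_trans h3).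
      apply: lee_wpmul2l; first by rewrite lee_fin (le_trans ler01).
      by rewrite leeDr// HBnorm_ge0.
  (* the point has measure 0, or f vanishes there as it is in L^p *)
  have [B0 L0 H0] := Besov_zero mu s0 hp hq.
  exists (fun _ => cst 0%R), 1%R; split => //.
  - by move=> e e0 /(noK e e0).
  - by move=> a f g _ _; apply/funext => x /=; rewrite mulr0 addr0.
  - move=> f [_ /= Lf]; have [mf If] := (Lfun_powP nu f pn0).1 Lf.
    have [nu0|nu0] := eqVneq (nu setT) 0.
      by exists setT; split => //; exact: nu0.
    have nuy : nu setT = +oo.
      apply/eqP; rewrite -leye_eq leNgt; apply/negP => h; apply: nuinf; split => //.
      by rewrite lt0e nu0 measure_ge0.
    have f0 z : f z = 0%R.
      apply/eqP; rewrite -normr_eq0; apply/negP => /negP fz.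
      have fz0 : (0 < `|f z| `^ p)%R by rewrite powR_gt0// lt_neqAle eq_sym fz normr_ge0.
      move: If; rewrite (eq_integral (cst (`|f z| `^ p)%:E)); last by move=> w _; rewrite (one w z).
      by rewrite integral_cst// [X in _ * X]nuy gt0_muley// ltxx.
    apply: filterE => z; rewrite (_ : (fun r => _) = cst 0); first exact: cvg_cst.
    apply/funext => r; rewrite integral0_eq ?mule0// => x _.
    by rewrite f0 subrr normr0.
  - move=> f _; split => //.
      by rewrite L0 mul1e Lnorm_ge0.
    by rewrite H0 mul1e adde_ge0 ?HBnorm_ge0// Lnorm_ge0.
have fin := boundary_ball_fin dbl reg d00 d0d.
have ed (e : R) : e%:E <= diam B -> (2 * e)%:E <= 2%:E * diam B.
  by move=> h; rewrite EFinM lee_wpmul2l.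
pose P n := `[< (2 ^+ 10 * R1 n)%:E <= 2%:E * diam B >].
have PN (e : R) : (0 < e)%R -> e%:E <= diam B -> P (N e).
  by move=> e0 h; apply/asboolP; apply: le_trans (ed e h); rewrite lee_fin; exact: hN.
(* the highest collar allowed by the diameter; N e bounds n from above for all
   e <= diam, hence the sum in the definition of K *)
case: (ex_minnP (ex_intro P _ (PN d0 d00 d0d))) => n /asboolP nd nmin.
have S : trace_setting Cmu theta Ctheta (2 ^+ 10 * R1 n)%R mu i j nu.
  split => // z r r0 rn; have [_ h] := reg; apply: h => //.
  by apply: le_trans nd; rewrite lee_fin.
have [C1 hCn] := hC n.
exists (Ext i j nu (R1 n)), (C n); split => //.
- move=> e e0 he; have nN := nmin _ (PN e e0 he).
  rewrite -ltnS in nN; rewrite (bigD1 (Ordinal nN))//= lerDl sumr_ge0// => m _.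
  by have [+ _] := hC m; exact: le_trans.
- move=> a f g Bf Bg; have [lf _ _] := Besov_locint hp S Bf.
  by have [lg _ _] := Besov_locint hp S Bg; exact: (Ext_lin isoj sep).
- by move=> f Bf; exact: (Ext_trace alpha0 hp hq htheta Ct1 (R10 n) S Bf).
- by move=> f Bf; exact: hCn S _ Bf.
Qed.
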